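(* If $H$ is a quasi-Hopf algebra, then $H_0\,\underline{\otimes}\,H_0\simeq(H\otimes H)^{\Delta}$ as algebras in ${}_H^H\mathcal{YD}$.
   Context: Throughout, $k$ is a field, all algebras and linear spaces are over $k$, $\otimes=\otimes_k$. A quasi-bialgebra $(H,\Delta,\varepsilon,\Phi)$ is a unital associative algebra $H$ with algebra maps $\Delta:H\to H\otimes H$, $\varepsilon:H\to k$ and an invertible $\Phi\in H^{\otimes 3}$ such that for all $h\in H$: $(id\otimes\Delta)(\Delta(h))=\Phi(\Delta\otimes id)(\Delta(h))\Phi^{-1}$; $(id\otimes\varepsilon)(\Delta(h))=h=(\varepsilon\otimes id)(\Delta(h))$; $(1\otimes\Phi)(id\otimes\Delta\otimes id)(\Phi)(\Phi\otimes 1)=(id\otimes id\otimes\Delta)(\Phi)(\Delta\otimes id\otimes id)(\Phi)$; $(\varepsilon\otimes id\otimes id)(\Phi)=(id\otimes\varepsilon\otimes id)(\Phi)=(id\otimes id\otimes\varepsilon)(\Phi)=1\otimes 1$. Notation (summation understood): $\Delta(h)=h_1\otimes h_2$; $\Phi=X^1\otimes X^2\otimes X^3=Y^1\otimes Y^2\otimes Y^3=\cdots$ and $\Phi^{-1}=x^1\otimes x^2\otimes x^3=y^1\otimes y^2\otimes y^3=\cdots$ (different letters denote independent copies); lower indices denote components of $\Delta$, e.g. $\Delta(X^3)=X^3_1\otimes X^3_2$. A quasi-Hopf algebra is a quasi-bialgebra $H$ with an algebra anti-automorphism $S$ and $\alpha,\beta\in H$ such that $S(h_1)\alpha h_2=\varepsilon(h)\alpha$,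 $h_1\beta S(h_2)=\varepsilon(h)\beta$ for all $h$, $X^1\beta S(X^2)\alpha X^3=1$, $S(x^1)\alpha x^2\beta S(x^3)=1$; normalised (as one may) so that $\varepsilon(\alpha)=\varepsilon(\beta)=1$ and $\varepsilon\circ S=\varepsilon$. Drinfeld twist: let $A^1\otimes A^2\otimes A^3\otimes A^4=(\Phi\otimes 1)(\Delta\otimes id\otimes id)(\Phi^{-1})$, $B^1\otimes B^2\otimes B^3\otimes B^4=(\Delta\otimes id\otimes id)(\Phi)(\Phi^{-1}\otimes 1)$, $\gamma=S(A^2)\alpha A^3\otimes S(A^1)\alpha A^4$, $\delta=B^1\beta S(B^4)\otimes B^2\beta S(B^3)$, $\Delta^{cop}(h)=h_2\otimes h_1$. Then $f=f^1\otimes f^2=(S\otimes S)(\Delta^{cop}(x^1))\,\gamma\,\Delta(x^2\beta S(x^3))$ is invertible with inverse $f^{-1}=g^1\otimes g^2=\Delta(S(x^1)\alpha x^2)\,\delta\,(S\otimes S)(\Delta^{cop}(x^3))$. Also $q_R=q^1\otimes q^2=X^1\otimes S^{-1}(\alpha X^3)X^2$. A left $H$-module algebra is a left $H$-module $A$ with a multiplication and (usual) unit $1_A$ such that $(aa')a''=(X^1\cdot a)[(X^2\cdot a')(X^3\cdot a'')]$, $h\cdot(aa')=(h_1\cdot a)(h_2\cdot a')$, $h\cdot 1_A=\varepsilon(h)1_A$. A left Yetter-Drinfeld module over $H$ is a left $H$-module $M$ with a linear map $\lambda_M:M\to H\otimes M$, $\lambda_M(m)=m_{(-1)}\otimes m_{(0)}$,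 such that $X^1m_{(-1)}\otimes(X^2\cdot m_{(0)})_{(-1)}X^3\otimes(X^2\cdot m_{(0)})_{(0)}=X^1(Y^1\cdot m)_{(-1)_1}Y^2\otimes X^2(Y^1\cdot m)_{(-1)_2}Y^3\otimes X^3\cdot(Y^1\cdot m)_{(0)}$, $\varepsilon(m_{(-1)})m_{(0)}=m$, $h_1m_{(-1)}\otimes h_2\cdot m_{(0)}=(h_1\cdot m)_{(-1)}h_2\otimes(h_1\cdot m)_{(0)}$. Morphisms in ${}_H^H\mathcal{YD}$ are $H$-linear maps intertwining the coactions. For $M,N$ in ${}_H^H\mathcal{YD}$, $M\otimes N$ is in ${}_H^H\mathcal{YD}$ with action $h\cdot(m\otimes n)=h_1\cdot m\otimes h_2\cdot n$ and coaction $\lambda_{M\otimes N}(m\otimes n)=X^1(x^1Y^1\cdot m)_{(-1)}x^2(Y^2\cdot n)_{(-1)}Y^3\otimes X^2\cdot(x^1Y^1\cdot m)_{(0)}\otimes X^3x^3\cdot(Y^2\cdot n)_{(0)}$; associativity constraint $(u\otimes v)\otimes w\mapsto X^1\cdot u\otimes(X^2\cdot v\otimes X^3\cdot w)$; (pre)braiding $m\otimes n\mapsto m_{(-1)}\cdot n\otimes m_{(0)}$. An algebra in ${}_H^H\mathcal{YD}$ is a left $H$-module algebra $A$ that is a Yetter-Drinfeld module with $\lambda_A(1_A)=1\otimes 1_A$ and $\lambda_A(aa')=X^1(x^1Y^1\cdot a)_{(-1)}x^2(Y^2\cdot a')_{(-1)}Y^3\otimes[X^2\cdot(x^1Y^1\cdot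 a)_{(0)}][X^3x^3\cdot(Y^2\cdot a')_{(0)}]$; isomorphisms of such algebras are bijective unital multiplicative morphisms in ${}_H^H\mathcal{YD}$. If $B$ is an associative algebra and $v:H\to B$ an algebra map, $B^v$ is the left $H$-module algebra with underlying space $B$, multiplication $b\star b'=v(X^1)bv(S(x^1X^2)\alpha x^2X^3_1)b'v(S(x^3X^3_2))$, unit $v(\beta)$, action $h\triangleright_v b=v(h_1)bv(S(h_2))$. $H_0:=H^{id_H}$ (multiplication $*$, action $h\triangleright h'=h_1h'S(h_2)$) is an algebra in ${}_H^H\mathcal{YD}$ with coaction $h\mapsto h_{(-1)}\otimes h_{(0)}=X^1Y^1_1h_1g^1S(q^2Y^2_2)Y^3\otimes X^2Y^1_2h_2g^2S(X^3q^1Y^2_1)$. $H_0\,\underline{\otimes}\,H_0$ is the braided tensor product algebra in ${}_H^H\mathcal{YD}$: the object $H_0\otimes H_0$ with unit $\beta\otimes\beta$ and multiplication $(a\otimes h)(a'\otimes h')=(y^1X^1\triangleright a)*(y^2Y^1(x^1X^2\triangleright h)_{(-1)}x^2X^3_1\triangleright a')\otimes(y^3_1Y^2\triangleright(x^1X^2\triangleright h)_{(0)})*(y^3_2Y^3x^3X^3_2\triangleright h')$. $(H\otimes H)^{\Delta}$ is $B^v$ for $B=H\otimes H$ (usual tensor product algebra) and $v=\Delta$, with the following coaction making it an algebra in ${}_H^H\mathcal{YD}$. Put $\lambda:H\otimes H\to H\otimes(H\otimes H)$, $\lambda(h'\otimes h)=\Phi\cdot((\Delta\otimes id_H)(h'\otimes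 h))\cdot\Phi^{-1}$, and write $\lambda(b)=b_{[-1]}\otimes b_{[0]}$ for $b\in H\otimes H$ (together with $\Phi_\lambda=(id\otimes id\otimes\Delta)(\Phi)$, this makes $H\otimes H$ a left $H$-comodule algebra). The coaction is $b\mapsto X^1Y^1_1b_{[-1]}g^1S(q^2Y^2_2)Y^3\otimes\Delta(X^2Y^1_2)\,b_{[0]}\,\Delta(g^2S(X^3q^1Y^2_1))$. *)

(* Defs.v *)
From HB Require Import structures.
From mathcomp Require Import all_boot all_algebra generic_quotient.
From mathcomp Require Import boolp classical_sets.

Set Implicit Arguments.
Unset Strict Implicit.
Unset Printing Implicit Defensive.

Import GRing.Theory.
Local Open Scope ring_scope.
Local Open Scope quotient_scope.

Reserved Notation "V ⊗ W" (at level 45, right associativity).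
Reserved Notation "\tsum_ ( x ⊗ y <- t ) E"
  (at level 46, E at level 46, x name, y name, t at level 200,
   format "'[' \tsum_ ( x  ⊗  y  <-  t ) '/  '  E ']'").
Reserved Notation "\tsum_ ( x ⊗ y ⊗ z <- t ) E"
  (at level 46, E at level 46, x name, y name, z name, t at level 200,
   format "'[' \tsum_ ( x  ⊗  y  ⊗  z  <-  t ) '/  '  E ']'").

(* Two formal sums of pairs are identified when no bilinear map separates     *)
(* them: this is V (x) W, with its universal property built in (see           *)
(* tfold_linear, tfoldE and tfold_uniq below).                                *)
Section TensorProduct.
Variables (k : fieldType) (V W : lmodType k).

Definition bilin (U : lmodType k) (f : V -> W -> U) : Prop :=
  (forall v, linear (f v)) /\ (forall w, linear (f^~ w)).

Definition tens_eqv (s t : seq (V * W)) : bool :=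
  `[< forall (U : lmodType k) (f : V -> W -> U), bilin f ->
      \sum_(p <- s) f p.1 p.2 = \sum_(p <- t) f p.1 p.2 >].

Fact tens_eqv_refl : reflexive tens_eqv.
Proof. by move=> s; apply/asboolP. Qed.

Fact tens_eqv_sym : symmetric tens_eqv.
Proof.
by move=> s t; apply/asboolP/asboolP => h U f bf; rewrite (h U f bf).
Qed.

Fact tens_eqv_trans : transitive tens_eqv.
Proof.
move=> t s u /asboolP h1 /asboolP h2; apply/asboolP => U f bf.
by rewrite (h1 U f bf) (h2 U f bf).
Qed.

Canonical tens_equiv :=
  EquivRel tens_eqv tens_eqv_refl tens_eqv_sym tens_eqv_trans.

Definition tensor := {eq_quot tens_equiv}.

HB.instance Definition _ := Choice.on tensor.

Definition tpure (v : V) (w : W) : tensor := \pi_tensor [:: (v, w)].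

(* For t = \sum_i v_i (x) w_i, tfold f t = \sum_i f v_i w_i. The              *)
(* representation of t is an arbitrary one, so this is meaningful only for    *)
(* bilinear f, which is how it is always used.                                *)
Definition tfold (U : nmodType) (f : V -> W -> U) (t : tensor) : U :=
  \sum_(p <- repr t) f p.1 p.2.

Lemma tfold_pi (U : lmodType k) (f : V -> W -> U) (s : seq (V * W)) :
  bilin f -> tfold f (\pi_tensor s) = \sum_(p <- s) f p.1 p.2.
Proof.
move=> bf; rewrite /tfold.
have /eqmodP/asboolP : repr (\pi_tensor s) = s %[mod tensor] by rewrite reprK.
by apply.
Qed.

Lemma tensorP (x y : tensor) :
  (forall (U : lmodType k) (f : V -> W -> U), bilin f ->
     tfold f x = tfold f y) -> x = y.
Proof.
move=> h; rewrite -[x]reprK -[y]reprK; apply/eqmodP/asboolP => U f bf.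
exact: h.
Qed.

Lemma bilinDl (U : lmodType k) (f : V -> W -> U) : bilin f ->
  forall v v' w, f (v + v') w = f v w + f v' w.
Proof. by move=> [_ h] v v' w; have := h w 1 v v'; rewrite !scale1r. Qed.

Lemma bilinDr (U : lmodType k) (f : V -> W -> U) : bilin f ->
  forall v w w', f v (w + w') = f v w + f v w'.
Proof. by move=> [h _] v w w'; have := h v 1 w w'; rewrite !scale1r. Qed.

Lemma bilin0l (U : lmodType k) (f : V -> W -> U) : bilin f ->
  forall w, f 0 w = 0.
Proof.
by move=> bf w; apply: (addrI (f 0 w)); rewrite -bilinDl // !addr0.
Qed.

Lemma bilin0r (U : lmodType k) (f : V -> W -> U) : bilin f ->
  forall v, f v 0 = 0.
Proof.
by move=> bf v; apply: (addrI (f v 0)); rewrite -bilinDr // !addr0.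
Qed.

Lemma bilinZl (U : lmodType k) (f : V -> W -> U) : bilin f ->
  forall a v w, f (a *: v) w = a *: f v w.
Proof.
by move=> bf a v w; have := bf.2 w a v 0; rewrite !addr0 bilin0l // addr0.
Qed.

Lemma bilinZr (U : lmodType k) (f : V -> W -> U) : bilin f ->
  forall a v w, f v (a *: w) = a *: f v w.
Proof.
by move=> bf a v w; have := bf.1 v a w 0; rewrite !addr0 bilin0r // addr0.
Qed.

Definition tzero : tensor := \pi_tensor [::].
Definition tadd (x y : tensor) : tensor := \pi_tensor (repr x ++ repr y).
Definition tscale (a : k) (x : tensor) : tensor :=
  \pi_tensor [seq (a *: p.1, p.2) | p <- repr x].
Definition topp : tensor -> tensor := tscale (-1).

Lemma tfold_tzero (U : lmodType k) (f : V -> W -> U) :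
  bilin f -> tfold f tzero = 0.
Proof. by move=> bf; rewrite tfold_pi // big_nil. Qed.

Lemma tfold_tadd (U : lmodType k) (f : V -> W -> U) x y :
  bilin f -> tfold f (tadd x y) = tfold f x + tfold f y.
Proof. by move=> bf; rewrite tfold_pi // big_cat. Qed.

Lemma tfold_tscale (U : lmodType k) (f : V -> W -> U) a x :
  bilin f -> tfold f (tscale a x) = a *: tfold f x.
Proof.
move=> bf; rewrite tfold_pi // big_map scaler_sumr.
by apply: eq_bigr => p _; rewrite bilinZl.
Qed.

Fact taddA : associative tadd.
Proof. by move=> x y z; apply: tensorP => U f bf; rewrite !tfold_tadd // addrA. Qed.
Fact taddC : commutative tadd.
Proof. by move=> x y; apply: tensorP => U f bf; rewrite !tfold_tadd // addrC. Qed.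
Fact tadd0 : left_id tzero tadd.
Proof.
by move=> x; apply: tensorP => U f bf; rewrite !tfold_tadd // tfold_tzero // add0r.
Qed.
Fact taddN : left_inverse tzero topp tadd.
Proof.
move=> x; apply: tensorP => U f bf.
by rewrite tfold_tadd // tfold_tscale // tfold_tzero // scaleN1r addNr.
Qed.
HB.instance Definition _ := GRing.isZmodule.Build tensor taddA taddC tadd0 taddN.

Fact tscaleA a b x : tscale a (tscale b x) = tscale (a * b) x.
Proof. by apply: tensorP => U f bf; rewrite !tfold_tscale // scalerA. Qed.
Fact tscale1 : left_id 1 tscale.
Proof. by move=> x; apply: tensorP => U f bf; rewrite tfold_tscale // scale1r. Qed.
Fact tscaleDr : right_distributive tscale +%R.
Proof.
move=> a x y; apply: tensorP => U f bf.
by rewrite !(tfold_tscale, tfold_tadd) // scalerDr.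
Qed.
Fact tscaleDl x : {morph tscale^~ x : a b / a + b}.
Proof.
move=> a b; apply: tensorP => U f bf.
by rewrite !(tfold_tscale, tfold_tadd) // scalerDl.
Qed.
HB.instance Definition _ :=
  GRing.Zmodule_isLmodule.Build k tensor tscaleA tscale1 tscaleDr tscaleDl.

Lemma tfold_linear (U : lmodType k) (f : V -> W -> U) :
  bilin f -> linear (tfold f).
Proof. by move=> bf a x y; rewrite tfold_tadd // tfold_tscale. Qed.

Lemma tfoldE (U : lmodType k) (f : V -> W -> U) v w :
  bilin f -> tfold f (tpure v w) = f v w.
Proof. by move=> bf; rewrite tfold_pi // big_seq1. Qed.

Lemma tpure_bilin : bilin tpure.
Proof.
split=> [v a w w'|w a v v']; apply: tensorP => U f bf;
  rewrite (tfold_linear bf) !tfoldE //.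
- by rewrite bilinDr // bilinZr.
- by rewrite bilinDl // bilinZl.
Qed.

Lemma tfold_tpure (t : tensor) : t = tfold tpure t.
Proof.
apply: tensorP => U f bf; rewrite [tfold tpure t]/tfold.
have : forall s : seq (V * W), tfold f (\sum_(p <- s) tpure p.1 p.2)
    = \sum_(p <- s) f p.1 p.2.
  elim=> [|p s IH]; first by rewrite !big_nil tfold_tzero.
  by rewrite !big_cons tfold_tadd // tfoldE // IH.
by move->.
Qed.

Lemma tfold_uniq (U : lmodType k) (f g : {linear tensor -> U}) :
  (forall v w, f (tpure v w) = g (tpure v w)) -> f =1 g.
Proof.
move=> h t; rewrite (tfold_tpure t) /tfold !linear_sum /=.
by apply: eq_bigr => p _; apply: h.
Qed.

End TensorProduct.

Notation "V ⊗ W" := (tensor V%type W%type) : type_scope.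
Notation "v ⊗ w" := (tpure v w) : ring_scope.

(* Sweedler-style summation over a decomposition of t; triple tensors are     *)
(* right-nested: U ⊗ V ⊗ W is U ⊗ (V ⊗ W).                                    *)
Notation "\tsum_ ( x ⊗ y <- t ) E" := (tfold (fun x y => E) t) : ring_scope.
Notation "\tsum_ ( x ⊗ y ⊗ z <- t ) E" :=
  (tfold (fun x u => tfold (fun y z => E) u) t) : ring_scope.

(* Needed for 1 ⊗ 1 != 0, i.e. for A ⊗ B to be an algType. *)
Lemma exists_functional (k : fieldType) (V : lmodType k) (v : V) :
  v != 0 -> exists phi : V -> k^o, linear phi /\ phi v = 1.
Proof.
move=> v0.
pose closed (A : set V) := forall a x y, A x -> A y -> A (a *: x + y).
pose P : set (set V) := fun A => closed A /\ ~ A v.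
have [|W [[Wcl Wv] Wmax]] := @Zorn_bigcup V P.
  move=> F FP Ftot; split; last by case=> A FA Av; have [_] := FP _ FA; apply.
  move=> a x y [A FA Ax] [B FB By].
  have [AB|BA] := Ftot _ _ FA FB.
    by exists B => //; have [+ _] := FP _ FB; apply=> //; apply: AB.
  by exists A => //; have [+ _] := FP _ FA; apply=> //; apply: BA.
have W0 : W 0.
  apply: contrapT => nW0.
  have WE x : ~ W x.
    by move=> Wx; apply: nW0; have := Wcl (-1) _ _ Wx Wx; rewrite scaleN1r addNr.
  apply: (Wmax [set 0]%classic).
    by split; [move=> x /WE|move=> /(_ 0 erefl)/WE].
  by split=> [a x y -> ->|/= /eqP]; [rewrite scaler0 addr0|rewrite (negbTE v0)].
have WZ a x : W x -> W (a *: x) by move=> Wx; rewrite -[_ *: _]addr0; apply: Wcl.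
have WD x y : W x -> W y -> W (x + y).
  by move=> Wx Wy; rewrite -[x]scale1r; apply: Wcl.
have ex x : exists c : k, W (x - c *: v).
  have [Wx|nWx] := pselect (W x); first by exists 0; rewrite scale0r subr0.
  pose W' : set V := fun z => exists c w, W w /\ z = w + c *: x.
  have : ~ P W'.
    apply: Wmax; split; first by move=> w Ww; exists 0, w; rewrite scale0r addr0.
    by move=> /(_ x) sub; apply: nWx; apply: sub; exists 1, 0; rewrite scale1r add0r.
  have W'cl : closed W'.
    move=> a _ _ [c [w [Ww ->]]] [c' [w' [Ww' ->]]].
    exists (a * c + c'), (a *: w + w'); split; first exact: Wcl.
    by rewrite scalerDr scalerDl scalerA addrACA.
  move=> nP; have [c [w [Ww vE]]] : W' v by apply: contrapT => nv; apply: nP.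
  have c0 : c != 0.
    by apply/eqP => c0; apply: Wv; rewrite vE c0 scale0r addr0.
  exists c^-1; rewrite vE scalerDr scalerA mulVf // scale1r opprD.
  by rewrite addrCA subrr addr0 -scaleNr; apply: WZ.
have uniq_c c c' x : W (x - c *: v) -> W (x - c' *: v) -> c = c'.
  move=> Wc Wc'; apply/eqP; rewrite -subr_eq0; apply: contrapT => /negP d0.
  apply: Wv; rewrite -[v]scale1r -(mulVf d0) -scalerA; apply: WZ.
  have := Wcl (-1) _ _ Wc Wc'.
  by rewrite scaleN1r opprB addrA subrK -scalerBl.
pose phi x : k^o := projT1 (cid (ex x)).
have phiP x : W (x - phi x *: v) by rewrite /phi; case: cid.
exists phi; split=> [a x y|].
  apply: (uniq_c _ _ (a *: x + y)); first exact: phiP.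
  have := Wcl a _ _ (phiP x) (phiP y).
  by rewrite scalerBr scalerA addrACA -opprD -scalerDl.
by apply: (uniq_c _ _ v); [exact: phiP|rewrite scale1r subrr].
Qed.

Section TensorAlgebra.
Variables (k : fieldType) (A B : algType k).

Definition tmul (x y : A ⊗ B) : A ⊗ B :=
  \tsum_(a ⊗ b <- x) \tsum_(a' ⊗ b' <- y) (a * a') ⊗ (b * b').
Definition tone : A ⊗ B := 1 ⊗ 1.

Let tmulI_bilin a b :
  bilin (fun (a' : A) (b' : B) => (a * a') ⊗ (b * b')).
Proof.
split=> [a' c x y|b' c x y]; rewrite mulrDr -scalerAr.
- by rewrite (bilinDr (tpure_bilin _ _)) (bilinZr (tpure_bilin _ _)).
- by rewrite (bilinDl (tpure_bilin _ _)) (bilinZl (tpure_bilin _ _)).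
Qed.

Let tmulO_bilin (y : A ⊗ B) :
  bilin (fun (a : A) (b : B) => \tsum_(a' ⊗ b' <- y) (a * a') ⊗ (b * b')).
Proof.
split=> [a c x x'|b c x x']; rewrite /tfold scaler_sumr -big_split /=;
  apply: eq_bigr => p _; rewrite mulrDl -scalerAl.
- by rewrite (bilinDr (tpure_bilin _ _)) (bilinZr (tpure_bilin _ _)).
- by rewrite (bilinDl (tpure_bilin _ _)) (bilinZl (tpure_bilin _ _)).
Qed.

Let tmul_bilin : bilin tmul.
Proof.
split=> [x c y y'|y c x x']; last exact: tfold_linear (tmulO_bilin y) c x x'.
rewrite /tmul /tfold scaler_sumr -big_split /=; apply: eq_bigr => p _.
exact: tfold_linear (tmulI_bilin p.1 p.2) c y y'.
Qed.

Lemma tmulE a b a' b' : tmul (a ⊗ b) (a' ⊗ b') = (a * a') ⊗ (b * b').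
Proof. by rewrite /tmul (tfoldE _ _ (tmulO_bilin _)) (tfoldE _ _ (tmulI_bilin _ _)). Qed.

Let tensor_ind (P : A ⊗ B -> Prop) :
  P 0 -> (forall x y, P x -> P y -> P (x + y)) ->
  (forall a b, P (a ⊗ b)) -> forall t, P t.
Proof.
move=> P0 PD Pp t; rewrite (tfold_tpure t) /tfold.
by apply: (big_ind P) => // p _; apply: Pp.
Qed.

Fact tmulDl : left_distributive tmul +%R.
Proof. by move=> x y z; apply: bilinDl tmul_bilin _ _ _. Qed.
Fact tmulDr : right_distributive tmul +%R.
Proof. by move=> x y z; apply: bilinDr tmul_bilin _ _ _. Qed.

Fact tmulA : associative tmul.
Proof.
have b := tmul_bilin.
elim/tensor_ind=> [y z|x x' IH IH' y z|a1 b1]; first by rewrite !(bilin0l b).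
  by rewrite !tmulDl IH IH'.
elim/tensor_ind=> [z|y y' IH IH' z|a2 b2].
- by rewrite (bilin0l b) !(bilin0r b) (bilin0l b).
- by rewrite tmulDr !tmulDl tmulDr IH IH'.
elim/tensor_ind=> [|z z' IH IH'|a3 b3]; first by rewrite !(bilin0r b).
  by rewrite !tmulDr IH IH'.
by rewrite !tmulE !mulrA.
Qed.

Fact tmul1l : left_id tone tmul.
Proof.
elim/tensor_ind=> [|x y IHx IHy|a b]; first by rewrite (bilin0r tmul_bilin).
  by rewrite tmulDr IHx IHy.
by rewrite tmulE !mul1r.
Qed.

Fact tmul1r : right_id tone tmul.
Proof.
elim/tensor_ind=> [|x y IHx IHy|a b]; first by rewrite (bilin0l tmul_bilin).
  by rewrite tmulDl IHx IHy.
by rewrite tmulE !mulr1.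
Qed.

Fact tone_neq0 : tone != 0.
Proof.
have [phi [lphi phi1]] := exists_functional (oner_neq0 A).
have [psi [lpsi psi1]] := exists_functional (oner_neq0 B).
have b : bilin (fun a b => (phi a * psi b : k^o)).
  split=> [a c x y|x c a b]; first by rewrite lpsi mulrDr mulrCA.
  by rewrite lphi mulrDl -mulrA.
apply/eqP => /(congr1 (tfold (fun a b => (phi a * psi b : k^o)))).
rewrite tfoldE // phi1 psi1 mulr1 (tfold_tzero b).
by apply/eqP; rewrite oner_neq0.
Qed.

HB.instance Definition _ := GRing.Zmodule_isNzRing.Build (tensor A B)
  tmulA tmul1l tmul1r tmulDl tmulDr tone_neq0.

Fact tscaleAl c (x y : A ⊗ B) : c *: (x * y) = (c *: x) * y.
Proof. by rewrite [RHS](bilinZl tmul_bilin). Qed.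
HB.instance Definition _ := GRing.Lmodule_isLalgebra.Build k (tensor A B) tscaleAl.

Fact tscaleAr c (x y : A ⊗ B) : c *: (x * y) = x * (c *: y).
Proof. by rewrite [RHS](bilinZr tmul_bilin). Qed.
HB.instance Definition _ := GRing.Lalgebra_isAlgebra.Build k (tensor A B) tscaleAr.

End TensorAlgebra.

Section TensorMaps.
Variable k : fieldType.

(* id ⊗ f *)
Definition id_tens (U V W : lmodType k) (f : V -> W) (t : U ⊗ V) : U ⊗ W :=
  \tsum_(u ⊗ v <- t) u ⊗ f v.

(* f ⊗ id, followed by the identification of (V ⊗ W) ⊗ U with V ⊗ W ⊗ U *)
Definition tens_id (T U V W : lmodType k) (f : T -> V ⊗ W) (t : T ⊗ U) :
    V ⊗ W ⊗ U :=
  \tsum_(s ⊗ u <- t) \tsum_(v ⊗ w <- f s) v ⊗ w ⊗ u.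

End TensorMaps.

HB.mixin Record Algebra_isQuasiBialgebra (k : fieldType) H
    of GRing.Algebra k H := {
  comult : {lrmorphism H -> tensor H H};
  counit : {lrmorphism H -> k | *%R};
  reassoc : tensor H (tensor H H);
  reassocV : tensor H (tensor H H);
  reassocK : reassoc * reassocV = 1;
  reassocVK : reassocV * reassoc = 1;
  comultA : forall h : H,
    id_tens comult (comult h) = reassoc * tens_id comult (comult h) * reassocV;
  comult_counitr : forall h : H,
    \tsum_(h1 ⊗ h2 <- comult h) counit h2 *: h1 = h;
  comult_counitl : forall h : H,
    \tsum_(h1 ⊗ h2 <- comult h) counit h1 *: h2 = h;
  reassoc_cocycle :
    (1 ⊗ reassoc) * id_tens (tens_id comult) reassoc
      * (\tsum_(X1 ⊗ X2 ⊗ X3 <- reassoc) X1 ⊗ X2 ⊗ X3 ⊗ (1 : H))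
    = id_tens (id_tens comult) reassoc * tens_id comult reassoc;
  reassoc_counit1 :
    \tsum_(X1 ⊗ X2 ⊗ X3 <- reassoc) counit X1 *: (X2 ⊗ X3) = 1;
  reassoc_counit2 :
    \tsum_(X1 ⊗ X2 ⊗ X3 <- reassoc) counit X2 *: (X1 ⊗ X3) = 1;
  reassoc_counit3 :
    \tsum_(X1 ⊗ X2 ⊗ X3 <- reassoc) counit X3 *: (X1 ⊗ X2) = 1
}.

#[short(type="quasiBialgType")]
HB.structure Definition QuasiBialgebra (k : fieldType) :=
  {H of Algebra_isQuasiBialgebra k H & GRing.Algebra k H}.

Arguments reassoc {k} s.
Arguments reassocV {k} s.

HB.mixin Record QuasiBialgebra_isQuasiHopf (k : fieldType) H
    of QuasiBialgebra k H := {
  antipode : {linear H -> H};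
  antipodeV : H -> H;
  antipodeK : cancel antipode antipodeV;
  antipodeVK : cancel antipodeV antipode;
  antipode1 : antipode 1 = 1;
  antipodeM : forall x y : H, antipode (x * y) = antipode y * antipode x;
  alpha : H;
  beta : H;
  antipode_alpha : forall h : H,
    \tsum_(h1 ⊗ h2 <- comult h) antipode h1 * alpha * h2 = counit h *: alpha;
  antipode_beta : forall h : H,
    \tsum_(h1 ⊗ h2 <- comult h) h1 * beta * antipode h2 = counit h *: beta;
  antipode_reassoc :
    \tsum_(X1 ⊗ X2 ⊗ X3 <- reassoc H)
      X1 * beta * antipode X2 * alpha * X3 = 1;
  antipode_reassocV :
    \tsum_(x1 ⊗ x2 ⊗ x3 <- reassocV H)
      antipode x1 * alpha * x2 * beta * antipode x3 = 1;
  counit_alpha : counit alpha = 1;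
  counit_beta : counit beta = 1;
  counit_antipode : forall h : H, counit (antipode h) = counit h
}.

#[short(type="quasiHopfAlgType")]
HB.structure Definition QuasiHopf (k : fieldType) :=
  {H of QuasiBialgebra_isQuasiHopf k H & QuasiBialgebra k H}.

Arguments alpha {k} s.
Arguments beta {k} s.
Arguments antipodeV {k s}.

Section QuasiHopfElements.
Variables (k : fieldType) (H : quasiHopfAlgType k).

Local Notation Δ := (@comult k H).
Local Notation S := (@antipode k H).
Local Notation "'Φ'" := (reassoc H).
Local Notation "'Φ⁻'" := (reassocV H).
Local Notation α := (alpha H).
Local Notation β := (beta H).

(* B^1 ⊗ B^2 ⊗ B^3 ⊗ B^4 in the formula for delta *)
Definition twistB : H ⊗ H ⊗ H ⊗ H :=
  tens_id Δ Φ * (\tsum_(x1 ⊗ x2 ⊗ x3 <- Φ⁻) x1 ⊗ x2 ⊗ x3 ⊗ (1 : H)).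

Definition twist_delta : H ⊗ H :=
  \tsum_(B1 ⊗ u <- twistB) \tsum_(B2 ⊗ B3 ⊗ B4 <- u)
    B1 * β * S B4 ⊗ B2 * β * S B3.

(* The inverse f^{-1} = g^1 ⊗ g^2 of the Drinfeld twist *)
Definition drinfeld_twistV : H ⊗ H :=
  \tsum_(x1 ⊗ x2 ⊗ x3 <- Φ⁻)
    Δ (S x1 * α * x2) * twist_delta
      * (\tsum_(x31 ⊗ x32 <- Δ x3) S x32 ⊗ S x31).

Definition q_R : H ⊗ H :=
  \tsum_(X1 ⊗ X2 ⊗ X3 <- Φ) X1 ⊗ antipodeV (α * X3) * X2.

(* The operations carried by an algebra in the category of left               *)
(* Yetter-Drinfeld modules over H: its laws are not part of the record, since *)
(* an isomorphism of such algebras only involves the operations.              *)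
Record ydAlgData := YDAlgData {
  yd_sort :> lmodType k;
  yd_act : H -> yd_sort -> yd_sort;
  yd_coact : yd_sort -> H ⊗ yd_sort;
  yd_mul : yd_sort -> yd_sort -> yd_sort;
  yd_one : yd_sort
}.

Definition yd_algebra_iso (A B : ydAlgData) (phi : {linear A -> B}) : Prop :=
  [/\ bijective phi,
      forall (h : H) (a : A), phi (yd_act h a) = yd_act h (phi a),
      forall a : A, yd_coact (phi a) = id_tens phi (yd_coact a),
      phi (yd_one A) = yd_one B
    & forall a a' : A, phi (yd_mul a a') = yd_mul (phi a) (phi a')].

Definition yd_algebra_isomorphic (A B : ydAlgData) : Prop :=
  exists phi : {linear A -> B}, yd_algebra_iso phi.

Section BraidedTensor.
Variables M N : ydAlgData.

Local Notation "h ▷ m" := (yd_act h m) (at level 42, right associativity).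
Local Notation "m ∗ n" := (yd_mul m n) (at level 43, left associativity).
Local Notation λ m := (yd_coact m).

Definition braided_act (h : H) (t : M ⊗ N) : M ⊗ N :=
  \tsum_(h1 ⊗ h2 <- Δ h) \tsum_(m ⊗ n <- t) (h1 ▷ m) ⊗ (h2 ▷ n).

Definition braided_coact (t : M ⊗ N) : H ⊗ M ⊗ N :=
  \tsum_(m ⊗ n <- t)
  \tsum_(X1 ⊗ X2 ⊗ X3 <- Φ)
  \tsum_(Y1 ⊗ Y2 ⊗ Y3 <- Φ)
  \tsum_(x1 ⊗ x2 ⊗ x3 <- Φ⁻)
  \tsum_(m_1 ⊗ m_0 <- λ (x1 * Y1 ▷ m))
  \tsum_(n_1 ⊗ n_0 <- λ (Y2 ▷ n))
    X1 * m_1 * x2 * n_1 * Y3 ⊗ (X2 ▷ m_0) ⊗ (X3 * x3 ▷ n_0).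

Definition braided_mul (t t' : M ⊗ N) : M ⊗ N :=
  \tsum_(a ⊗ h <- t)
  \tsum_(a' ⊗ h' <- t')
  \tsum_(X1 ⊗ X2 ⊗ X3 <- Φ)
  \tsum_(Y1 ⊗ Y2 ⊗ Y3 <- Φ)
  \tsum_(x1 ⊗ x2 ⊗ x3 <- Φ⁻)
  \tsum_(y1 ⊗ y2 ⊗ y3 <- Φ⁻)
  \tsum_(X31 ⊗ X32 <- Δ X3)
  \tsum_(y31 ⊗ y32 <- Δ y3)
  \tsum_(h_1 ⊗ h_0 <- λ (x1 * X2 ▷ h))
    (y1 * X1 ▷ a) ∗ (y2 * Y1 * h_1 * x2 * X31 ▷ a')
    ⊗ (y31 * Y2 ▷ h_0) ∗ (y32 * Y3 * x3 * X32 ▷ h').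

Definition braided_tensor : ydAlgData :=
  YDAlgData braided_act braided_coact braided_mul (yd_one M ⊗ yd_one N).

End BraidedTensor.

(* B^v with the Yetter-Drinfeld coaction induced by a left H-comodule algebra *)
(* structure λ on B, b_[-1] ⊗ b_[0] being λ b.                                *)
Section TwistedAlgebra.
Variables (B : algType k) (v : {lrmorphism H -> B}) (λ : B -> H ⊗ B).

Definition twisted_act (h : H) (b : B) : B :=
  \tsum_(h1 ⊗ h2 <- Δ h) v h1 * b * v (S h2).

Definition twisted_mul (b b' : B) : B :=
  \tsum_(X1 ⊗ X2 ⊗ X3 <- Φ)
  \tsum_(x1 ⊗ x2 ⊗ x3 <- Φ⁻)
  \tsum_(X31 ⊗ X32 <- Δ X3)
    v X1 * b * v (S (x1 * X2) * α * x2 * X31) * b' * v (S (x3 * X32)).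

Definition twisted_coact (b : B) : H ⊗ B :=
  \tsum_(X1 ⊗ X2 ⊗ X3 <- Φ)
  \tsum_(Y1 ⊗ Y2 ⊗ Y3 <- Φ)
  \tsum_(Y11 ⊗ Y12 <- Δ Y1)
  \tsum_(Y21 ⊗ Y22 <- Δ Y2)
  \tsum_(q1 ⊗ q2 <- q_R)
  \tsum_(g1 ⊗ g2 <- drinfeld_twistV)
  \tsum_(b_1 ⊗ b_0 <- λ b)
    X1 * Y11 * b_1 * g1 * S (q2 * Y22) * Y3
    ⊗ v (X2 * Y12) * b_0 * v (g2 * S (X3 * q1 * Y21)).

Definition twisted_algebra : ydAlgData :=
  YDAlgData twisted_act twisted_coact twisted_mul (v β).

End TwistedAlgebra.

Definition H0 : ydAlgData := twisted_algebra idfun Δ.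

Definition HH_coact (b : H ⊗ H) : H ⊗ H ⊗ H := Φ * tens_id Δ b * Φ⁻.

Definition HH_Delta : ydAlgData := twisted_algebra Δ HH_coact.

End QuasiHopfElements.

Arguments H0 {k} H.
Arguments HH_Delta {k} H.

(* Main.v *)
Require Import Defs.
From mathcomp Require Import all_boot all_algebra.
From HB Require Import structures.
From mathcomp Require Import boolp.

(* An element b of B^v acts on every B-module X by an H-linear map              *)
(* b ⊗ x ↦ v(X^1) b v(S(X^2) α X^3) x, natural in X, and b is recovered from the *)
(* actions of its H-translates. The product of B^v is composition of actions,   *)
(* and the coaction is the half-braiding for which acting on N ⊗ X, through the *)
(* comodule algebra structure of B, is moving b past N and then acting on X. So *)
(* a map into (H ⊗ H)^Δ is determined by the induced action on X ⊗ Y, for X and *)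
(* Y two H-modules. The isomorphism sends a ⊗ h to the element that acts as h   *)
(* on X ⊗ Y, then as a on X alone. It is multiplicative since the action of a'  *)
(* on X alone is H-linear, so it commutes with the action of h up to braiding h *)
(* past a'; it is colinear by the same description of the coaction. What is     *)
(* left is coherence: pentagons and naturality of Φ and of the braiding.        *)
(* The formula for the coaction contains the Drinfeld twist f⁻¹; all that is    *)
(* used of it is Δ(S(h)) f⁻¹ = f⁻¹ (S ⊗ S)Δ^cop(h) and Δ(α) = f⁻¹ γ.            *)

Set Implicit Arguments.
Unset Strict Implicit.
Unset Printing Implicit Defensive.

Import GRing.Theory.
Local Open Scope ring_scope.

(* An element of B^v is studied through its action on modules, [ev]. This loses nothing: [ev_rec]
   rebuilds b from the actions of its translates, [ev_act] says that the action map is H-linear, and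
   [ev_mul] that the product is composition. For coactions the test is the action on N ⊗ X, [co_ev]:
   [co_ev_coact] characterises the coaction of B^v by it, and [coact_uniq] says that two maps into H
   ⊗ B satisfying the Yetter-Drinfeld compatibility agree once they agree after [co_ev].

   For B = H ⊗ H the elements become operators on X ⊗ Y, and each factor of H_0 ⊗ H_0 supplies some:
   h acts on the whole of X ⊗ Y through Δ, while a acts on X alone ([evl]). The map [iso] composes
   the two, which is the content of [evT_iso]. The claims then concern composition of operators. The
   unit is preserved because β acts as the identity. For products, h must be exchanged with a'
   acting on X alone; [cop_evA_evl_sum] shows that the cost of this exchange is exactly the
   braiding, and [mult_coherence] compares the bracketings. For coactions, h and a are moved past N
   one after the other, and [coact_coherence] compares the two ways of doing so. Bijectivity is read
   off the formula: [iso_bij] factors it into three maps with explicit inverses.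

   All computations are on Sweedler sums. The tactic [sweedler] takes care of distributing and
   reordering; each [step] is then one genuine move: a pentagon, a naturality square of Φ or of the
   braiding, or the absorption of components of Δ(h) by α or β. *)
Reserved Notation "a ⊠ b" (at level 45, right associativity).
Reserved Notation "\S_ ( x , y <- t ) E"
  (at level 46, E at level 46, x name, y name, t at level 200,
   format "'[' \S_ ( x ,  y  <-  t ) '/  '  E ']'").
Reserved Notation "\S_ ( x , y , z <- t ) E"
  (at level 46, E at level 46, x name, y name, z name, t at level 200,
   format "'[' \S_ ( x ,  y ,  z  <-  t ) '/  '  E ']'").

(** * Multilinear maps and Sweedler sums *)

Section Linearity.
Variable k : fieldType.
Implicit Types U V W : lmodType k.

(** A bare predicate instead of a bundled morphism: what has to be linear is an expression in one of
    its slots, and the tactic [lin] proves this by recursion on the expression. *)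
Definition lin V U (f : V -> U) : Prop :=
  forall a x y, f (a *: x + y) = a *: f x + f y.

Definition lin2 V W U (f : V -> W -> U) : Prop :=
  (forall v, lin (f v)) /\ (forall w, lin (fun v => f v w)).

Definition lin3 V1 V2 V3 U (f : V1 -> V2 -> V3 -> U) : Prop :=
  [/\ forall b c, lin (fun a => f a b c), forall a c, lin (fun b => f a b c)
    & forall a b, lin (f a b)].

Definition lin4 V1 V2 V3 V4 U (f : V1 -> V2 -> V3 -> V4 -> U) : Prop :=
  [/\ forall b c d, lin (fun a => f a b c d), forall a c d, lin (fun b => f a b c d),
      forall a b d, lin (fun c => f a b c d) & forall a b c, lin (f a b c)].

Lemma lin_id U : lin (fun x : U => x).
Proof. by []. Qed.

Lemma lin_comp V W U (f : W -> U) (g : V -> W) :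
  lin f -> lin g -> lin (fun x => f (g x)).
Proof. by move=> lf lg a x y; rewrite lg lf. Qed.

Lemma lin_linear V U (f : {linear V -> U}) : lin f.
Proof. by move=> a x y; rewrite linearP. Qed.

Lemma lin_mull V (A : algType k) (g : V -> A) c : lin g -> lin (fun x => g x * c).
Proof. by move=> lg a x y; rewrite lg mulrDl scalerAl. Qed.

Lemma lin_mulr V (A : algType k) (g : V -> A) c : lin g -> lin (fun x => c * g x).
Proof. by move=> lg a x y; rewrite lg mulrDr scalerAr. Qed.

Lemma lin_scaler V U (g : V -> U) (c : k) : lin g -> lin (fun x => c *: g x).
Proof. by move=> lg a x y; rewrite lg scalerDr !scalerA mulrC. Qed.

Lemma lin0 V U (f : V -> U) : lin f -> f 0 = 0.
Proof. by move=> lf; have := lf (-1) 0 0; rewrite scaler0 addr0 scaleN1r addNr. Qed.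

Lemma linD V U (f : V -> U) : lin f -> {morph f : x y / x + y}.
Proof. by move=> lf x y; have := lf 1 x y; rewrite !scale1r. Qed.

Lemma linZ V U (f : V -> U) : lin f -> forall a x, f (a *: x) = a *: f x.
Proof. by move=> lf a x; have := lf a x 0; rewrite !addr0 (lin0 lf) addr0. Qed.

Lemma lin_sum V U (f : V -> U) : lin f ->
  forall I (r : seq I) (F : I -> V), f (\sum_(i <- r) F i) = \sum_(i <- r) f (F i).
Proof. by move=> lf I r F; apply: (big_morph f (linD lf) (lin0 lf)). Qed.

End Linearity.

(* Structure inference on nested [_ ⊗ _] is exponentially slow; [tens], [tp]   *)
(* and [sum2] are opaque copies of [⊗], of pure tensors and of [tfold].        *)
Definition tens (k : fieldType) (A B : algType k) : algType k := (A ⊗ B)%type.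
Definition tp (k : fieldType) (A B : algType k) (a : A) (b : B) : tens A B := tpure a b.
Definition sum2 (k : fieldType) (A B : algType k) (U : lmodType k) (F : A -> B -> U)
  (t : tens A B) : U := tfold F t.
Definition sum3 (k : fieldType) (A B C : algType k) (U : lmodType k)
    (F : A -> B -> C -> U) (t : tens A (tens B C)) : U :=
  sum2 (fun a u => sum2 (F a) u) t.
Definition sum4 (k : fieldType) (A B C D : algType k) (U : lmodType k)
    (F : A -> B -> C -> D -> U) (t : tens A (tens B (tens C D))) : U :=
  sum2 (fun a u => sum3 (F a) u) t.

Notation "a ⊠ b" := (tp a b) : ring_scope.
Notation "\S_ ( x , y <- t ) E" := (sum2 (fun x y => E) t) : ring_scope.
Notation "\S_ ( x , y , z <- t ) E" := (sum3 (fun x y z => E) t) : ring_scope.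

Section Tensor.
Variable k : fieldType.
Implicit Types A B C D E : algType k.
Implicit Types U V W : lmodType k.

Lemma tpM A B (a a' : A) (b b' : B) : tp a b * tp a' b' = tp (a * a') (b * b').
Proof. exact: tmulE. Qed.

Lemma tp1 A B : (1 : tens A B) = tp 1 1.
Proof. reflexivity. Qed.

Lemma lin_tpl V A B (g : V -> A) (b : B) : lin g -> lin (fun x => g x ⊠ b).
Proof. by move=> lg a x y; rewrite lg; exact: (tpure_bilin _ _).2. Qed.

Lemma lin_tpr V A B (g : V -> B) (a : A) : lin g -> lin (fun x => a ⊠ g x).
Proof. by move=> lg c x y; rewrite lg; exact: (tpure_bilin _ _).1. Qed.

Lemma sum2_lin A B U (F : A -> B -> U) : lin2 F -> lin (sum2 F).
Proof. by move=> bF; apply: tfold_linear. Qed.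

Lemma sum2_tp A B U (F : A -> B -> U) a b : lin2 F -> sum2 F (a ⊠ b) = F a b.
Proof. by move=> bF; apply: tfoldE. Qed.

Lemma sum2_id A B (t : tens A B) : \S_(x, y <- t) x ⊠ y = t.
Proof. by rewrite {2}(tfold_tpure t). Qed.

Lemma eq_sum2 A B U (F G : A -> B -> U) t :
  (forall x y, F x y = G x y) -> sum2 F t = sum2 G t.
Proof. by move=> FG; apply: eq_bigr => p _. Qed.

Lemma sum2_map A B U V (f : U -> V) (F : A -> B -> U) t :
  lin f -> f (sum2 F t) = \S_(x, y <- t) f (F x y).
Proof. by move=> lf; rewrite /sum2 /tfold lin_sum. Qed.

Lemma lin_sum2 (X : lmodType k) A B U (F : X -> A -> B -> U) t :
  (forall a b, lin (fun x => F x a b)) -> lin (fun x => sum2 (F x) t).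
Proof.
move=> lF a x y; rewrite /sum2 /tfold scaler_sumr -big_split /=.
by apply: eq_bigr => p _; rewrite lF.
Qed.

Lemma sum2C A B C D U (F : A -> B -> C -> D -> U) s t :
  \S_(x, y <- s) \S_(z, w <- t) F x y z w = \S_(z, w <- t) \S_(x, y <- s) F x y z w.
Proof. exact: exchange_big. Qed.

Lemma tens_lin_eq A B U (f g : tens A B -> U) : lin f -> lin g ->
  (forall a b, f (a ⊠ b) = g (a ⊠ b)) -> forall t, f t = g t.
Proof.
move=> lf lg fg t; rewrite -(sum2_id t) !sum2_map //.
by apply: eq_sum2 => x y.
Qed.

End Tensor.

(* Stated over an abstract algebra, where converting [⊗] to [tens] is cheap.   *)
Section Repackaging.
Variables (k : fieldType) (A : algType k) (D : A -> A ⊗ A) (P Q : A ⊗ A ⊗ A).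

Definition cop_id (D : A -> tens A A) (t : tens A A) : tens A (tens A A) :=
  \S_(a, b <- t) \S_(a1, a2 <- D a) a1 ⊠ a2 ⊠ b.
Definition id_cop (D : A -> tens A A) (t : tens A A) : tens A (tens A A) :=
  \S_(a, b <- t) a ⊠ D b.

(** The factors of the pentagon in the fourfold tensor power. Underscores separate the components of
    the argument, and a two-digit group is a component spread over two legs by [D]; [leg234] and
    [leg123] put the components on the legs named and 1 on the remaining one. *)
Definition leg234 (t : tens A (tens A A)) : tens A (tens A (tens A A)) := 1 ⊠ t.
Definition leg123 (t : tens A (tens A A)) : tens A (tens A (tens A A)) :=
  \S_(x, y, z <- t) x ⊠ y ⊠ z ⊠ 1.
Definition leg1_23_4 (D : A -> tens A A) (t : tens A (tens A A)) :
    tens A (tens A (tens A A)) :=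
  \S_(x, u <- t) x ⊠ cop_id D u.
Definition leg12_3_4 (D : A -> tens A A) (t : tens A (tens A A)) :
    tens A (tens A (tens A A)) :=
  \S_(x, u <- t) \S_(x1, x2 <- D x) x1 ⊠ x2 ⊠ u.
Definition leg1_2_34 (D : A -> tens A A) (t : tens A (tens A A)) :
    tens A (tens A (tens A A)) :=
  \S_(x, u <- t) x ⊠ id_cop D u.

Lemma tens_coassoc x y : id_tens D x = P * tens_id D y * Q ->
  id_cop D x = (P : tens A (tens A A)) * cop_id D y * Q.
Proof. by []. Qed.

Lemma tens_pentagon :
  (1 ⊗ P) * id_tens (tens_id D) P
      * (\tsum_(X1 ⊗ X2 ⊗ X3 <- P) X1 ⊗ X2 ⊗ X3 ⊗ (1 : A))
    = id_tens (id_tens D) P * tens_id D P ->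
  leg234 P * leg1_23_4 D P * leg123 P = leg1_2_34 D P * leg12_3_4 D P.
Proof. by []. Qed.

Lemma tens_one3 : P * Q = 1 -> (P : tens A (tens A A)) * Q = 1 ⊠ 1 ⊠ 1.
Proof. by []. Qed.

Lemma tens_conj (b : A ⊗ A) :
  P * tens_id D b * Q = (P : tens A (tens A A)) * cop_id D b * Q.
Proof. by []. Qed.

Lemma tens_fold4 (U : lmodType k) (F : A -> A -> A -> A -> U) :
  \tsum_(a ⊗ u <- tens_id D P * (\tsum_(x ⊗ y ⊗ z <- Q) x ⊗ y ⊗ z ⊗ (1 : A)))
    \tsum_(b ⊗ c ⊗ d <- u) F a b c d
  = sum4 F (leg12_3_4 D P * leg123 Q).
Proof. by []. Qed.

End Repackaging.

Global Opaque tens tp sum2.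
Arguments sum3 : simpl never.
Arguments sum4 : simpl never.

Section Sums.
Variable k : fieldType.
Implicit Types A B C D E : algType k.
Implicit Types U V W : lmodType k.

Lemma lin_sum2t (X : lmodType k) A B U (F : A -> B -> U) (g : X -> tens A B) :
  lin2 F -> lin g -> lin (fun x => sum2 F (g x)).
Proof. by move=> lF; apply: lin_comp; apply: sum2_lin. Qed.

Lemma sum3_lin2 A B C U (F : A -> B -> C -> U) :
  lin3 F -> lin2 (fun a u => sum2 (F a) u).
Proof.
move=> [l1 l2 l3]; split=> [a|u]; first by apply: sum2_lin; split.
by apply: lin_sum2.
Qed.

Lemma sum3_lin A B C U (F : A -> B -> C -> U) : lin3 F -> lin (sum3 F).
Proof. by move=> lF; apply: sum2_lin; apply: sum3_lin2. Qed.

Lemma lin_sum3 (X : lmodType k) A B C U (F : X -> A -> B -> C -> U) t :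
  (forall a b c, lin (fun x => F x a b c)) -> lin (fun x => sum3 (F x) t).
Proof. by move=> lF; apply: lin_sum2 => a u; apply: lin_sum2. Qed.

Lemma lin_sum3t (X : lmodType k) A B C U (F : A -> B -> C -> U) (g : X -> tens A (tens B C)) :
  lin3 F -> lin g -> lin (fun x => sum3 F (g x)).
Proof. by move=> lF; apply: lin_comp; apply: sum3_lin. Qed.

Lemma sum4_lin2 A B C D U (F : A -> B -> C -> D -> U) :
  lin4 F -> lin2 (fun a u => sum3 (F a) u).
Proof.
move=> [l1 l2 l3 l4]; split=> [a|u]; first by apply: sum3_lin; split.
by apply: lin_sum3.
Qed.

Lemma sum4_lin A B C D U (F : A -> B -> C -> D -> U) : lin4 F -> lin (sum4 F).
Proof. by move=> lF; apply: sum2_lin; apply: sum4_lin2. Qed.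

Lemma lin_sum4 (X : lmodType k) A B C D U (F : X -> A -> B -> C -> D -> U) t :
  (forall a b c d, lin (fun x => F x a b c d)) -> lin (fun x => sum4 (F x) t).
Proof. by move=> lF; apply: lin_sum2 => a u; apply: lin_sum3. Qed.

Lemma eq_sum3 A B C U (F G : A -> B -> C -> U) t :
  (forall x y z, F x y z = G x y z) -> sum3 F t = sum3 G t.
Proof. by move=> FG; apply: eq_sum2 => x u; apply: eq_sum2. Qed.

Lemma sum23C A B C D E U (F : A -> B -> C -> D -> E -> U) s t :
  \S_(x, y <- s) \S_(a, b, c <- t) F x y a b c
  = \S_(a, b, c <- t) \S_(x, y <- s) F x y a b c.
Proof.
rewrite /sum3; etransitivity; first exact: sum2C.
by apply: eq_sum2 => a u; exact: sum2C.
Qed.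

Lemma sum32C A B C D E U (F : C -> D -> E -> A -> B -> U) s t :
  \S_(a, b, c <- t) \S_(x, y <- s) F a b c x y
  = \S_(x, y <- s) \S_(a, b, c <- t) F a b c x y.
Proof. by symmetry; exact: sum23C. Qed.

Lemma sum3C A B C (A' B' C' : algType k) U (F : A -> B -> C -> A' -> B' -> C' -> U) s t :
  \S_(a, b, c <- t) \S_(x, y, z <- s) F a b c x y z
  = \S_(x, y, z <- s) \S_(a, b, c <- t) F a b c x y z.
Proof.
rewrite /sum3.
transitivity (\S_(a, u <- t) \S_(x, v <- s) \S_(b, c <- u) \S_(y, z <- v) F a b c x y z).
  by apply: eq_sum2 => a u; exact: sum2C.
etransitivity; first exact: sum2C.
apply: eq_sum2 => x v; etransitivity; last exact: sum2C.
by apply: eq_sum2 => a u; exact: sum2C.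
Qed.

Lemma sum3_tp A B C U (F : A -> B -> C -> U) a b c :
  lin3 F -> sum3 F (a ⊠ b ⊠ c) = F a b c.
Proof.
move=> lF; rewrite /sum3 sum2_tp; last exact: sum3_lin2.
by case: lF => l1 l2 l3; rewrite sum2_tp.
Qed.

Lemma sum4_tp A B C D U (F : A -> B -> C -> D -> U) a b c d :
  lin4 F -> sum4 F (a ⊠ b ⊠ c ⊠ d) = F a b c d.
Proof.
move=> lF; rewrite /sum4 sum2_tp; last exact: sum4_lin2.
by case: lF => l1 l2 l3 l4; rewrite sum3_tp.
Qed.

Lemma sum3_map A B C U V (f : U -> V) (F : A -> B -> C -> U) t :
  lin f -> f (sum3 F t) = \S_(x, y, z <- t) f (F x y z).
Proof.
by move=> lf; rewrite /sum3 sum2_map //; apply: eq_sum2 => x u; rewrite sum2_map.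
Qed.

Lemma sum3_id A B C (t : tens A (tens B C)) : \S_(x, y, z <- t) x ⊠ y ⊠ z = t.
Proof.
rewrite -[RHS](sum2_id t); apply: eq_sum2 => x u.
by rewrite -[in RHS](sum2_id u) (sum2_map _ _ (lin_tpr x (@lin_id _ _))).
Qed.

Lemma tens3_lin_eq A B C U (f g : tens A (tens B C) -> U) : lin f -> lin g ->
  (forall a b c, f (a ⊠ b ⊠ c) = g (a ⊠ b ⊠ c)) -> forall t, f t = g t.
Proof.
move=> lf lg fg t; rewrite -(sum3_id t) !sum3_map //.
by apply: eq_sum3.
Qed.

End Sums.

Global Opaque sum3.

Create HintDb linear_db.

Ltac lin_eta :=
  lazymatch goal with
  | |- lin (fun x => _) => idtac
  | |- @lin ?k ?V ?U ?f => change (@lin k V U (fun x => f x)); cbv beta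
  | _ => idtac
  end.

Ltac lin_base := first [ assumption | solve [eauto with linear_db nocore]
  | apply: lin_linear].

(** A hook, redefined as operations appear that are linear in an argument other than the last, such
    as [ad h b] in h. *)
Ltac lin_ext := fail.

Ltac lin :=
  cbv beta; lin_eta;
  lazymatch goal with
  | |- lin2 _ => split; intros; lin
  | |- lin3 _ => split; intros; lin
  | |- lin4 _ => split; intros; lin
  | |- lin (fun x => x) => exact: lin_id
  | |- lin (fun x => _ * _) => first [apply: lin_mull | apply: lin_mulr]; lin
  | |- lin (fun x => _ ⊠ _) => first [apply: lin_tpl | apply: lin_tpr]; lin
  | |- lin (fun x => sum2 _ _) =>
      first [apply: lin_sum2; intros | apply: lin_sum2t]; lin
  | |- lin (fun x => sum3 _ _) =>
      first [apply: lin_sum3; intros | apply: lin_sum3t]; lin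
  | |- lin (fun x => sum4 _ _) => apply: lin_sum4; intros; lin
  | |- lin _ => first
     [ lin_base
     | lin_ext; lin
     | match goal with Hl : forall _, lin _ |- _ => apply: (lin_comp (Hl _)); lin end
     | match goal with Hl : forall _ _, lin _ |- _ => apply: (lin_comp (Hl _ _)); lin end
     | match goal with Hl : forall _ _ _, lin _ |- _ => apply: (lin_comp (Hl _ _ _)); lin end
     | apply: lin_scaler; lin
     | apply: lin_comp; [ lin_base | lin] ]
  | |- _ => idtac
  end.

Section SumMul.
Variable k : fieldType.
Implicit Types A B C D R : algType k.
Implicit Types U V W : lmodType k.

Lemma sum2M A B U (F : A -> B -> U) P Q : lin2 F ->
  sum2 F (P * Q) = \S_(a, b <- P) \S_(a', b' <- Q) F (a * a') (b * b').
Proof.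
move=> [l1 l2]; have lF := conj l1 l2; have lF' := sum2_lin lF.
move: P; apply: tens_lin_eq; [by lin | by lin |] => a b.
rewrite sum2_tp; last by lin.
move: Q; apply: tens_lin_eq; [by lin | by lin |] => a' b'.
by rewrite tpM !sum2_tp //; lin.
Qed.

Lemma sum3M A B C U (F : A -> B -> C -> U) P Q : lin3 F ->
  sum3 F (P * Q)
  = \S_(a, b, c <- P) \S_(a', b', c' <- Q) F (a * a') (b * b') (c * c').
Proof.
move=> lF; have lF' := sum3_lin lF; have [l1 l2 l3] := lF.
move: P; apply: tens3_lin_eq; [by lin | by lin |] => a b c.
rewrite sum3_tp; last by lin.
move: Q; apply: tens3_lin_eq; [by lin | by lin |] => a' b' c'.
by rewrite !tpM !sum3_tp //; lin.
Qed.

Lemma sum4M A B C D U (F : A -> B -> C -> D -> U) P Q : lin4 F ->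
  sum4 F (P * Q)
  = sum4 (fun a b c d => sum4 (fun a' b' c' d' =>
      F (a * a') (b * b') (c * c') (d * d')) Q) P.
Proof.
move=> lF; have [l1 l2 l3 l4] := lF.
rewrite [LHS]sum2M; last exact: sum4_lin2.
apply: eq_sum2 => a u; etransitivity; last exact: sum23C.
by apply: eq_sum2 => a' u'; rewrite sum3M.
Qed.

Lemma sum2_morph A B R (G : A -> B -> R) P Q : lin2 G ->
  (forall a b a' b', G (a * a') (b * b') = G a b * G a' b') ->
  sum2 G (P * Q) = sum2 G P * sum2 G Q.
Proof.
move=> lG GM; rewrite sum2M // (sum2_map _ _ (f := fun x => x * _)); last by lin.
apply: eq_sum2 => a b; rewrite (sum2_map _ _ (f := fun x => _ * x)); last by lin.
exact: eq_sum2.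
Qed.

Lemma sum3_morph A B C R (G : A -> B -> C -> R) P Q : lin3 G ->
  (forall a b c a' b' c', G (a * a') (b * b') (c * c') = G a b c * G a' b' c') ->
  sum3 G (P * Q) = sum3 G P * sum3 G Q.
Proof.
move=> lG GM; rewrite sum3M // (sum3_map _ _ (f := fun x => x * _)); last by lin.
apply: eq_sum3 => a b c; rewrite (sum3_map _ _ (f := fun x => _ * x)); last by lin.
exact: eq_sum3.
Qed.

End SumMul.

(** * The axioms of a quasi-Hopf algebra as identities of sums *)

(** A sealed copy of H as a mere algebra. The operations are restated on it and made opaque, so that
    unification never enters the hierarchy of structures. *)
Definition alg_of (k : fieldType) (H : quasiHopfAlgType k) : algType k := H.

Section Operations.
Variables (k : fieldType) (H : quasiHopfAlgType k).
Local Notation A := (alg_of H).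

Definition cop (h : A) : tens A A := comult (h : H).
Definition ant (h : A) : A := antipode (h : H).
Definition antV (h : A) : A := antipodeV (h : H).
Definition eps (h : A) : k := counit (h : H).
Definition al : A := alpha H.
Definition be : A := beta H.
Definition phi : tens A (tens A A) := reassoc H.
Definition phiV : tens A (tens A A) := reassocV H.

Lemma cop_lin : lin cop.
Proof. exact: (lin_linear (@comult k H)). Qed.

Lemma ant_lin : lin ant.
Proof. exact: (lin_linear (@antipode k H)). Qed.

Lemma eps_lin (U : lmodType k) (u : U) : lin (fun h => eps h *: u).
Proof.
move=> a x y; rewrite /eps; have -> := linearP (@counit k H) a (x : H) (y : H).
by rewrite scalerDl scalerA.
Qed.

Lemma antM x y : ant (x * y) = ant y * ant x.
Proof. exact: (@antipodeM k H). Qed.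

Lemma ant1 : ant 1 = 1.
Proof. exact: (@antipode1 k H). Qed.

Lemma antK x : ant (antV x) = x.
Proof. exact: (@antipodeVK k H). Qed.

Lemma epsM x y : eps (x * y) = eps x * eps y.
Proof. exact: (rmorphM (@counit k H)). Qed.

Lemma eps1 : eps 1 = 1.
Proof. exact: (rmorph1 (@counit k H)). Qed.

Lemma copM x y : cop (x * y) = cop x * cop y.
Proof. exact: (rmorphM (@comult k H)). Qed.

Lemma cop1 : cop 1 = 1 ⊠ 1.
Proof. exact: (rmorph1 (@comult k H)). Qed.

Lemma phiK : phi * phiV = 1 ⊠ 1 ⊠ 1.
Proof. exact: (tens_one3 (@reassocK k H)). Qed.

Lemma phiVK : phiV * phi = 1 ⊠ 1 ⊠ 1.
Proof. exact: (tens_one3 (@reassocVK k H)). Qed.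

Lemma cop_epsl h : \S_(h1, h2 <- cop h) eps h1 *: h2 = h.
Proof. exact: (@comult_counitl k H). Qed.

Lemma cop_epsr h : \S_(h1, h2 <- cop h) eps h2 *: h1 = h.
Proof. exact: (@comult_counitr k H). Qed.

Lemma cop_al h : \S_(h1, h2 <- cop h) ant h1 * al * h2 = eps h *: al.
Proof. exact: (@antipode_alpha k H). Qed.

Lemma cop_be h : \S_(h1, h2 <- cop h) h1 * be * ant h2 = eps h *: be.
Proof. exact: (@antipode_beta k H). Qed.

Lemma phi_ant : \S_(X1, X2, X3 <- phi) X1 * be * ant X2 * al * X3 = 1.
Proof. exact: (@antipode_reassoc k H). Qed.

Lemma phiV_ant : \S_(x1, x2, x3 <- phiV) ant x1 * al * x2 * be * ant x3 = 1.
Proof. exact: (@antipode_reassocV k H). Qed.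

Lemma phi_eps1 : \S_(X1, X2, X3 <- phi) eps X1 *: (X2 ⊠ X3) = 1 ⊠ 1.
Proof. exact: (@reassoc_counit1 k H). Qed.

Lemma phi_eps2 : \S_(X1, X2, X3 <- phi) eps X2 *: (X1 ⊠ X3) = 1 ⊠ 1.
Proof. exact: (@reassoc_counit2 k H). Qed.

Lemma phi_eps3 : \S_(X1, X2, X3 <- phi) eps X3 *: (X1 ⊠ X2) = 1 ⊠ 1.
Proof. exact: (@reassoc_counit3 k H). Qed.

Lemma copA h : id_cop cop (cop h) = phi * cop_id cop (cop h) * phiV.
Proof. exact: (tens_coassoc (@comultA k H h)). Qed.

Lemma pentagon :
  leg234 phi * leg1_23_4 cop phi * leg123 phi = leg1_2_34 cop phi * leg12_3_4 cop phi.
Proof. exact: (tens_pentagon (@reassoc_cocycle k H)). Qed.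

End Operations.
Global Opaque alg_of cop ant antV eps al be phi phiV.

#[local] Hint Resolve cop_lin ant_lin : linear_db.
Ltac lin_ext ::= apply: (lin_comp (eps_lin _)).

Lemma cop_id_lin (k : fieldType) (A : algType k) (D : A -> tens A A) :
  lin D -> lin (cop_id D).
Proof. by move=> lD; rewrite /cop_id; lin. Qed.

Lemma id_cop_lin (k : fieldType) (A : algType k) (D : A -> tens A A) :
  lin D -> lin (id_cop D).
Proof. by move=> lD; rewrite /id_cop; lin. Qed.

Lemma leg1_23_4_lin (k : fieldType) (A : algType k) (D : A -> tens A A) :
  lin D -> lin (leg1_23_4 D).
Proof. by move=> lD; have := cop_id_lin lD; rewrite /leg1_23_4 => l; lin. Qed.

Lemma leg1_2_34_lin (k : fieldType) (A : algType k) (D : A -> tens A A) :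
  lin D -> lin (leg1_2_34 D).
Proof. by move=> lD; have := id_cop_lin lD; rewrite /leg1_2_34 => l; lin. Qed.

Lemma leg12_3_4_lin (k : fieldType) (A : algType k) (D : A -> tens A A) :
  lin D -> lin (leg12_3_4 D).
Proof. by move=> lD; rewrite /leg12_3_4; lin. Qed.

#[local] Hint Resolve cop_id_lin id_cop_lin leg1_23_4_lin leg1_2_34_lin leg12_3_4_lin : linear_db.

(** * The pentagon and its rearrangements *)

Section Legs.
Variables (k : fieldType) (H : quasiHopfAlgType k).
Local Notation A := (alg_of H).
Local Notation cop := (@cop k H).
Local Notation phi := (phi H).
Local Notation phiV := (phiV H).

Lemma sum_copM (U : lmodType k) (F : A -> A -> U) x y : lin2 F ->
  sum2 F (cop (x * y)) = \S_(a, b <- cop x) \S_(a', b' <- cop y) F (a * a') (b * b').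
Proof. by move=> lF; rewrite copM sum2M. Qed.

Lemma sum_cop1 (U : lmodType k) (F : A -> A -> U) : lin2 F -> sum2 F (cop 1) = F 1 1.
Proof. by move=> lF; rewrite cop1 sum2_tp. Qed.

Lemma cop_id_morph : {morph cop_id cop : s t / s * t}.
Proof.
move=> s t; apply: sum2_morph; first by lin.
move=> a b a' b'; rewrite copM; rewrite [LHS]sum2M; last by lin.
rewrite (sum2_map _ _ (f := fun x => x * _)); last by lin.
apply: eq_sum2 => c d; rewrite (sum2_map _ _ (f := fun x => _ * x)); last by lin.
by apply: eq_sum2 => c' d'; rewrite !tpM.
Qed.

Let id_cop_morph : {morph id_cop cop : s t / s * t}.
Proof.
move=> s t; apply: sum2_morph; first by lin.
by move=> a b a' b'; rewrite copM !tpM.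
Qed.

Let leg234M : {morph @leg234 k A : s t / s * t}.
Proof. by move=> s t; rewrite /leg234 tpM mulr1. Qed.

Let leg123M : {morph @leg123 k A : s t / s * t}.
Proof.
move=> s t; apply: sum3_morph; first by lin.
by move=> a b c a' b' c'; rewrite !tpM mulr1.
Qed.

Let leg1_23_4M : {morph leg1_23_4 cop : s t / s * t}.
Proof.
move=> s t; apply: sum2_morph; first by split=> x; lin.
by move=> a b a' b'; rewrite cop_id_morph tpM.
Qed.

Let leg1_2_34M : {morph leg1_2_34 cop : s t / s * t}.
Proof.
move=> s t; apply: sum2_morph; first by lin.
by move=> a b a' b'; rewrite id_cop_morph tpM.
Qed.

Let leg12_3_4M : {morph leg12_3_4 cop : s t / s * t}.
Proof.
move=> s t; apply: sum2_morph; first by lin.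
move=> a b a' b'; rewrite copM; rewrite [LHS]sum2M; last by lin.
rewrite (sum2_map _ _ (f := fun x => x * _)); last by lin.
apply: eq_sum2 => c d; rewrite (sum2_map _ _ (f := fun x => _ * x)); last by lin.
by apply: eq_sum2 => c' d'; rewrite !tpM.
Qed.

Let cop_id1 : cop_id cop (1 ⊠ 1) = 1 ⊠ 1 ⊠ 1.
Proof. rewrite /cop_id sum2_tp; [rewrite cop1 sum2_tp; [reflexivity|lin]|lin]. Qed.
Let id_cop1 : id_cop cop (1 ⊠ 1) = 1 ⊠ 1 ⊠ 1.
Proof. rewrite /id_cop sum2_tp; [rewrite cop1; reflexivity|lin]. Qed.

Let legs1 : [/\ leg234 (1 ⊠ 1 ⊠ 1) = 1 :> tens A _, leg123 (1 ⊠ 1 ⊠ 1) = 1 :> tens A _,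
  leg1_23_4 cop (1 ⊠ 1 ⊠ 1) = 1, leg12_3_4 cop (1 ⊠ 1 ⊠ 1) = 1
  & leg1_2_34 cop (1 ⊠ 1 ⊠ 1) = 1].
Proof.
have e : (1 : tens A (tens A (tens A A))) = 1 ⊠ 1 ⊠ 1 ⊠ 1 by rewrite !tp1.
rewrite !e; split.
- reflexivity.
- by rewrite /leg123 sum3_tp; [reflexivity | lin].
- rewrite /leg1_23_4 sum2_tp; [rewrite cop_id1; reflexivity | lin].
- rewrite /leg12_3_4 sum2_tp; [rewrite cop1 sum2_tp; [reflexivity | lin] | lin].
- rewrite /leg1_2_34 sum2_tp; [rewrite id_cop1; reflexivity | lin].
Qed.

Let R := tens A (tens A (tens A A)).
Let legK (f : tens A (tens A A) -> R) : {morph f : s t / s * t} ->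
  f (1 ⊠ 1 ⊠ 1) = 1 -> (f phi * f phiV = 1) * (f phiV * f phi = 1).
Proof. by move=> fM f1; rewrite -!fM phiK phiVK. Qed.

Let l234K : (leg234 phi * leg234 phiV = 1) * (leg234 phiV * leg234 phi = 1).
Proof. by apply: legK leg234M _; case: legs1. Qed.
Let l123K : (leg123 phi * leg123 phiV = 1) * (leg123 phiV * leg123 phi = 1).
Proof. by apply: legK leg123M _; case: legs1. Qed.
Let l1_23_4K : (leg1_23_4 cop phi * leg1_23_4 cop phiV = 1)
  * (leg1_23_4 cop phiV * leg1_23_4 cop phi = 1).
Proof. by apply: legK leg1_23_4M _; case: legs1. Qed.
Let l12_3_4K : (leg12_3_4 cop phi * leg12_3_4 cop phiV = 1)
  * (leg12_3_4 cop phiV * leg12_3_4 cop phi = 1).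
Proof. by apply: legK leg12_3_4M _; case: legs1. Qed.
Let l1_2_34K : (leg1_2_34 cop phi * leg1_2_34 cop phiV = 1)
  * (leg1_2_34 cop phiV * leg1_2_34 cop phi = 1).
Proof. by apply: legK leg1_2_34M _; case: legs1. Qed.

(** This and the variants below are the pentagon with some edges inverted and carried to the other
    side. Each is named after its left-hand side, the path that it replaces; [V] marks Φ⁻¹. *)
Lemma pent_12_3_4_123V :
  leg12_3_4 cop phi * leg123 phiV = leg1_2_34 cop phiV * leg234 phi * leg1_23_4 cop phi.
Proof.
have E := congr1 (fun x => leg1_2_34 cop phiV * x * leg123 phiV) (pentagon H).
move: E; rewrite !mulrA l1_2_34K mul1r -!mulrA l123K mulr1 !mulrA => <-.
reflexivity.
Qed.

Lemma pent_234V_1_2_34 :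
  leg234 phiV * leg1_2_34 cop phi = leg1_23_4 cop phi * leg123 phi * leg12_3_4 cop phiV.
Proof.
have E := congr1 (fun x => leg234 phiV * x * leg12_3_4 cop phiV) (pentagon H).
by move: E; rewrite !mulrA l234K mul1r -!mulrA l12_3_4K mulr1 !mulrA => ->.
Qed.

Lemma pent_1_2_34V_234 :
  leg1_2_34 cop phiV * leg234 phi = leg12_3_4 cop phi * leg123 phiV * leg1_23_4 cop phiV.
Proof.
by rewrite pent_12_3_4_123V -!mulrA l1_23_4K mulr1.
Qed.

Lemma pentV : leg123 phiV * leg1_23_4 cop phiV * leg234 phiV
  = leg12_3_4 cop phiV * leg1_2_34 cop phiV.
Proof.
(* The two sides of the claim are a left and a right inverse of [a], hence equal. *)
set a := leg1_2_34 cop phi * leg12_3_4 cop phi.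
have Ka : a * (leg12_3_4 cop phiV * leg1_2_34 cop phiV) = 1.
  by rewrite /a -!mulrA (mulrA _ _ (leg1_2_34 cop phiV)) l12_3_4K mul1r l1_2_34K.
have aK : (leg123 phiV * leg1_23_4 cop phiV * leg234 phiV) * a = 1.
  rewrite /a -pentagon !mulrA -(mulrA _ (leg234 phiV)) l234K mulr1.
  by rewrite -(mulrA _ (leg1_23_4 cop phiV)) l1_23_4K mulr1 l123K.
by rewrite -[LHS]mulr1 -Ka mulrA aK mul1r.
Qed.

Lemma pent_1_23_4_123 :
  leg1_23_4 cop phi * leg123 phi = leg234 phiV * leg1_2_34 cop phi * leg12_3_4 cop phi.
Proof. by rewrite pent_234V_1_2_34 -!mulrA l12_3_4K mulr1. Qed.

Lemma pent_123V_1_23_4V :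
  leg123 phiV * leg1_23_4 cop phiV
  = leg12_3_4 cop phiV * leg1_2_34 cop phiV * leg234 phi.
Proof. by rewrite -pentV -!mulrA l234K mulr1. Qed.

Lemma pent_123_12_3_4V :
  leg123 phi * leg12_3_4 cop phiV
  = leg1_23_4 cop phiV * leg234 phiV * leg1_2_34 cop phi.
Proof. by rewrite -(mulrA _ (leg234 phiV)) pent_234V_1_2_34 !mulrA l1_23_4K mul1r. Qed.

Section SumLegs.
Variables (U : lmodType k) (F : A -> A -> A -> A -> U).
Hypothesis lF : lin4 F.

Lemma sum_leg234 t : sum4 F (leg234 t) = \S_(x, y, z <- t) F 1 x y z.
Proof. by rewrite /sum4 sum2_tp //; exact: sum4_lin2. Qed.

Lemma sum_leg123 t : sum4 F (leg123 t) = \S_(x, y, z <- t) F x y z 1.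
Proof.
rewrite /leg123 (sum3_map _ _ (sum4_lin lF)).
by apply: eq_sum3 => x y z; rewrite sum4_tp.
Qed.

Lemma sum_leg1_2_34 t :
  sum4 F (leg1_2_34 cop t) = \S_(x, y, z <- t) \S_(z1, z2 <- cop z) F x y z1 z2.
Proof.
have [l1 l2 l3 l4] := lF; move: t; apply: tens3_lin_eq; last move=> a b c.
- by apply: lin_comp; [apply: sum4_lin | lin].
- by lin.
rewrite /leg1_2_34 /id_cop sum2_tp; last by lin.
rewrite sum2_tp; last by lin.
rewrite sum3_tp; last by lin.
rewrite -{1}(sum2_id (cop c)) (sum2_map _ _ (f := fun u => a ⊠ b ⊠ u)); last by lin.
rewrite (sum2_map _ _ (sum4_lin lF)).
by apply: eq_sum2 => x y; rewrite sum4_tp.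
Qed.

Lemma sum_leg12_3_4 t :
  sum4 F (leg12_3_4 cop t) = \S_(x, y, z <- t) \S_(x1, x2 <- cop x) F x1 x2 y z.
Proof.
have [l1 l2 l3 l4] := lF; move: t; apply: tens3_lin_eq; last move=> a b c.
- by apply: lin_comp; [apply: sum4_lin | lin].
- by lin.
rewrite /leg12_3_4 sum2_tp; last by lin.
rewrite sum3_tp; last by lin.
rewrite (sum2_map _ _ (sum4_lin lF)).
by apply: eq_sum2 => x y; rewrite sum4_tp.
Qed.

Lemma sum_leg1_23_4 t :
  sum4 F (leg1_23_4 cop t) = \S_(x, y, z <- t) \S_(y1, y2 <- cop y) F x y1 y2 z.
Proof.
have [l1 l2 l3 l4] := lF; move: t; apply: tens3_lin_eq; last move=> a b c.
- by apply: lin_comp; [apply: sum4_lin | lin].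
- by lin.
rewrite /leg1_23_4 /cop_id sum2_tp; last by lin.
rewrite sum2_tp; last by lin.
rewrite sum3_tp; last by lin.
rewrite (sum2_map _ _ (f := fun u => a ⊠ u)); last by lin.
rewrite (sum2_map _ _ (sum4_lin lF)).
by apply: eq_sum2 => x y; rewrite sum4_tp.
Qed.

End SumLegs.
End Legs.

Global Opaque sum4.

(** * Automation: Sweedler sums up to distributing and reordering *)

Section Pull.
Variable k : fieldType.
Implicit Types A B C D E R : algType k.

Lemma sum2_mull A B R (F : A -> B -> R) t c : (sum2 F t : R) * c = \S_(x, y <- t) F x y * c.
Proof. by rewrite (sum2_map _ _ (f := fun x : R => x * c)); lin. Qed.
Lemma sum2_mulr A B R (F : A -> B -> R) t c : c * (sum2 F t : R) = \S_(x, y <- t) c * F x y.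
Proof. by rewrite (sum2_map _ _ (f := fun x : R => c * x)); lin. Qed.
Lemma sum2_tpl A B R C (F : A -> B -> R) t (c : C) : sum2 F t ⊠ c = \S_(x, y <- t) F x y ⊠ c.
Proof. by rewrite (sum2_map _ _ (f := fun x => x ⊠ c)); lin. Qed.
Lemma sum2_tpr A B R C (F : A -> B -> R) t (c : C) : c ⊠ sum2 F t = \S_(x, y <- t) c ⊠ F x y.
Proof. by rewrite (sum2_map _ _ (f := fun x => c ⊠ x)); lin. Qed.
Lemma sum3_mull A B C R (F : A -> B -> C -> R) t c :
  (sum3 F t : R) * c = \S_(x, y, z <- t) F x y z * c.
Proof. by rewrite (sum3_map _ _ (f := fun x : R => x * c)); lin. Qed.
Lemma sum3_mulr A B C R (F : A -> B -> C -> R) t c :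
  c * (sum3 F t : R) = \S_(x, y, z <- t) c * F x y z.
Proof. by rewrite (sum3_map _ _ (f := fun x : R => c * x)); lin. Qed.
Lemma sum3_tpl A B C D R (F : A -> B -> C -> R) t (c : D) :
  sum3 F t ⊠ c = \S_(x, y, z <- t) F x y z ⊠ c.
Proof. by rewrite (sum3_map _ _ (f := fun x => x ⊠ c)); lin. Qed.
Lemma sum3_tpr A B C D R (F : A -> B -> C -> R) t (c : D) :
  c ⊠ sum3 F t = \S_(x, y, z <- t) c ⊠ F x y z.
Proof. by rewrite (sum3_map _ _ (f := fun x => c ⊠ x)); lin. Qed.

Lemma sum22 A B C D (U : lmodType k) (F : A -> B -> U) (G : C -> D -> tens A B) t :
  lin2 F -> sum2 F (sum2 G t) = \S_(x, y <- t) sum2 F (G x y).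
Proof. by move=> lF; rewrite (sum2_map _ _ (sum2_lin lF)). Qed.
Lemma sum23 A B C D E (U : lmodType k) (F : A -> B -> U) (G : C -> D -> E -> tens A B) t :
  lin2 F -> sum2 F (sum3 G t) = \S_(x, y, z <- t) sum2 F (G x y z).
Proof. by move=> lF; rewrite (sum3_map _ _ (sum2_lin lF)). Qed.
Lemma sum32 A B C D E (U : lmodType k) (F : A -> B -> C -> U)
    (G : D -> E -> tens A (tens B C)) t :
  lin3 F -> sum3 F (sum2 G t) = \S_(x, y <- t) sum3 F (G x y).
Proof. by move=> lF; rewrite (sum2_map _ _ (sum3_lin lF)). Qed.

(** The [bring] lemmas carry a buried sum to the front, one binder at a time: once the body starts
    with the sum over t, that sum may cross the sum over s. *)
Lemma bring22 A B C D (U : lmodType k) (F : A -> B -> U) (G : A -> B -> C -> D -> U) s t :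
  (forall x y, F x y = \S_(z, w <- t) G x y z w) ->
  sum2 F s = \S_(z, w <- t) \S_(x, y <- s) G x y z w.
Proof. by move=> FG; rewrite -sum2C; apply: eq_sum2. Qed.
Lemma bring23 A B C D E (U : lmodType k) (F : A -> B -> U) (G : A -> B -> C -> D -> E -> U) s t :
  (forall x y, F x y = \S_(z, w, u <- t) G x y z w u) ->
  sum2 F s = \S_(z, w, u <- t) \S_(x, y <- s) G x y z w u.
Proof. by move=> FG; rewrite -sum23C; apply: eq_sum2. Qed.
Lemma bring32 A B C D E (U : lmodType k) (F : A -> B -> E -> U)
    (G : A -> B -> E -> C -> D -> U) s t :
  (forall x y z, F x y z = \S_(u, w <- t) G x y z u w) ->
  sum3 F s = \S_(u, w <- t) \S_(x, y, z <- s) G x y z u w.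
Proof. by move=> FG; rewrite -sum32C; apply: eq_sum3. Qed.
Lemma bring33 A B C D E (E' : algType k) (U : lmodType k) (F : A -> B -> E -> U)
    (G : A -> B -> E -> C -> D -> E' -> U) s t :
  (forall x y z, F x y z = \S_(u, w, v <- t) G x y z u w v) ->
  sum3 F s = \S_(u, w, v <- t) \S_(x, y, z <- s) G x y z u w v.
Proof. by move=> FG; rewrite -sum3C; apply: eq_sum3. Qed.

End Pull.

(** Φ usually occurs several times, so which of its sums to bring forward is a guess. The [+] keeps
    the alternatives open, and a mismatch of the leaves in [permute_sums_] makes the search come
    back here. *)
Ltac bring_sum2 t :=
  cbv beta;
  lazymatch goal with
  | |- @sum2 _ _ _ _ _ ?s = _ =>
     (constr_eq s t; reflexivity) + (eapply bring22; intros; bring_sum2 t)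
  | |- @sum3 _ _ _ _ _ _ ?s = _ => eapply bring32; intros; bring_sum2 t
  end.
Ltac bring_sum3 t :=
  cbv beta;
  lazymatch goal with
  | |- @sum3 _ _ _ _ _ _ ?s = _ =>
     (constr_eq s t; reflexivity) + (eapply bring33; intros; bring_sum3 t)
  | |- @sum2 _ _ _ _ _ ?s = _ => eapply bring23; intros; bring_sum3 t
  end.

Ltac permute_sums_ :=
  cbv beta;
  lazymatch goal with
  | |- _ = @sum2 _ _ _ _ _ ?t =>
      eapply eq_trans; [ bring_sum2 t | eapply eq_sum2; intros; permute_sums_ ]
  | |- _ = @sum3 _ _ _ _ _ _ ?t =>
      eapply eq_trans; [ bring_sum3 t | eapply eq_sum3; intros; permute_sums_ ]
  | |- ?a = ?b => constr_eq a b; reflexivity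
  end.
Ltac permute_sums := once permute_sums_.

(** [leaf_ext] and [sum_ext] are hooks: the first holds extra rewriting rules for the summands, the
    second rules for sums over derived tensors such as [SS h], [λ b] or [coA b]. *)
Ltac leaf_ext := idtac.

Ltac sum_ext := fail.

Ltac norm_leaf := leaf_ext; rewrite ?antM ?mulrA ?ant1 ?mulr1 ?mul1r; reflexivity.

(* Without the explicit match, [rewrite] would unfold constants to find a sum.  *)
Ltac pull_sum :=
  match goal with
  | |- context [sum2 ?F ?t * ?c] => rewrite (sum2_mull F t c)
  | |- context [?c * sum2 ?F ?t] => rewrite (sum2_mulr F t c)
  | |- context [sum2 ?F ?t ⊠ ?c] => rewrite (sum2_tpl F t c)
  | |- context [?c ⊠ sum2 ?F ?t] => rewrite (sum2_tpr F t c)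
  | |- context [sum3 ?F ?t * ?c] => rewrite (sum3_mull F t c)
  | |- context [?c * sum3 ?F ?t] => rewrite (sum3_mulr F t c)
  | |- context [sum3 ?F ?t ⊠ ?c] => rewrite (sum3_tpl F t c)
  | |- context [?c ⊠ sum3 ?F ?t] => rewrite (sum3_tpr F t c)
  end.

(** Runs on goals whose right-hand side is an existential variable: the left-hand side is expanded
    under the binders, and [reflexivity] at each leaf records the normal form. *)
Ltac norm_sums :=
  cbv beta;
  lazymatch goal with
  | |- sum4 _ (_ * _) = _ => eapply eq_trans; [apply: sum4M; lin | norm_sums]
  | |- sum4 _ (leg234 _) = _ => eapply eq_trans; [apply: sum_leg234; lin | norm_sums]
  | |- sum4 _ (leg123 _) = _ => eapply eq_trans; [apply: sum_leg123; lin | norm_sums]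
  | |- sum4 _ (leg12_3_4 _ _) = _ => eapply eq_trans; [apply: sum_leg12_3_4; lin | norm_sums]
  | |- sum4 _ (leg1_23_4 _ _) = _ => eapply eq_trans; [apply: sum_leg1_23_4; lin | norm_sums]
  | |- sum4 _ (leg1_2_34 _ _) = _ => eapply eq_trans; [apply: sum_leg1_2_34; lin | norm_sums]
  | |- sum2 _ (cop (_ * _)) = _ => eapply eq_trans; [apply: sum_copM; lin | norm_sums]
  | |- sum2 _ (cop (ant (_ * _))) = _ =>
      eapply eq_trans; [apply: (congr1 (fun h => sum2 _ (cop h)) (antM _ _)) | norm_sums]
  | |- sum2 _ (cop 1) = _ => eapply eq_trans; [apply: sum_cop1; lin | norm_sums]
  | |- sum2 _ (_ * _) = _ => eapply eq_trans; [apply: sum2M; lin | norm_sums]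
  | |- sum3 _ (_ * _) = _ => eapply eq_trans; [apply: sum3M; lin | norm_sums]
  | |- sum2 _ (_ ⊠ _) = _ => eapply eq_trans; [apply: sum2_tp; lin | norm_sums]
  | |- sum3 _ (_ ⊠ _ ⊠ _) = _ => eapply eq_trans; [apply: sum3_tp; lin | norm_sums]
  | |- sum2 _ (sum2 _ _) = _ => eapply eq_trans; [apply: sum22; lin | norm_sums]
  | |- sum2 _ (sum3 _ _) = _ => eapply eq_trans; [apply: sum23; lin | norm_sums]
  | |- sum3 _ (sum2 _ _) = _ => eapply eq_trans; [apply: sum32; lin | norm_sums]
  | |- sum2 _ _ = _ => first
     [ eapply eq_trans; [solve [sum_ext] | norm_sums] | eapply eq_sum2; intros; norm_sums ]
  | |- sum3 _ _ = _ => first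
     [ eapply eq_trans; [solve [sum_ext] | norm_sums] | eapply eq_sum3; intros; norm_sums ]
  | |- _ => first
     [ pull_sum; norm_sums
     | norm_leaf ]
  end.

(* Equality of two iterated sums up to reordering and distributing.            *)
Ltac sweedler :=
  eapply eq_trans;
  [ norm_sums
  | eapply eq_trans; [ | eapply Logic.eq_sym; norm_sums ]; permute_sums ].

Ltac feed e :=
  repeat match type of e with
  | ?P -> _ =>
      let a := fresh in assert (a : P); [ clear e; solve [lin] | specialize (e a); clear a ]
  end.

(* Rewrites the left-hand side of the goal with [E], up to [sweedler].          *)
Tactic Notation "step" uconstr(E) :=
  let e := fresh "e" in have e := E; feed e; cbv beta in e;
  refine (eq_trans (eq_trans _ e) _); [ clear e; sweedler | clear e; cbv beta ].

(** * The axioms tested against arbitrary multilinear maps *)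

Section Sweedler.
Variables (k : fieldType) (H : quasiHopfAlgType k).
Local Notation A := (alg_of H).
Local Notation Δ := (@cop k H).
Local Notation ε := (@eps k H).
Local Notation S := (@ant k H).
Local Notation Φ := (phi H).
Local Notation Φ' := (phiV H).
Local Notation α := (al H).
Local Notation β := (be H).
Implicit Type U : lmodType k.

(** A pentagon read through an arbitrary 4-linear F, which stands for the rest of the expression;
    this is what allows it to be applied in the middle of a long Sweedler sum. *)
Lemma pent_12_3_4_123V_sum U (F : A -> A -> A -> A -> U) : lin4 F ->
  \S_(X, Y, Z <- Φ) \S_(x, y, z <- Φ') \S_(X1, X2 <- Δ X) F (X1 * x) (X2 * y) (Y * z) Z
  = \S_(x, y, z <- Φ') \S_(X, Y, Z <- Φ) \S_(X', Y', Z' <- Φ) \S_(z1, z2 <- Δ z)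
    \S_(y1, y2 <- Δ Y') F (x * X') (y * X * y1) (z1 * Y * y2) (z2 * Z * Z').
Proof.
move=> lF; have [l1 l2 l3 l4] := lF.
refine (eq_trans _ (eq_trans (congr1 (sum4 F) (pent_12_3_4_123V H)) _)); last by sweedler.
by apply/esym; sweedler.
Qed.

Lemma pent_234V_1_2_34_sum U (F : A -> A -> A -> A -> U) : lin4 F ->
  \S_(x, y, z <- Φ') \S_(X, Y, Z <- Φ) \S_(Z1, Z2 <- Δ Z) F X (x * Y) (y * Z1) (z * Z2)
  = \S_(X, Y, Z <- Φ) \S_(X', Y', Z' <- Φ) \S_(x, y, z <- Φ') \S_(Y1, Y2 <- Δ Y)
    \S_(x1, x2 <- Δ x) F (X * X' * x1) (Y1 * Y' * x2) (Y2 * Z' * y) (Z * z).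
Proof.
move=> lF; have [l1 l2 l3 l4] := lF.
refine (eq_trans _ (eq_trans (congr1 (sum4 F) (pent_234V_1_2_34 H)) _)); last by sweedler.
by apply/esym; sweedler.
Qed.

Lemma pent_1_2_34V_234_sum U (F : A -> A -> A -> A -> U) : lin4 F ->
  \S_(x, y, z <- Φ') \S_(X, Y, Z <- Φ) \S_(z1, z2 <- Δ z) F x (y * X) (z1 * Y) (z2 * Z)
  = \S_(X, Y, Z <- Φ) \S_(x, y, z <- Φ') \S_(x', y', z' <- Φ') \S_(X1, X2 <- Δ X)
    \S_(y1, y2 <- Δ y') F (X1 * x * x') (X2 * y * y1) (Y * z * y2) (Z * z').
Proof.
move=> lF; have [l1 l2 l3 l4] := lF.
refine (eq_trans _ (eq_trans (congr1 (sum4 F) (pent_1_2_34V_234 H)) _)); last by sweedler.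
by apply/esym; sweedler.
Qed.

Lemma pentV_sum U (F : A -> A -> A -> A -> U) : lin4 F ->
  \S_(x, y, z <- Φ') \S_(x', y', z' <- Φ') \S_(x'', y'', z'' <- Φ') \S_(y1, y2 <- Δ y')
    F (x * x') (y * y1 * x'') (z * y2 * y'') (z' * z'')
  = \S_(x, y, z <- Φ') \S_(x', y', z' <- Φ') \S_(x1, x2 <- Δ x) \S_(z1, z2 <- Δ z')
    F (x1 * x') (x2 * y') (y * z1) (z * z2).
Proof.
move=> lF; have [l1 l2 l3 l4] := lF.
refine (eq_trans _ (eq_trans (congr1 (sum4 F) (pentV H)) _)); last by sweedler.
by apply/esym; sweedler.
Qed.

Lemma pent_sum U (F : A -> A -> A -> A -> U) : lin4 F ->
  \S_(X, Y, Z <- Φ) \S_(X', Y', Z' <- Φ) \S_(X'', Y'', Z'' <- Φ) \S_(Y1, Y2 <- Δ Y')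
    F (X' * X'') (X * Y1 * Y'') (Y * Y2 * Z'') (Z * Z')
  = \S_(X, Y, Z <- Φ) \S_(X', Y', Z' <- Φ) \S_(Z1, Z2 <- Δ Z) \S_(X1, X2 <- Δ X')
    F (X * X1) (Y * X2) (Z1 * Y') (Z2 * Z').
Proof.
move=> lF; have [l1 l2 l3 l4] := lF.
refine (eq_trans _ (eq_trans (congr1 (sum4 F) (pentagon H)) _)); last by sweedler.
by apply/esym; sweedler.
Qed.

Lemma pent_1_23_4_123_sum U (F : A -> A -> A -> A -> U) : lin4 F ->
  \S_(X, Y, Z <- Φ) \S_(X', Y', Z' <- Φ) \S_(Y1, Y2 <- Δ Y)
    F (X * X') (Y1 * Y') (Y2 * Z') Z
  = \S_(x, y, z <- Φ') \S_(X, Y, Z <- Φ) \S_(X', Y', Z' <- Φ) \S_(Z1, Z2 <- Δ Z)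
    \S_(X1, X2 <- Δ X') F (X * X1) (x * Y * X2) (y * Z1 * Y') (z * Z2 * Z').
Proof.
move=> lF; have [l1 l2 l3 l4] := lF.
refine (eq_trans _ (eq_trans (congr1 (sum4 F) (pent_1_23_4_123 H)) _)); last by sweedler.
by apply/esym; sweedler.
Qed.

Lemma pent_123V_1_23_4V_sum U (F : A -> A -> A -> A -> U) : lin4 F ->
  \S_(x, y, z <- Φ') \S_(x', y', z' <- Φ') \S_(y1, y2 <- Δ y')
    F (x * x') (y * y1) (z * y2) z'
  = \S_(x, y, z <- Φ') \S_(x', y', z' <- Φ') \S_(X, Y, Z <- Φ) \S_(x1, x2 <- Δ x)
    \S_(z1, z2 <- Δ z') F (x1 * x') (x2 * y' * X) (y * z1 * Y) (z * z2 * Z).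
Proof.
move=> lF; have [l1 l2 l3 l4] := lF.
refine (eq_trans _ (eq_trans (congr1 (sum4 F) (pent_123V_1_23_4V H)) _)); last by sweedler.
by apply/esym; sweedler.
Qed.

Lemma pent_123_12_3_4V_sum U (F : A -> A -> A -> A -> U) : lin4 F ->
  \S_(X, Y, Z <- Φ) \S_(x, y, z <- Φ') \S_(x1, x2 <- Δ x) F (X * x1) (Y * x2) (Z * y) z
  = \S_(x, y, z <- Φ') \S_(x', y', z' <- Φ') \S_(X, Y, Z <- Φ) \S_(y1, y2 <- Δ y)
    \S_(Z1, Z2 <- Δ Z) F (x * X) (y1 * x' * Y) (y2 * y' * Z1) (z * z' * Z2).
Proof.
move=> lF; have [l1 l2 l3 l4] := lF.
refine (eq_trans _ (eq_trans (congr1 (sum4 F) (pent_123_12_3_4V H)) _)); last by sweedler.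
by apply/esym; sweedler.
Qed.

Lemma phiK_sum U (F : A -> A -> A -> U) : lin3 F ->
  \S_(X, Y, Z <- Φ) \S_(x, y, z <- Φ') F (X * x) (Y * y) (Z * z) = F 1 1 1.
Proof. by move=> lF; rewrite -sum3M // phiK sum3_tp. Qed.

Lemma phiVK_sum U (F : A -> A -> A -> U) : lin3 F ->
  \S_(x, y, z <- Φ') \S_(X, Y, Z <- Φ) F (x * X) (y * Y) (z * Z) = F 1 1 1.
Proof. by move=> lF; rewrite -sum3M // phiVK sum3_tp. Qed.

Lemma eps_l U (L : A -> U) h : lin L -> \S_(h1, h2 <- Δ h) ε h1 *: L h2 = L h.
Proof.
move=> lL; rewrite -{2}(cop_epsl h) (sum2_map _ _ lL).
by apply: eq_sum2 => x y; rewrite (linZ lL).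
Qed.

Lemma eps_r U (L : A -> U) h : lin L -> \S_(h1, h2 <- Δ h) ε h2 *: L h1 = L h.
Proof.
move=> lL; rewrite -{2}(cop_epsr h) (sum2_map _ _ lL).
by apply: eq_sum2 => x y; rewrite (linZ lL).
Qed.

Lemma cop_id_sum U (F : A -> A -> A -> U) t : lin3 F ->
  sum3 F (cop_id Δ t) = \S_(a, b <- t) \S_(a1, a2 <- Δ a) F a1 a2 b.
Proof.
move=> lF; rewrite /cop_id (sum2_map _ _ (sum3_lin lF)); apply: eq_sum2 => a b.
by rewrite (sum2_map _ _ (sum3_lin lF)); apply: eq_sum2 => *; rewrite sum3_tp.
Qed.

Lemma id_cop_sum U (F : A -> A -> A -> U) t : lin3 F ->
  sum3 F (id_cop Δ t) = \S_(a, b <- t) \S_(b1, b2 <- Δ b) F a b1 b2.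
Proof.
move=> lF; rewrite /id_cop (sum2_map _ _ (sum3_lin lF)); apply: eq_sum2 => a b.
rewrite -{1}(sum2_id (Δ b)) (sum2_map _ _ (f := fun u => a ⊠ u)); last by lin.
by rewrite (sum2_map _ _ (sum3_lin lF)); apply: eq_sum2 => *; rewrite sum3_tp.
Qed.

(** Coassociativity as an exchange rule instead of a conjugation: this is naturality of the
    associator, moving h from one side of Φ to the other. *)
Lemma coassoc U (F : A -> A -> A -> U) h : lin3 F ->
  \S_(X, Y, Z <- Φ) \S_(h1, h2 <- Δ h) \S_(h11, h12 <- Δ h1) F (X * h11) (Y * h12) (Z * h2)
  = \S_(X, Y, Z <- Φ) \S_(h1, h2 <- Δ h) \S_(h21, h22 <- Δ h2) F (h1 * X) (h21 * Y) (h22 * Z).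
Proof.
move=> lF; have [l1 l2 l3] := lF.
have E : Φ * cop_id Δ (Δ h) = id_cop Δ (Δ h) * Φ.
  by rewrite copA -mulrA phiVK -!tp1 mulr1.
have := congr1 (sum3 F) E; rewrite !sum3M // => {}E.
refine (eq_trans _ (eq_trans E _)).
  by apply: eq_sum3 => X Y Z; rewrite cop_id_sum //; lin.
rewrite id_cop_sum; last by lin.
by permute_sums.
Qed.

Lemma coassocV U (F : A -> A -> A -> U) h : lin3 F ->
  \S_(x, y, z <- Φ') \S_(h1, h2 <- Δ h) \S_(h21, h22 <- Δ h2) F (x * h1) (y * h21) (z * h22)
  = \S_(x, y, z <- Φ') \S_(h1, h2 <- Δ h) \S_(h11, h12 <- Δ h1) F (h11 * x) (h12 * y) (h2 * z).
Proof.
move=> lF; have [l1 l2 l3] := lF.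
have E : Φ' * id_cop Δ (Δ h) = cop_id Δ (Δ h) * Φ'.
  by rewrite copA !mulrA phiVK -!tp1 mul1r.
have := congr1 (sum3 F) E; rewrite !sum3M // => {}E.
refine (eq_trans _ (eq_trans E _)).
  by apply: eq_sum3 => X Y Z; rewrite id_cop_sum //; lin.
rewrite cop_id_sum; last by lin.
by permute_sums.
Qed.

Lemma phi_eps1_sum U (F : A -> A -> U) : lin2 F ->
  \S_(X, Y, Z <- Φ) ε X *: F Y Z = F 1 1.
Proof.
move=> lF; have := congr1 (sum2 F) (phi_eps1 H); rewrite sum2_tp // => <-.
rewrite (sum3_map _ _ (sum2_lin lF)); apply: eq_sum3 => X Y Z.
by rewrite (linZ (sum2_lin lF)) sum2_tp.
Qed.

Lemma phi_eps2_sum U (F : A -> A -> U) : lin2 F ->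
  \S_(X, Y, Z <- Φ) ε Y *: F X Z = F 1 1.
Proof.
move=> lF; have := congr1 (sum2 F) (phi_eps2 H); rewrite sum2_tp // => <-.
rewrite (sum3_map _ _ (sum2_lin lF)); apply: eq_sum3 => X Y Z.
by rewrite (linZ (sum2_lin lF)) sum2_tp.
Qed.

Lemma phi_eps3_sum U (F : A -> A -> U) : lin2 F ->
  \S_(X, Y, Z <- Φ) ε Z *: F X Y = F 1 1.
Proof.
move=> lF; have := congr1 (sum2 F) (phi_eps3 H); rewrite sum2_tp // => <-.
rewrite (sum3_map _ _ (sum2_lin lF)); apply: eq_sum3 => X Y Z.
by rewrite (linZ (sum2_lin lF)) sum2_tp.
Qed.

(** Apply ε to the first leg of ΦΦ⁻¹ = 1; the factor Φ disappears since its own counit is trivial.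
    The two lemmas that follow do the same on the other legs. *)
Lemma phiV_eps1_sum U (F : A -> A -> U) : lin2 F ->
  \S_(x, y, z <- Φ') ε x *: F y z = F 1 1.
Proof.
move=> lF; have [l1 l2] := lF.
have := phiK_sum (F := fun a b c => ε a *: F b c); rewrite eps1 scale1r => <-; last by lin.
transitivity (\S_(X, Y, Z <- Φ) ε X *: \S_(x, y, z <- Φ') ε x *: F (Y * y) (Z * z)).
  rewrite (phi_eps1_sum (F := fun Y Z => \S_(x, y, z <- Φ') ε x *: F (Y * y) (Z * z))).
    by apply: eq_sum3 => x y z; rewrite !mul1r.
  by lin.
apply: eq_sum3 => X Y Z; rewrite (sum3_map _ _ (lin_scaler (ε X) (@lin_id _ _))).
by apply: eq_sum3 => x y z; rewrite scalerA epsM.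
Qed.

Lemma phiV_eps2_sum U (F : A -> A -> U) : lin2 F ->
  \S_(x, y, z <- Φ') ε y *: F x z = F 1 1.
Proof.
move=> lF; have [l1 l2] := lF.
have := phiK_sum (F := fun b a c => ε a *: F b c); rewrite eps1 scale1r => <-; last by lin.
transitivity (\S_(X, Y, Z <- Φ) ε Y *: \S_(x, y, z <- Φ') ε y *: F (X * x) (Z * z)).
  rewrite (phi_eps2_sum (F := fun Y Z => \S_(x, y, z <- Φ') ε y *: F (Y * x) (Z * z))).
    by apply: eq_sum3 => x y z; rewrite !mul1r.
  by lin.
apply: eq_sum3 => X Y Z; rewrite (sum3_map _ _ (lin_scaler (ε Y) (@lin_id _ _))).
by apply: eq_sum3 => x y z; rewrite scalerA epsM.
Qed.

Lemma phiV_eps3_sum U (F : A -> A -> U) : lin2 F ->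
  \S_(x, y, z <- Φ') ε z *: F x y = F 1 1.
Proof.
move=> lF; have [l1 l2] := lF.
have := phiK_sum (F := fun b c a => ε a *: F b c); rewrite eps1 scale1r => <-; last by lin.
transitivity (\S_(X, Y, Z <- Φ) ε Z *: \S_(x, y, z <- Φ') ε z *: F (X * x) (Y * y)).
  rewrite (phi_eps3_sum (F := fun Y Z => \S_(x, y, z <- Φ') ε z *: F (Y * x) (Z * y))).
    by apply: eq_sum3 => x y z; rewrite !mul1r.
  by lin.
apply: eq_sum3 => X Y Z; rewrite (sum3_map _ _ (lin_scaler (ε Z) (@lin_id _ _))).
by apply: eq_sum3 => x y z; rewrite scalerA epsM.
Qed.

(* Pattern of [S(h_1) α h_2] and [h_1 β S(h_2)]: what is summed against [Δ h]    *)
(* only sees [ε h], so a component of [Φ] under such a [K] disappears.         *)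
Definition absorbs (V : lmodType k) (K : A -> A -> V) (c : V) : Prop :=
  forall h, \S_(h1, h2 <- Δ h) K h1 h2 = ε h *: c.

Section Absorb.
Variables (V U : lmodType k) (K : A -> A -> V) (c : V) (G : V -> A -> A -> U).
Hypotheses (Kc : absorbs K c) (lG : lin3 G).

Let absorbG h y z : \S_(h1, h2 <- Δ h) G (K h1 h2) y z = ε h *: G c y z.
Proof.
have [l1 _ _] := lG; rewrite -(linZ (l1 y z)) -Kc.
by rewrite (sum2_map _ _ (l1 y z)).
Qed.

Let lGc : lin2 (G c).
Proof. by case: lG. Qed.

Lemma absorb_phi1 :
  \S_(X, Y, Z <- Φ) \S_(h1, h2 <- Δ X) G (K h1 h2) Y Z = G c 1 1.
Proof. by rewrite -(phi_eps1_sum lGc); apply: eq_sum3 => *; apply: absorbG. Qed.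

Lemma absorb_phi2 :
  \S_(X, Y, Z <- Φ) \S_(h1, h2 <- Δ Y) G (K h1 h2) X Z = G c 1 1.
Proof. by rewrite -(phi_eps2_sum lGc); apply: eq_sum3 => *; apply: absorbG. Qed.

Lemma absorb_phi3 :
  \S_(X, Y, Z <- Φ) \S_(h1, h2 <- Δ Z) G (K h1 h2) X Y = G c 1 1.
Proof. by rewrite -(phi_eps3_sum lGc); apply: eq_sum3 => *; apply: absorbG. Qed.

Lemma absorb_phiV1 :
  \S_(X, Y, Z <- Φ') \S_(h1, h2 <- Δ X) G (K h1 h2) Y Z = G c 1 1.
Proof. by rewrite -(phiV_eps1_sum lGc); apply: eq_sum3 => *; apply: absorbG. Qed.

Lemma absorb_phiV2 :
  \S_(X, Y, Z <- Φ') \S_(h1, h2 <- Δ Y) G (K h1 h2) X Z = G c 1 1.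
Proof. by rewrite -(phiV_eps2_sum lGc); apply: eq_sum3 => *; apply: absorbG. Qed.

Lemma absorb_phiV3 :
  \S_(X, Y, Z <- Φ') \S_(h1, h2 <- Δ Z) G (K h1 h2) X Y = G c 1 1.
Proof. by rewrite -(phiV_eps3_sum lGc); apply: eq_sum3 => *; apply: absorbG. Qed.

End Absorb.

Lemma absorb_l (V U : lmodType k) (K : A -> A -> V) (c : V) (G : V -> A -> U) h :
  absorbs K c -> lin2 G ->
  \S_(h1, h2 <- Δ h) \S_(a, b <- Δ h1) G (K a b) h2 = G c h.
Proof.
move=> Kc [l1 l2]; rewrite -(eps_l h (l1 c)); apply: eq_sum2 => h1 h2.
by rewrite -(linZ (l2 h2)) -Kc (sum2_map _ _ (l2 h2)).
Qed.

Lemma absorb_r (V U : lmodType k) (K : A -> A -> V) (c : V) (G : V -> A -> U) h :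
  absorbs K c -> lin2 G ->
  \S_(h1, h2 <- Δ h) \S_(a, b <- Δ h2) G (K a b) h1 = G c h.
Proof.
move=> Kc [l1 l2]; rewrite -(eps_r h (l1 c)); apply: eq_sum2 => h1 h2.
by rewrite -(linZ (l2 h1)) -Kc (sum2_map _ _ (l2 h1)).
Qed.

Lemma phi_ant_sum U (L : A -> U) : lin L ->
  \S_(X, Y, Z <- Φ) L (X * β * S Y * α * Z) = L 1.
Proof. by move=> lL; rewrite -(phi_ant H) (sum3_map _ _ lL). Qed.

Lemma phiV_ant_sum U (L : A -> U) : lin L ->
  \S_(x, y, z <- Φ') L (S x * α * y * β * S z) = L 1.
Proof. by move=> lL; rewrite -(phiV_ant H) (sum3_map _ _ lL). Qed.

(** A pentagon places β and α so that each absorbs one component of Φ or Φ⁻¹, and what is left is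
    X¹βS(X²)αX³ = 1. With p_L = X²S⁻¹(X¹β) ⊗ X³ and q_L = S(x¹)αx² ⊗ x³ this is the classical
    relation S(p¹)q¹p²₁ ⊗ q²p²₂ = 1 ⊗ 1. It gives [evl_be] and, together with [al_be_cancel], the
    invertibility of the last factor of [iso]. *)
Lemma be_al_cancel U (F : A -> A -> U) : lin2 F ->
  \S_(X, Y, Z <- Φ) \S_(x, y, z <- Φ') \S_(Z1, Z2 <- Δ Z)
    F (X * β * S (x * Y) * α * y * Z1) (z * Z2) = F 1 1.
Proof.
move=> lF; have [l1 l2] := lF.
step (pent_234V_1_2_34_sum (F := fun a b c d => F (a * β * S b * α * c) d)).
step (absorb_phiV1 (G := fun m y z => \S_(X, Y, Z <- Φ) \S_(X', Y', Z' <- Φ) \S_(Y1, Y2 <- Δ Y)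
        F (X * X' * m * S (Y1 * Y') * α * Y2 * Z' * y) (Z * z)) (@cop_be k H)).
step (absorb_phi2 (G := fun m X Z => \S_(X', Y', Z' <- Φ)
        F (X * X' * β * S Y' * m * Z') Z) (@cop_al k H)).
step (phi_ant_sum (L := fun m => F m 1)).
by [].
Qed.

Lemma al_be_cancel U (F : A -> A -> U) : lin2 F ->
  \S_(x, y, z <- Φ') \S_(X, Y, Z <- Φ) \S_(z1, z2 <- Δ z)
    F (S x * α * y * X * β * S (z1 * Y)) (z2 * Z) = F 1 1.
Proof.
move=> lF; have [l1 l2] := lF.
step (pent_1_2_34V_234_sum (F := fun a b c d => F (S a * α * b * β * S c) d)).
step (absorb_phi1 (G := fun m Y Z => \S_(x, y, z <- Φ') \S_(x', y', z' <- Φ') \S_(y1, y2 <- Δ y')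
        F (S x' * S x * m * y * y1 * β * S (Y * z * y2)) (Z * z')) (@cop_al k H)).
step (absorb_phiV2 (G := fun m x' z' => \S_(x, y, z <- Φ')
        F (S x' * S x * α * y * m * S z) z') (@cop_be k H)).
step (phiV_ant_sum (L := fun m => F m 1)).
by [].
Qed.
End Sweedler.

(** * The Drinfeld twist *)

Section Twist.
Variables (k : fieldType) (H : quasiHopfAlgType k).
Local Notation A := (alg_of H).
Local Notation Δ := (@cop k H).
Local Notation ε := (@eps k H).
Local Notation S := (@ant k H).
Local Notation Φ := (phi H).
Local Notation Φ' := (phiV H).
Local Notation α := (al H).
Local Notation β := (be H).
Implicit Type U : lmodType k.

(* γ and δ of the definition of the Drinfeld twist. *)
Definition gam : tens A A :=
  \S_(X, Y, Z <- Φ) \S_(x, y, z <- Φ') \S_(x1, x2 <- Δ x)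
    (S (Y * x2) * α * Z * y) ⊠ (S (X * x1) * α * z).
Definition del : tens A A :=
  \S_(X, Y, Z <- Φ) \S_(x, y, z <- Φ') \S_(X1, X2 <- Δ X)
    (X1 * x * β * S Z) ⊠ (X2 * y * β * S (Y * z)).

Lemma del_sum U (F : A -> A -> U) : lin2 F ->
  sum2 F del = \S_(X, Y, Z <- Φ) \S_(x, y, z <- Φ') \S_(X1, X2 <- Δ X)
    F (X1 * x * β * S Z) (X2 * y * β * S (Y * z)).
Proof.
move=> lF; rewrite /del (sum3_map _ _ (sum2_lin lF)); apply: eq_sum3 => X Y Z.
rewrite (sum3_map _ _ (sum2_lin lF)); apply: eq_sum3 => x y z.
by rewrite (sum2_map _ _ (sum2_lin lF)); apply: eq_sum2 => *; rewrite sum2_tp.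
Qed.

Lemma gam_sum U (F : A -> A -> U) : lin2 F ->
  sum2 F gam = \S_(X, Y, Z <- Φ) \S_(x, y, z <- Φ') \S_(x1, x2 <- Δ x)
    F (S (Y * x2) * α * Z * y) (S (X * x1) * α * z).
Proof.
move=> lF; rewrite /gam (sum3_map _ _ (sum2_lin lF)); apply: eq_sum3 => X Y Z.
rewrite (sum3_map _ _ (sum2_lin lF)); apply: eq_sum3 => x y z.
by rewrite (sum2_map _ _ (sum2_lin lF)); apply: eq_sum2 => *; rewrite sum2_tp.
Qed.

Lemma absorb0 (V U : lmodType k) (K : A -> A -> V) (c : V) (L : V -> U) h :
  absorbs K c -> lin L -> \S_(h1, h2 <- Δ h) L (K h1 h2) = ε h *: L c.
Proof. by move=> Kc lL; rewrite -(linZ lL) -Kc (sum2_map _ _ lL). Qed.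

(** Coassociativity brings two components of h around the β of the second leg, where they are
    absorbed; the remaining two are then absorbed by the β of the first leg. *)
Lemma del_absorb_sum U (F : A -> A -> U) h : lin2 F ->
  \S_(h1, h2 <- Δ h) \S_(h11, h12 <- Δ h1) \S_(h21, h22 <- Δ h2) \S_(u, v <- del)
     F (h11 * u * S h22) (h12 * v * S h21) = ε h *: \S_(u, v <- del) F u v.
Proof.
move=> lF; have [l1 l2] := lF.
transitivity (\S_(h1, h2 <- Δ h) \S_(h11, h12 <- Δ h1) \S_(h21, h22 <- Δ h2)
   \S_(X, Y, Z <- Φ) \S_(x, y, z <- Φ') \S_(X1, X2 <- Δ X)
    F (h11 * X1 * x * β * S Z * S h22) (h12 * X2 * y * β * S (Y * z) * S h21)).
  do 3!apply: eq_sum2 => ? ?; rewrite del_sum; last by lin.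
  by sweedler.
step (esym (coassoc (F := fun a b c => \S_(x, y, z <- Φ') \S_(a1, a2 <- Δ a)
  F (a1 * x * β * S c) (a2 * y * β * S (b * z))) h ltac:(lin))).
step (eq_sum3 Φ (fun X Y Z => eq_sum2 (Δ h) (fun h1 h2 => esym (coassocV
  (F := fun a b c => \S_(X1, X2 <- Δ X)
  F (X1 * a * β * S (Z * h2)) (X2 * b * β * S (Y * c))) h1 ltac:(lin))))).
step (eq_sum3 Φ (fun X Y Z => eq_sum2 (Δ h) (fun h1 h2 => absorb_r
  (G := fun m a => \S_(X1, X2 <- Δ X) \S_(x, y, z <- Φ')
  F (X1 * x * a * β * S (Z * h2)) (X2 * y * m * S (Y * z))) h1 (@cop_be k H) ltac:(lin)))).
rewrite del_sum //.
step (absorb0 (L := fun m => \S_(X, Y, Z <- Φ) \S_(X1, X2 <- Δ X) \S_(x, y, z <- Φ')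
  F (X1 * x * m * S Z) (X2 * y * β * S (Y * z))) h (@cop_be k H) ltac:(lin)).
congr (_ *: _); sweedler.
Qed.

Lemma gam_absorb_sum U (F : A -> A -> U) h : lin2 F ->
  \S_(h1, h2 <- Δ h) \S_(h11, h12 <- Δ h1) \S_(h21, h22 <- Δ h2) \S_(u, v <- gam)
     F (S h12 * u * h21) (S h11 * v * h22) = ε h *: \S_(u, v <- gam) F u v.
Proof.
move=> lF; have [l1 l2] := lF.
transitivity (\S_(h1, h2 <- Δ h) \S_(h11, h12 <- Δ h1) \S_(h21, h22 <- Δ h2)
   \S_(X, Y, Z <- Φ) \S_(x, y, z <- Φ') \S_(x1, x2 <- Δ x)
    F (S (Y * x2 * h12) * α * Z * y * h21) (S (X * x1 * h11) * α * z * h22)).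
  do 3!apply: eq_sum2 => ? ?; rewrite gam_sum; last by lin.
  by sweedler.
step (coassocV (F := fun a b c => \S_(X, Y, Z <- Φ) \S_(a1, a2 <- Δ a)
  F (S (Y * a2) * α * Z * b) (S (X * a1) * α * c)) h ltac:(lin)).
step (eq_sum3 Φ' (fun x y z => eq_sum2 (Δ h) (fun h1 h2 => coassoc
  (F := fun a b c => \S_(x1, x2 <- Δ x)
  F (S (b * x2) * α * c * y) (S (a * x1) * α * h2 * z)) h1 ltac:(lin)))).
step (eq_sum3 Φ' (fun x y z => eq_sum2 (Δ h) (fun h1 h2 => absorb_r
  (G := fun m a => \S_(x1, x2 <- Δ x) \S_(X, Y, Z <- Φ)
  F (S (Y * x2) * m * Z * y) (S (a * X * x1) * α * h2 * z)) h1 (@cop_al k H) ltac:(lin)))).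
rewrite gam_sum //.
step (absorb0 (L := fun m => \S_(X, Y, Z <- Φ) \S_(x, y, z <- Φ') \S_(x1, x2 <- Δ x)
  F (S (Y * x2) * α * Z * y) (S (X * x1) * m * z)) h (@cop_al k H) ltac:(lin)).
congr (_ *: _); sweedler.
Qed.

(** The analogue of X¹βS(X²)αX³ = 1 for the pair δ, γ. Pentagons and absorptions reduce the first
    leg to that very expression, and then the second leg in the same way. *)
Lemma del_gam_sum U (F : A -> A -> U) : lin2 F ->
  \S_(X, Y, Z <- Φ) \S_(X1, X2 <- Δ X) \S_(Y1, Y2 <- Δ Y) \S_(Z1, Z2 <- Δ Z)
  \S_(u, v <- del) \S_(u', v' <- gam)
    F (X1 * u * S Y2 * u' * Z1) (X2 * v * S Y1 * v' * Z2) = F 1 1.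
Proof.
move=> lF; have [l1 l2] := lF.
transitivity (\S_(X, Y, Z <- Φ) \S_(X1, X2 <- Δ X) \S_(Y1, Y2 <- Δ Y) \S_(Z1, Z2 <- Δ Z)
  \S_(P, Q, R <- Φ) \S_(p, q, r <- Φ') \S_(P1, P2 <- Δ P)
  \S_(L, M, N <- Φ) \S_(l, m, n <- Φ') \S_(l1, l2 <- Δ l)
  F (X1 * P1 * p * β * S (M * l2 * Y2 * R) * α * N * m * Z1)
    (X2 * P2 * q * β * S (L * l1 * Y1 * Q * r) * α * n * Z2)).
  apply: eq_sum3 => *; do 3!apply: eq_sum2 => ? ?; rewrite del_sum; last by lin.
  do 2!apply: eq_sum3 => ? ? ?; apply: eq_sum2 => ? ?; rewrite gam_sum; last by lin.
  by sweedler.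
step (pent_234V_1_2_34_sum (F := fun u w e g => \S_(u1, u2 <- Δ u) \S_(w1, w2 <- Δ w)
  \S_(P, Q, R <- Φ) \S_(p, q, r <- Φ') \S_(P1, P2 <- Δ P) \S_(L, M, N <- Φ)
  F (u1 * P1 * p * β * S (M * w2 * R) * α * N * e)
    (u2 * P2 * q * β * S (L * w1 * Q * r) * α * g))).
step (eq_sum3 Φ (fun X Y Z => coassoc (F := fun a b c =>
  \S_(X', Y', Z' <- Φ) \S_(x, y, z <- Φ') \S_(x1, x2 <- Δ x)
  \S_(u1, u2 <- Δ (X * X' * x1)) \S_(w1, w2 <- Δ (Y' * x2))
  \S_(P, Q, R <- Φ) \S_(p, q, r <- Φ') \S_(P1, P2 <- Δ P)
  F (u1 * P1 * p * β * S (b * w2 * R) * α * c * Z' * y)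
    (u2 * P2 * q * β * S (a * w1 * Q * r) * α * Z * z)) Y ltac:(lin))).
step (eq_sum3 Φ (fun X Y Z => absorb_r (G := fun a h =>
  \S_(X', Y', Z' <- Φ) \S_(x, y, z <- Φ') \S_(x1, x2 <- Δ x) \S_(L, M, N <- Φ)
  \S_(u1, u2 <- Δ (X * X' * x1)) \S_(w1, w2 <- Δ (Y' * x2))
  \S_(P, Q, R <- Φ) \S_(p, q, r <- Φ') \S_(P1, P2 <- Δ P)
  F (u1 * P1 * p * β * S (M * w2 * R) * a * N * Z' * y)
    (u2 * P2 * q * β * S (h * L * w1 * Q * r) * α * Z * z)) Y (@cop_al k H) ltac:(lin))).
step (eq_sum3 Φ' (fun x y z => esym (coassoc (F := fun a b c =>
  \S_(X, Y, Z <- Φ) \S_(X', Y', Z' <- Φ) \S_(L, M, N <- Φ)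
  \S_(u1, u2 <- Δ (X * X' * a)) \S_(w1, w2 <- Δ Y') \S_(p, q, r <- Φ')
  F (u1 * p * β * S (M * w2 * c) * α * N * Z' * y)
    (u2 * q * β * S (Y * L * w1 * b * r) * α * Z * z)) x ltac:(lin)))).
step (pent_sum (F := fun u c d e =>
  \S_(X, Y, Z <- Φ) \S_(x, y, z <- Φ') \S_(p, q, r <- Φ') \S_(x1, x2 <- Δ x)
  \S_(x11, x12 <- Δ x1) \S_(u1, u2 <- Δ (X * u * x11))
  F (u1 * p * β * S (d * x2) * α * e * y)
    (u2 * q * β * S (Y * c * x12 * r) * α * Z * z))).
step (absorb_phi3 (G := fun a V V' => \S_(W, W', W'' <- Φ) \S_(W1, W2 <- Δ W)
  \S_(X, Y, Z <- Φ) \S_(x, y, z <- Φ') \S_(p, q, r <- Φ') \S_(x1, x2 <- Δ x)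
  \S_(x11, x12 <- Δ x1) \S_(u1, u2 <- Δ (X * V * W1 * x11))
  F (u1 * p * β * S (W' * x2) * a * W'' * y)
    (u2 * q * β * S (Y * V' * W2 * x12 * r) * α * Z * z)) (@cop_al k H)).
step (eq_sum3 Φ (fun W W' W'' => eq_sum3 Φ' (fun x y z => eq_sum2 (Δ x) (fun x1 x2 =>
  esym (coassocV (F := fun a b c => \S_(X, Y, Z <- Φ) \S_(X1, X2 <- Δ X)
  F (X1 * a * β * S (W' * x2) * α * W'' * y)
    (X2 * b * β * S (Y * c) * α * Z * z)) (W * x1) ltac:(lin)))))).
step (eq_sum3 Φ (fun W W' W'' => eq_sum3 Φ' (fun x y z => eq_sum2 (Δ x) (fun x1 x2 =>
  absorb_r (G := fun b a => \S_(X, Y, Z <- Φ) \S_(X1, X2 <- Δ X) \S_(p, q, r <- Φ')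
  F (X1 * p * a * β * S (W' * x2) * α * W'' * y)
    (X2 * q * b * S (Y * r) * α * Z * z)) (W * x1) (@cop_be k H) ltac:(lin))))).
step (absorb_phiV1 (G := fun b y z => \S_(W, W', W'' <- Φ) \S_(X, Y, Z <- Φ)
  \S_(X1, X2 <- Δ X) \S_(p, q, r <- Φ')
  F (X1 * p * W * b * S W' * α * W'' * y) (X2 * q * β * S (Y * r) * α * Z * z))
  (@cop_be k H)).
step (phi_ant_sum (L := fun a => \S_(X, Y, Z <- Φ)
  \S_(X1, X2 <- Δ X) \S_(p, q, r <- Φ') F (X1 * p * a) (X2 * q * β * S (Y * r) * α * Z))).
step (pent_12_3_4_123V_sum (F := fun a b c d => F a (b * β * S c * α * d))).
step (absorb_phiV3 (G := fun a x y => \S_(X, Y, Z <- Φ) \S_(X', Y', Z' <- Φ)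
  \S_(y1, y2 <- Δ Y') F (x * X') (y * X * y1 * β * S (Y * y2) * a * Z * Z')) (@cop_al k H)).
step (absorb_phi2 (G := fun b x z => \S_(X, Y, Z <- Φ)
  F x (X * b * S Y * α * Z * z)) (@cop_be k H)).
step (phi_ant_sum (L := fun a => F 1 a)).
by [].
Qed.

End Twist.

Section TwistInverse.
Variables (k : fieldType) (H : quasiHopfAlgType k).
Local Notation A := (alg_of H).
Local Notation Δ := (@cop k H).
Local Notation S := (@ant k H).
Local Notation Φ := (phi H).
Local Notation Φ' := (phiV H).
Local Notation α := (al H).
Local Notation γ := (gam H).
Local Notation δ := (del H).
Implicit Type U : lmodType k.

Definition SS (h : A) : tens A A := \S_(h1, h2 <- Δ h) S h2 ⊠ S h1.

Lemma SS_lin : lin SS.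
Proof. by rewrite /SS; lin. Qed.
#[local] Hint Resolve SS_lin : linear_db.

Lemma SS_sum U (F : A -> A -> U) h : lin2 F ->
  sum2 F (SS h) = \S_(h1, h2 <- Δ h) F (S h2) (S h1).
Proof.
move=> lF; rewrite /SS (sum2_map _ _ (sum2_lin lF)).
by apply: eq_sum2 => *; rewrite sum2_tp.
Qed.

Ltac sum_ext ::= (apply: SS_sum; lin).

Lemma SSM a b : SS (a * b) = SS b * SS a.
Proof.
rewrite /SS sum_copM; last by lin.
rewrite sum2_mull sum2C; apply: eq_sum2 => b1 b2.
by rewrite sum2_mulr; apply: eq_sum2 => a1 a2; rewrite tpM !antM.
Qed.

Lemma cop_one : Δ 1 = 1.
Proof. by rewrite cop1 -tp1. Qed.

Lemma SS1 : SS 1 = 1.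
Proof. by rewrite /SS sum_cop1; [rewrite ant1 -tp1 | lin]. Qed.

(* f⁻¹; the two properties needed of it, [SS_twistV] and [cop_al_twist], are    *)
(* proved without f itself.                                                     *)
Definition twistV : tens A A :=
  \S_(x, y, z <- Φ') Δ (S x * α * y) * δ * SS z.

Lemma tens_eq (B C : algType k) (P Q : tens B C) :
  (forall U (F : B -> C -> U), lin2 F -> sum2 F P = sum2 F Q) -> P = Q.
Proof. by move=> PQ; rewrite -(sum2_id P) -(sum2_id Q); apply: PQ; lin. Qed.

Opaque SS del gam.

(** [del_absorb], [gam_absorb] and [del_gam] say that [SS], with γ and δ in the roles of α and β,
    behaves as an antipode along Δ : H → H ⊗ H. So does Δ ∘ S with Δ(α) and Δ(β), and f⁻¹ is the
    intertwiner given by the uniqueness of antipodes up to a twist. *)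
Lemma del_absorb : absorbs (fun a b => Δ a * δ * SS b) δ.
Proof.
move=> h; apply: tens_eq => U F lF; have [l1 l2] := lF; have lF' := sum2_lin lF.
rewrite (sum2_map _ _ lF') (linZ lF') -del_absorb_sum //.
sweedler.
Qed.

Lemma gam_absorb : absorbs (fun a b => SS a * γ * Δ b) γ.
Proof.
move=> h; apply: tens_eq => U F lF; have [l1 l2] := lF; have lF' := sum2_lin lF.
rewrite (sum2_map _ _ lF') (linZ lF') -gam_absorb_sum //.
sweedler.
Qed.

Lemma del_gam :
  \S_(X, Y, Z <- Φ) Δ X * δ * SS Y * γ * Δ Z = 1 ⊠ 1.
Proof.
apply: tens_eq => U F lF; have [l1 l2] := lF; have lF' := sum2_lin lF.
rewrite (sum3_map _ _ lF') sum2_tp // -del_gam_sum //.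
sweedler.
Qed.

Ltac leaf_ext ::= rewrite ?(ant1, mul1r, mulr1, antM) ?(cop_one, SS1, SSM, copM).

(** The uniqueness argument for antipodes: α is made to emit a pair of components of h,
    coassociativity carries h across Φ⁻¹, and δ absorbs the pair that has reached it. *)
Lemma SS_twistV h : Δ (S h) * twistV = twistV * SS h.
Proof.
rewrite /twistV.
apply: esym.
transitivity (\S_(x, y, z <- Φ') Δ (S x * α * y) * δ * SS (h * z)); first by sweedler.
step (esym (@absorb_l k H _ _ (fun a b => S a * α * b) _
 (fun a h2 => \S_(x, y, z <- Φ') Δ (S x * a * y) * δ * SS (h2 * z)) h (@cop_al k H) ltac:(lin))).
step (esym (@coassocV k H _ (fun a b c => Δ (S a * α * b) * δ * SS c) h ltac:(lin))).
step (absorb_r (G := fun d h => \S_(x, y, z <- Φ') Δ (S (x * h) * α * y) * d * SS z) h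
  del_absorb ltac:(lin)).
by sweedler.
Qed.

(** Inserting a copy of Φ whose first component is absorbed by α permits a pentagon; then γ and δ
    absorb one component each, and [del_gam] finishes. *)
Lemma cop_al_twist : Δ α = twistV * γ.
Proof.
apply: esym; rewrite /twistV.
step (esym (@absorb_phi1 k H _ _ (fun a b => S a * α * b) _
  (fun a Y Z => \S_(x, y, z <- Φ') Δ (S x * a * y) * δ * SS (Y * z) * γ * Δ Z)
  (@cop_al k H) ltac:(lin))).
step (@pent_12_3_4_123V_sum k H _ (fun p q r s => Δ (S p * α * q) * δ * SS r * γ * Δ s) ltac:(lin)).
step (absorb_phiV3 (G := fun g x y => \S_(X, Y, Z <- Φ) \S_(X', Y', Z' <- Φ)
  \S_(y1, y2 <- Δ Y') Δ (S (x * X') * α * y * X * y1) * δ * SS (Y * y2) * g * Δ (Z * Z'))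
  gam_absorb).
step (absorb_phi2 (G := fun d x z => \S_(X, Y, Z <- Φ)
   Δ (S x * α * X) * d * SS Y * γ * Δ (Z * z)) del_absorb).
transitivity (Δ α * (1 ⊠ 1)); last by rewrite -tp1 mulr1.
by rewrite -del_gam; sweedler.
Qed.

Opaque twistV.

(** The factor S(Y)αZ occurs in [ev]; this is its coproduct as needed when λ is applied to
    [ev b]. *)
Lemma cop_ant_al_sum U (F : A -> A -> U) a b : lin2 F ->
  sum2 F (Δ (S a * α * b)) = \S_(g, g' <- twistV) \S_(a1, a2 <- Δ a)
    \S_(u, v <- γ) \S_(b1, b2 <- Δ b) F (g * S a2 * u * b1) (g' * S a1 * v * b2).
Proof.
move=> lF; rewrite !copM cop_al_twist mulrA SS_twistV.
by have [l1 l2] := lF; sweedler.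
Qed.

End TwistInverse.
Global Opaque SS del gam twistV.

#[local] Hint Resolve SS_lin : linear_db.

(** * The algebra B^v and its coaction *)

Ltac map_norm :=
  repeat match goal with
  | vM : forall x y, ?v (x * y) = ?v x * ?v y |- context [?v (_ * _)] => rewrite vM
  | v1 : ?v 1 = 1 |- context [?v 1] => rewrite v1
  end.

Ltac leaf_ext ::= rewrite ?(ant1, mul1r, mulr1, antM); map_norm.
Ltac sum_ext ::= (apply: SS_sum; lin).

Section ComoduleAlgebra.
Variables (k : fieldType) (H : quasiHopfAlgType k).
Local Notation A := (alg_of H).
Local Notation Δ := (@cop k H).
Local Notation ε := (@eps k H).
Local Notation S := (@ant k H).
Local Notation Φ := (phi H).
Local Notation Φ' := (phiV H).
Local Notation α := (al H).
Local Notation β := (be H).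
Local Notation g_ := (twistV H).
Implicit Type U : lmodType k.
Variables (B : algType k) (v : A -> B) (λ : B -> tens A B).

Definition act (h : A) (b : B) : B := \S_(h1, h2 <- Δ h) v h1 * b * v (S h2).

Definition mul (b b' : B) : B :=
  \S_(X, Y, Z <- Φ) \S_(x, y, z <- Φ') \S_(Z1, Z2 <- Δ Z)
    v X * b * v (S (x * Y) * α * y * Z1) * b' * v (S (z * Z2)).

(* S(q² h) has been expanded to S(h) S(R) α T, with q² = S⁻¹(α T) R.             *)
Definition coact (b : B) : tens A B :=
  \S_(X, Y, Z <- Φ) \S_(X', Y', Z' <- Φ) \S_(X1, X2 <- Δ X') \S_(Y1, Y2 <- Δ Y')
  \S_(Q, R, T <- Φ) \S_(g, g' <- g_) \S_(b1, b0 <- λ b)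
    (X * X1 * b1 * g * S Y2 * S R * α * T * Z')
    ⊠ (v (Y * X2) * b0 * v (g' * S (Z * Q * Y1))).

(* The action of b ∈ B^v on a B-module, applied to the unit of B.               *)
Definition ev (b : B) : B := \S_(X, Y, Z <- Φ) v X * b * v (S Y * α * Z).

Hypotheses (v_lin : lin v) (vM : forall x y, v (x * y) = v x * v y) (v1 : v 1 = 1).
Hypotheses (λ_lin : lin λ) (λM : forall b b', λ (b * b') = λ b * λ b').
Hypothesis λv : forall h, λ (v h) = \S_(h1, h2 <- Δ h) h1 ⊠ v h2.

Lemma act_lin h : lin (act h).
Proof. by rewrite /act; lin. Qed.

Lemma act_linl b : lin (fun h => act h b).
Proof. by rewrite /act; lin. Qed.

Lemma ev_lin : lin ev.
Proof. by rewrite /ev; lin. Qed.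

Lemma coact_lin : lin coact.
Proof. by rewrite /coact; lin. Qed.

#[local] Hint Resolve act_lin ev_lin coact_lin : linear_db.

(** The action map b ⊗ x ↦ b·x is H-linear: coassociativity moves h across Φ, and the two components
    that land around α are absorbed. *)
Lemma ev_act h b : \S_(h1, h2 <- Δ h) ev (act h1 b) * v h2 = v h * ev b.
Proof.
rewrite /ev /act.
step (coassoc (F := fun p q r => v p * b * v (S q * α * r)) h ltac:(lin)).
step (eq_sum3 Φ (fun X Y Z => absorb_r (G := fun m h => v (h * X) * b * v (S Y * m * Z)) h
  (@cop_al k H) ltac:(lin))).
by sweedler.
Qed.

(** The product is made so that actions compose: up to the associator, acting with [mul b b'] is
    acting with b' and then with b. The pentagons bring each α next to the components that it
    absorbs. *)
Lemma ev_mul b b' :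
  ev (mul b b') = \S_(X, Y, Z <- Φ) ev (act X b) * ev (act Y b') * v Z.
Proof.
rewrite /ev /act /mul.
step (eq_sum3 Φ (fun W W' W'' => esym (absorb_l (K := fun a b => S a * α * b)
  (G := fun a h => \S_(X, Y, Z <- Φ) \S_(x, y, z <- Φ') \S_(Z1, Z2 <- Δ Z)
    v (W * X) * b * v (S (x * Y) * a * y * Z1) * b' * v (S (h * z * Z2) * α * W''))
  W' (@cop_al k H) ltac:(lin)))).
step (eq_sum3 Φ (fun W W' W'' => esym (coassocV
  (F := fun p q r => \S_(X, Y, Z <- Φ) \S_(Z1, Z2 <- Δ Z)
    v (W * X) * b * v (S (p * Y) * α * q * Z1) * b' * v (S (r * Z2) * α * W''))
  W' ltac:(lin)))).
step (@pent_1_23_4_123_sum k H _ (fun p q r s => \S_(x, y, z <- Φ') \S_(r1, r2 <- Δ r)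
  v p * b * v (S (x * q) * α * y * r1) * b' * v (S (z * r2) * α * s)) ltac:(lin)).
step (@pent_123V_1_23_4V_sum k H _ (fun a b1 c d => \S_(X, Y, Z <- Φ) \S_(X', Y', Z' <- Φ)
  \S_(Z1, Z2 <- Δ Z) \S_(X1, X2 <- Δ X') \S_(Z11, Z12 <- Δ Z1) \S_(Y1, Y2 <- Δ Y')
  v (X * X1) * b * v (S (a * Y * X2) * α * b1 * Z11 * Y1) * b'
   * v (S (c * Z12 * Y2) * α * d * Z2 * Z')) ltac:(lin)).
step (absorb_phiV1 (G := fun m y z => \S_(x', y', z' <- Φ') \S_(R, R', R'' <- Φ)
  \S_(z1, z2 <- Δ z') \S_(X, Y, Z <- Φ) \S_(X', Y', Z' <- Φ)
  \S_(Z1, Z2 <- Δ Z) \S_(X1, X2 <- Δ X') \S_(Z11, Z12 <- Δ Z1) \S_(Y1, Y2 <- Δ Y')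
  v (X * X1) * b * v (S (x' * Y * X2) * m * y' * R * Z11 * Y1) * b'
   * v (S (y * z1 * R' * Z12 * Y2) * α * z * z2 * R'' * Z2 * Z')) (@cop_al k H) ltac:(lin)).
step (absorb_phiV3 (G := fun m x' y' => \S_(R, R', R'' <- Φ)
  \S_(X, Y, Z <- Φ) \S_(X', Y', Z' <- Φ)
  \S_(Z1, Z2 <- Δ Z) \S_(X1, X2 <- Δ X') \S_(Z11, Z12 <- Δ Z1) \S_(Y1, Y2 <- Δ Y')
  v (X * X1) * b * v (S (x' * Y * X2) * α * y' * R * Z11 * Y1) * b'
   * v (S (R' * Z12 * Y2) * m * R'' * Z2 * Z')) (@cop_al k H) ltac:(lin)).
step (eq_sum3 Φ (fun X Y Z => coassoc (F := fun p q r => \S_(X', Y', Z' <- Φ)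
  \S_(X1, X2 <- Δ X') \S_(Y1, Y2 <- Δ Y')
  v (X * X1) * b * v (S (Y * X2) * α * p * Y1) * b' * v (S (q * Y2) * α * r * Z'))
  Z ltac:(lin))).
step (eq_sum3 Φ (fun X Y Z => absorb_r (G := fun m h => \S_(R, R', R'' <- Φ)
  \S_(X', Y', Z' <- Φ) \S_(X1, X2 <- Δ X') \S_(Y1, Y2 <- Δ Y')
  v (X * X1) * b * v (S (Y * X2) * α * h * R * Y1) * b' * v (S (R' * Y2) * m * R'' * Z'))
  Z (@cop_al k H) ltac:(lin))).
by sweedler.
Qed.

(** After one pentagon, α and β absorb everything except S(x¹)αx²βS(x³) = 1. Hence equality in B^v
    can be tested on the actions of translates. *)
Lemma ev_rec b : \S_(x, y, z <- Φ') ev (act x b) * v (y * β * S z) = b.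
Proof.
rewrite /ev /act.
step (@pent_123_12_3_4V_sum k H _ (fun p q r s => v p * b * v (S q * α * r * β * S s)) ltac:(lin)).
step (absorb_phiV2 (G := fun m x z => \S_(x', y', z' <- Φ') \S_(X, Y, Z <- Φ) \S_(Z1, Z2 <- Δ Z)
  v (x * X) * b * v (S (x' * Y) * m * y' * Z1 * β * S (z * z' * Z2))) (@cop_al k H) ltac:(lin)).
step (absorb_phi3 (G := fun m X Y => \S_(x', y', z' <- Φ')
  v X * b * v (S (x' * Y) * α * y' * m * S z')) (@cop_be k H) ltac:(lin)).
step (phiV_ant_sum (L := fun m => b * v m)).
by rewrite v1 mulr1.
Qed.

Lemma act_be h : act h (v β) = ε h *: v β.
Proof.
rewrite /act -(linZ v_lin) -cop_be (sum2_map _ _ v_lin).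
by apply: eq_sum2 => a b; rewrite !vM.
Qed.

Lemma actM g h b : act (g * h) b = act g (act h b).
Proof. by rewrite /act; sweedler. Qed.

Lemma act1 b : act 1 b = b.
Proof. by rewrite /act sum_cop1; [rewrite ant1 v1 mul1r mulr1 | lin]. Qed.

Lemma act_mul h b b' :
  \S_(h1, h2 <- Δ h) mul (act h1 b) (act h2 b') = act h (mul b b').
Proof.
rewrite /mul /act.
step (coassoc (F := fun p q r => \S_(x, y, z <- Φ') \S_(r1, r2 <- Δ r)
  v p * b * v (S (x * q) * α * y * r1) * b' * v (S (z * r2))) h ltac:(lin)).
step (eq_sum2 (Δ h) (fun h1 h2 => coassocV (F := fun p q r => \S_(X, Y, Z <- Φ) \S_(Z1, Z2 <- Δ Z)
  v (h1 * X) * b * v (S (p * Y) * α * q * Z1) * b' * v (S (r * Z2))) h2 ltac:(lin))).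
step (eq_sum2 (Δ h) (fun h1 h2 => absorb_l (G := fun m h2 =>
  \S_(X, Y, Z <- Φ) \S_(x, y, z <- Φ') \S_(Z1, Z2 <- Δ Z)
  v (h1 * X) * b * v (S (x * Y) * m * y * Z1) * b' * v (S (h2 * z * Z2))) h2
  (@cop_al k H) ltac:(lin))).
by sweedler.
Qed.

Lemma λ_sum U (F : A -> B -> U) x b y : lin2 F ->
  sum2 F (λ (v x * b * v y)) = \S_(x1, x2 <- Δ x) \S_(b1, b0 <- λ b) \S_(y1, y2 <- Δ y)
    F (x1 * b1 * y1) (v x2 * b0 * v y2).
Proof. by move=> lF; have [l1 l2] := lF; rewrite !λM !λv; sweedler. Qed.

Lemma λ_sum2 U (C D : algType k) (F : A -> B -> U) (G : C -> D -> B) t : lin2 F ->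
  sum2 F (λ (sum2 G t)) = \S_(x, y <- t) sum2 F (λ (G x y)).
Proof. by move=> lF; rewrite (sum2_map _ _ (lin_comp (sum2_lin lF) λ_lin)). Qed.

Lemma λ_sum3 U (C D E : algType k) (F : A -> B -> U) (G : C -> D -> E -> B) t : lin2 F ->
  sum2 F (λ (sum3 G t)) = \S_(x, y, z <- t) sum2 F (λ (G x y z)).
Proof. by move=> lF; rewrite (sum3_map _ _ (lin_comp (sum2_lin lF) λ_lin)). Qed.

Ltac sum_ext ::= first
  [ apply: SS_sum; lin
  | lazymatch goal with |- sum2 _ (λ (sum2 _ _)) = _ => apply: λ_sum2; lin end
  | lazymatch goal with |- sum2 _ (λ (sum3 _ _)) = _ => apply: λ_sum3; lin end
  | lazymatch goal with |- sum2 _ (λ (_ * _)) = _ => apply: λ_sum; lin end ].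

Lemma cop_ant_twist U (F : A -> A -> U) h : lin2 F ->
  \S_(s, s' <- Δ (S h)) \S_(g, g' <- g_) F (s * g) (s' * g')
  = \S_(h1, h2 <- Δ h) \S_(g, g' <- g_) F (g * S h2) (g' * S h1).
Proof.
move=> lF; have [l1 l2] := lF.
transitivity (sum2 F (Δ (S h) * g_)); first by sweedler.
by rewrite SS_twistV; sweedler.
Qed.

Lemma sum_coact U (F : A -> B -> U) b : lin2 F ->
  sum2 F (coact b) = \S_(X, Y, Z <- Φ) \S_(X', Y', Z' <- Φ) \S_(X1, X2 <- Δ X')
  \S_(Y1, Y2 <- Δ Y') \S_(Q, R, T <- Φ) \S_(g, g' <- g_) \S_(b1, b0 <- λ b)
    F (X * X1 * b1 * g * S Y2 * S R * α * T * Z')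
      (v (Y * X2) * b0 * v (g' * S (Z * Q * Y1))).
Proof. by move=> lF; have [l1 l2] := lF; rewrite /coact; sweedler.
Qed.

Lemma sum_coact_act U (F : A -> B -> U) h b : lin2 F ->
  sum2 F (coact (act h b)) = \S_(X, Y, Z <- Φ) \S_(X', Y', Z' <- Φ) \S_(X1, X2 <- Δ X')
  \S_(Y1, Y2 <- Δ Y') \S_(Q, R, T <- Φ) \S_(g, g' <- g_) \S_(b1, b0 <- λ b)
  \S_(h1, h2 <- Δ h) \S_(h11, h12 <- Δ h1) \S_(h21, h22 <- Δ h2)
    F (X * X1 * h11 * b1 * g * S (Y2 * h22) * S R * α * T * Z')
      (v (Y * X2 * h12) * b0 * v (g' * S (Z * Q * Y1 * h21))).
Proof.
move=> lF; have [l1 l2] := lF; rewrite sum_coact // /act.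
transitivity (\S_(X, Y, Z <- Φ) \S_(X', Y', Z' <- Φ) \S_(X1, X2 <- Δ X')
  \S_(Y1, Y2 <- Δ Y') \S_(Q, R, T <- Φ) \S_(b1, b0 <- λ b) \S_(h1, h2 <- Δ h)
  \S_(h11, h12 <- Δ h1) \S_(s, s' <- Δ (S h2)) \S_(g, g' <- g_)
    F (X * X1 * h11 * b1 * (s * g) * S Y2 * S R * α * T * Z')
      (v (Y * X2 * h12) * b0 * v (s' * g' * S (Z * Q * Y1)))).
  sweedler.
apply: eq_sum3 => X Y Z; apply: eq_sum3 => X' Y' Z'; apply: eq_sum2 => X1 X2.
apply: eq_sum2 => Y1 Y2; apply: eq_sum3 => Q R T.
step (eq_sum2 (λ b) (fun b1 b0 => eq_sum2 (Δ h) (fun h1 h2 => cop_ant_twist (F := fun s s' =>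
  \S_(h11, h12 <- Δ h1)
    F (X * X1 * h11 * b1 * s * S Y2 * S R * α * T * Z')
      (v (Y * X2 * h12) * b0 * v (s' * S (Z * Q * Y1)))) h2 ltac:(lin)))).
by sweedler.
Qed.

(** The compatibility of action and coaction in a Yetter-Drinfeld module. The twist f⁻¹ turns
    Δ(S(h)) into S(h₂) ⊗ S(h₁), the α of q_R absorbs one pair of components, and the rest is
    coassociativity. *)
Lemma coact_act h b :
  \S_(h1, h2 <- Δ h) coact (act h1 b) * (h2 ⊠ 1)
  = \S_(h1, h2 <- Δ h) \S_(b1, b0 <- coact b) (h1 * b1) ⊠ act h2 b0.
Proof.
transitivity (\S_(h1, h2 <- Δ h) \S_(b1, b0 <- coact (act h1 b)) (b1 * h2) ⊠ b0).
  apply: eq_sum2 => h1 h2; rewrite -{1}(sum2_id (coact (act h1 b))) sum2_mull.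
  by apply: eq_sum2 => b1 b0; rewrite tpM mulr1.
transitivity (\S_(X, Y, Z <- Φ) \S_(X', Y', Z' <- Φ) \S_(X1, X2 <- Δ X')
  \S_(Y1, Y2 <- Δ Y') \S_(Q, R, T <- Φ) \S_(g, g' <- g_) \S_(b1, b0 <- λ b)
  \S_(h', h3 <- Δ h) \S_(h1, h2 <- Δ h') \S_(h11, h12 <- Δ h1) \S_(h21, h22 <- Δ h2)
    (X * X1 * h11 * b1 * g * S (Y2 * h22) * S R * α * T * Z' * h3)
    ⊠ (v (Y * X2 * h12) * b0 * v (g' * S (Z * Q * Y1 * h21)))).
  refine (eq_trans (eq_sum2 _ (fun h' h3 => sum_coact_act h' b _)) _); first by lin.
  by sweedler.
step (coassoc (F := fun p q r => \S_(X, Y, Z <- Φ) \S_(X1, X2 <- Δ p) \S_(Y1, Y2 <- Δ q)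
    \S_(Q, R, T <- Φ) \S_(g, g' <- g_) \S_(b1, b0 <- λ b)
    (X * X1 * b1 * g * S Y2 * S R * α * T * r)
    ⊠ (v (Y * X2) * b0 * v (g' * S (Z * Q * Y1)))) h ltac:(lin)).
step (eq_sum2 (Δ h) (fun h1 h2 => coassoc (F := fun p q r =>
    \S_(X, Y, Z <- Φ) \S_(X', Y', Z' <- Φ) \S_(X1, X2 <- Δ (h1 * X')) \S_(Y1, Y2 <- Δ Y')
    \S_(g, g' <- g_) \S_(b1, b0 <- λ b)
    (X * X1 * b1 * g * S (q * Y2) * α * r * Z')
    ⊠ (v (Y * X2) * b0 * v (g' * S (Z * p * Y1)))) h2 ltac:(lin))).
step (eq_sum2 (Δ h) (fun h1 h2 => absorb_r (G := fun m p =>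
    \S_(X, Y, Z <- Φ) \S_(X', Y', Z' <- Φ) \S_(X1, X2 <- Δ (h1 * X')) \S_(Y1, Y2 <- Δ Y')
    \S_(Q, R, T <- Φ) \S_(g, g' <- g_) \S_(b1, b0 <- λ b)
    (X * X1 * b1 * g * S (R * Y2) * m * T * Z')
    ⊠ (v (Y * X2) * b0 * v (g' * S (Z * p * Q * Y1)))) h2 (@cop_al k H) ltac:(lin))).
step (coassoc (F := fun p q r =>
    \S_(X', Y', Z' <- Φ) \S_(X1, X2 <- Δ X') \S_(Y1, Y2 <- Δ Y')
    \S_(Q, R, T <- Φ) \S_(g, g' <- g_) \S_(b1, b0 <- λ b)
    (p * X1 * b1 * g * S (R * Y2) * α * T * Z')
    ⊠ (v (q * X2) * b0 * v (g' * S (r * Q * Y1)))) h ltac:(lin)).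
apply: esym.
refine (eq_trans (eq_sum2 _ (fun h1 h2 => sum_coact b _)) _); first by rewrite /act; lin.
by rewrite /act; sweedler.
Qed.

(** The compatibility read through F: it moves h across the coaction, between its argument and its
    output, and serves as the naturality of the braiding in the coherence computations. *)
Lemma coact_cross U (F : A -> B -> U) h b : lin2 F ->
  \S_(h1, h2 <- Δ h) \S_(c, c0 <- coact (act h1 b)) F (c * h2) c0
  = \S_(h1, h2 <- Δ h) \S_(c, c0 <- coact b) F (h1 * c) (act h2 c0).
Proof.
move=> lF; have [l1 l2] := lF; have := congr1 (sum2 F) (coact_act h b) => E.
refine (eq_trans _ (eq_trans E _)); last first.
  by rewrite sum22 //; apply: eq_sum2 => h1 h2; rewrite sum22 //; apply: eq_sum2 => *;
     rewrite sum2_tp.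
rewrite sum22 //; apply: eq_sum2 => h1 h2; rewrite sum2M // sum2C.
by rewrite sum2_tp; [apply: eq_sum2 => *; rewrite mulr1 | lin].
Qed.

(* The action on (N ⊗ X) of an element of N ⊗ B^v, where N = H and X = B.        *)
Definition co_ev (t : tens A B) : tens A B :=
  \S_(X, Y, Z <- Φ) \S_(t1, t0 <- t) (X * t1) ⊠ (ev (act Y t0) * v Z).

(** Both sides are brought to one expression in f⁻¹: on the left by a pentagon and an absorption, on
    the right by expanding Δ(S(Y)αZ), where f⁻¹γ appears. *)
Lemma co_ev_coact b :
  co_ev (coact b) = \S_(X, Y, Z <- Φ) λ (ev (act X b)) * (Y ⊠ v Z).
Proof.
transitivity (\S_(W, W', W'' <- Φ) \S_(X, Y, Z <- Φ) \S_(X', Y', Z' <- Φ)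
  \S_(X1, X2 <- Δ X') \S_(Y1, Y2 <- Δ Y') \S_(Q, R, T <- Φ) \S_(g, g' <- g_)
  \S_(b1, b0 <- λ b) \S_(W1, W2 <- Δ W') \S_(P, P', P'' <- Φ)
  (W * X * X1 * b1 * g * S Y2 * S R * α * T * Z')
  ⊠ (v (P * W1 * Y * X2) * b0 * v (g' * S (P' * W2 * Z * Q * Y1) * α * P'' * W''))).
  rewrite /co_ev.
  refine (eq_trans (eq_sum3 _ (fun W W' W'' => sum_coact b _)) _).
    by lin.
  by rewrite /ev /act; sweedler.
step (@pent_sum k H _ (fun p q r s =>
  \S_(X', Y', Z' <- Φ)
  \S_(X1, X2 <- Δ X') \S_(Y1, Y2 <- Δ Y') \S_(Q, R, T <- Φ) \S_(g, g' <- g_)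
  \S_(b1, b0 <- λ b)
  (p * X1 * b1 * g * S Y2 * S R * α * T * Z')
  ⊠ (v (q * X2) * b0 * v (g' * S (r * Q * Y1) * α * s))) ltac:(lin)).
step (absorb_phi3 (G := fun m p q => \S_(W, W', W'' <- Φ) \S_(W1, W2 <- Δ W)
  \S_(X', Y', Z' <- Φ)
  \S_(X1, X2 <- Δ X') \S_(Y1, Y2 <- Δ Y') \S_(Q, R, T <- Φ) \S_(g, g' <- g_)
  \S_(b1, b0 <- λ b)
  (p * W1 * X1 * b1 * g * S Y2 * S R * α * T * Z')
  ⊠ (v (q * W2 * X2) * b0 * v (g' * S (W' * Q * Y1) * m * W''))) (@cop_al k H) ltac:(lin)).
apply: esym.
(* λ is multiplicative and restricts to (id ⊗ v)Δ on the image of v, so applying it to [ev] produces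
   the coproduct of S(Y)αZ. *)
transitivity (\S_(V, V', V'' <- Φ) \S_(Z, Z', Z'' <- Φ) \S_(V1, V2 <- Δ V)
  \S_(Z1, Z2 <- Δ (Z * V1)) \S_(b1, b0 <- λ b)
  \S_(s, s' <- Δ (S (Z' * V2) * α * Z''))
  (Z1 * b1 * s * V') ⊠ (v Z2 * b0 * v (s' * V''))).
  apply: eq_sum3 => V V' V''; rewrite -{1}(sum2_id (λ _)) sum2_mull.
  refine (eq_trans (eq_sum2 _ (fun x y => tpM _ _ _ _)) _).
  by rewrite /ev /act; sweedler.
refine (eq_trans (eq_sum3 _ (fun V V' V'' => eq_sum3 _ (fun Z Z' Z'' =>
  eq_sum2 _ (fun V1 V2 => eq_sum2 _ (fun Z1 Z2 => eq_sum2 _ (fun b1 b0 =>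
   cop_ant_al_sum (F := fun s s' => (Z1 * b1 * s * V') ⊠ (v Z2 * b0 * v (s' * V'')))
   (Z' * V2) Z'' ltac:(lin))))))) _).
transitivity (\S_(V, V', V'' <- Φ) \S_(Z, Z', Z'' <- Φ) \S_(V1, V2 <- Δ V)
  \S_(Z1, Z2 <- Δ (Z * V1)) \S_(b1, b0 <- λ b) \S_(g, g' <- g_) \S_(w1, w2 <- Δ (Z' * V2))
  \S_(L, M, N <- Φ) \S_(l, m, n <- Φ') \S_(l1, l2 <- Δ l) \S_(z1, z2 <- Δ Z'')
  (Z1 * b1 * g * S (M * l2 * w2) * α * N * m * z1 * V')
  ⊠ (v Z2 * b0 * v (g' * S (L * l1 * w1) * α * n * z2 * V''))).
  do 2!apply: eq_sum3 => ? ? ?; do 3!apply: eq_sum2 => ? ?.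
  do 2!apply: eq_sum2 => ? ?.
  refine (eq_trans (gam_sum _) _); first by lin.
  by sweedler.
step (esym (@pent_1_23_4_123_sum k H _ (fun a w d e =>
  \S_(Z1, Z2 <- Δ a) \S_(b1, b0 <- λ b) \S_(g, g' <- g_) \S_(w1, w2 <- Δ w)
  \S_(L, M, N <- Φ)
  (Z1 * b1 * g * S (M * w2) * α * N * d)
  ⊠ (v Z2 * b0 * v (g' * S (L * w1) * α * e))) ltac:(lin))).
step (eq_sum3 Φ (fun X Y Z => coassoc (F := fun p q r => \S_(X', Y', Z' <- Φ)
  \S_(Z1, Z2 <- Δ (X * X')) \S_(b1, b0 <- λ b) \S_(g, g' <- g_) \S_(w1, w2 <- Δ Y')
  (Z1 * b1 * g * S (q * w2) * α * r * Z')
  ⊠ (v Z2 * b0 * v (g' * S (p * w1) * α * Z))) Y ltac:(lin))).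
step (eq_sum3 Φ (fun X Y Z => absorb_r (G := fun a h => \S_(X', Y', Z' <- Φ)
  \S_(L, M, N <- Φ)
  \S_(Z1, Z2 <- Δ (X * X')) \S_(b1, b0 <- λ b) \S_(g, g' <- g_) \S_(w1, w2 <- Δ Y')
  (Z1 * b1 * g * S (M * w2) * a * N * Z')
  ⊠ (v Z2 * b0 * v (g' * S (h * L * w1) * α * Z))) Y (@cop_al k H) ltac:(lin))).
by sweedler.
Qed.

Lemma co_ev_lin : lin co_ev.
Proof. by rewrite /co_ev; lin. Qed.
#[local] Hint Resolve co_ev_lin : linear_db.

Lemma co_ev_tp a b : co_ev (a ⊠ b) = \S_(X, Y, Z <- Φ) (X * a) ⊠ (ev (act Y b) * v Z).
Proof. by apply: eq_sum3 => X Y Z; rewrite sum2_tp //; lin. Qed.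

Lemma co_ev_mull t h : co_ev (t * (h ⊠ 1)) = co_ev t * (h ⊠ 1).
Proof.
move: t; apply: tens_lin_eq; [by lin | by lin |] => a b.
rewrite tpM mulr1 !co_ev_tp sum3_mull; apply: eq_sum3 => X Y Z.
by rewrite tpM mulr1 mulrA.
Qed.

Lemma ev_act_sum U (L : B -> U) h b : lin L ->
  \S_(h1, h2 <- Δ h) L (ev (act h1 b) * v h2) = L (v h * ev b).
Proof. by move=> lL; rewrite -ev_act (sum2_map _ _ lL). Qed.

Ltac leaf_ext ::= rewrite -?actM ?(ant1, mul1r, mulr1, antM); map_norm.

(** The counterpart of [ev_rec] on N ⊗ X: linearity of the action pulls [v V'] inside, a pentagon
    lets β absorb a component, and [ev_rec] remains in the second leg. *)
Lemma co_ev_rec t :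
  \S_(V, V', V'' <- Φ) \S_(x, y, z <- Φ')
    (V ⊠ v V') * co_ev (\S_(x1, x2 <- Δ x) \S_(t1, t0 <- t) (x1 * t1) ⊠ act x2 t0)
      * (1 ⊠ v (y * β * S (V'' * z))) = t.
Proof.
have al := act_linl.
move: t; apply: tens_lin_eq; [by lin | by lin |] => a b.
transitivity (\S_(V, V', V'' <- Φ) \S_(x, y, z <- Φ') \S_(x1, x2 <- Δ x) \S_(W, W', W'' <- Φ)
  (V * W * x1 * a)
  ⊠ (v V' * ev (act W' (act x2 b)) * v W'' * v (y * β * S (V'' * z)))).
  apply: eq_sum3 => V V' V''; apply: eq_sum3 => x y z.
  rewrite (sum2_map _ _ co_ev_lin) sum2_mulr sum2_mull; apply: eq_sum2 => x1 x2.
  rewrite sum2_tp; last by lin.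
  rewrite co_ev_tp sum3_mulr sum3_mull; apply: eq_sum3 => W W' W''.
  by rewrite !tpM !mulrA !mulr1.
step (esym (eq_sum3 Φ (fun V V' V'' => eq_sum3 Φ' (fun x y z => eq_sum2 (Δ x) (fun x1 x2 =>
  eq_sum3 Φ (fun W W' W'' => ev_act_sum (L := fun e =>
  (V * W * x1 * a) ⊠ (e * v W'' * v (y * β * S (V'' * z)))) V' (act (W' * x2) b) ltac:(lin))))))).
step (esym (@pent_234V_1_2_34_sum k H _
  (fun p q r s => (p * a) ⊠ (ev (act q b) * v (r * β * S s))) ltac:(lin))).
step (absorb_phi3 (G := fun m X Y => \S_(x, y, z <- Φ')
  (X * a) ⊠ (ev (act (x * Y) b) * v (y * m * S z))) (@cop_be k H) ltac:(lin)).
rewrite -[in RHS](ev_rec b) sum3_tpr; apply: eq_sum3 => x y z.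
by rewrite !mul1r mulr1.
Qed.

(* The defining property of the half-braiding: acting with b on N ⊗ X through λ   *)
(* is the same as moving b past N and then acting on X.                         *)
Lemma λ_ev b : λ (ev b) = \S_(x, y, z <- Φ') co_ev (coact (act x b)) * (y ⊠ v z).
Proof.
have al := act_linl.
apply: esym.
transitivity (\S_(x, y, z <- Φ') \S_(X, Y, Z <- Φ) λ (ev (act (X * x) b)) * ((Y * y) ⊠ v (Z * z))).
  apply: eq_sum3 => x y z; rewrite co_ev_coact sum3_mull; apply: eq_sum3 => X Y Z.
  by rewrite -mulrA tpM actM vM.
step (phiK_sum (F := fun p q r => λ (ev (act p b)) * (q ⊠ v r))).
by rewrite act1 v1 -tp1 mulr1.
Qed.

Lemma λ_ev_sum U (F : A -> B -> U) b : lin2 F ->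
  sum2 F (λ (ev b)) = \S_(x, y, z <- Φ') \S_(X, Y, Z <- Φ) \S_(c, c0 <- coact (act x b))
    F (X * c * y) (ev (act Y c0) * v (Z * z)).
Proof.
move=> lF; have [l1 l2] := lF; rewrite λ_ev sum23 //; apply: eq_sum3 => x y z.
rewrite sum2M // sum2C sum2_tp; last by lin.
rewrite /co_ev sum23; last by lin.
apply: eq_sum3 => X Y Z; rewrite sum22; last by lin.
apply: eq_sum2 => c c0; rewrite sum2_tp; last by lin.
by rewrite vM mulrA.
Qed.

(** By [co_ev_rec], [f u] is determined by [co_ev] of its translates; the compatibility trades a
    translate of [f u] for f of a translate of u, where the last hypothesis applies. *)
Lemma coact_uniq (V : lmodType k) (ac : A -> V -> V) (f g : V -> tens A B) :
  (forall h u, \S_(h1, h2 <- Δ h) f (ac h1 u) * (h2 ⊠ 1)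
     = \S_(h1, h2 <- Δ h) \S_(t1, t0 <- f u) (h1 * t1) ⊠ act h2 t0) ->
  (forall h u, \S_(h1, h2 <- Δ h) g (ac h1 u) * (h2 ⊠ 1)
     = \S_(h1, h2 <- Δ h) \S_(t1, t0 <- g u) (h1 * t1) ⊠ act h2 t0) ->
  (forall u, co_ev (f u) = co_ev (g u)) -> f =1 g.
Proof.
move=> cf cg fg u; rewrite -(co_ev_rec (f u)) -(co_ev_rec (g u)).
apply: eq_sum3 => X Y Z; apply: eq_sum3 => x y z; congr (_ * _ * _).
rewrite -cf -cg !(sum2_map _ _ co_ev_lin); apply: eq_sum2 => h1 h2.
by rewrite !co_ev_mull fg.
Qed.

End ComoduleAlgebra.

(** * The canonical map *)

Section Adjoint.
Variables (k : fieldType) (H : quasiHopfAlgType k).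
Local Notation A := (alg_of H).
Local Notation T := (tens A A).
Local Notation Δ := (@cop k H).
Local Notation ε := (@eps k H).
Local Notation Φ := (phi H).
Local Notation Φ' := (phiV H).
Local Notation β := (be H).
Local Notation idA := (fun x : A => x).
Implicit Type U : lmodType k.

(** The operations of H_0, as the case B = H, v = id, λ = Δ of the preceding section. *)
Definition ad : A -> A -> A := act idA.
Definition evA : A -> A := ev idA.
Definition mulA : A -> A -> A := mul idA.
Definition coA : A -> T := coact idA Δ.

Lemma Δid h : Δ h = \S_(h1, h2 <- Δ h) h1 ⊠ h2.
Proof. by rewrite sum2_id. Qed.

Lemma idM (x y : A) : idA (x * y) = idA x * idA y. Proof. by []. Qed.

Lemma ad_lin h : lin (ad h). Proof. exact: (act_lin _ h). Qed.
Lemma ad_linl b : lin (fun h => ad h b). Proof. exact: (act_linl (@lin_id _ _) b). Qed.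
Lemma evA_lin : lin evA. Proof. exact: ev_lin. Qed.
Lemma mulA_lin b : lin (mulA b). Proof. by rewrite /mulA /mul; lin. Qed.
Lemma mulA_linl b : lin (fun a => mulA a b). Proof. by rewrite /mulA /mul; lin. Qed.
Lemma coA_lin : lin coA. Proof. exact: (coact_lin _ (@cop_lin _ _)). Qed.

Lemma adM g h b : ad (g * h) b = ad g (ad h b).
Proof. exact: (actM (@lin_id _ _) idM). Qed.
Lemma ad1 b : ad 1 b = b.
Proof. exact: (act1 (@lin_id _ _)). Qed.
Lemma ad_be h : ad h β = ε h *: β.
Proof. exact: (act_be (@lin_id _ _) idM). Qed.
Lemma evA_ad h b : \S_(h1, h2 <- Δ h) evA (ad h1 b) * h2 = h * evA b.
Proof. exact: (ev_act (@lin_id _ _) idM). Qed.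
Lemma evA_mul b b' :
  evA (mulA b b') = \S_(X, Y, Z <- Φ) evA (ad X b) * evA (ad Y b') * Z.
Proof. exact: (ev_mul (@lin_id _ _) idM). Qed.
Lemma ad_mul h b b' : \S_(h1, h2 <- Δ h) mulA (ad h1 b) (ad h2 b') = ad h (mulA b b').
Proof. exact: (act_mul (@lin_id _ _) idM). Qed.
Lemma coA_cross U (F : A -> A -> U) h b : lin2 F ->
  \S_(h1, h2 <- Δ h) \S_(c, c0 <- coA (ad h1 b)) F (c * h2) c0
  = \S_(h1, h2 <- Δ h) \S_(c, c0 <- coA b) F (h1 * c) (ad h2 c0).
Proof.
exact: (coact_cross (@lin_id _ _) idM (@cop_lin _ _) (@copM _ _) Δid).
Qed.
Lemma cop_evA_sum U (F : A -> A -> U) b : lin2 F ->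
  sum2 F (Δ (evA b)) = \S_(x, y, z <- Φ') \S_(X, Y, Z <- Φ) \S_(c, c0 <- coA (ad x b))
    F (X * c * y) (evA (ad Y c0) * (Z * z)).
Proof.
exact: (λ_ev_sum (@lin_id _ _) idM erefl (@cop_lin _ _) (@copM _ _) Δid).
Qed.

End Adjoint.

Global Opaque ad evA mulA coA.
#[local] Hint Resolve ad_lin evA_lin mulA_lin coA_lin : linear_db.
Ltac lin_ext ::= first [apply: (lin_comp (eps_lin _)) | apply: (lin_comp (ad_linl _))
  | apply: (lin_comp (mulA_linl _))].
Ltac leaf_ext ::= rewrite -?adM ?(ant1, mul1r, mulr1, antM) ?copM.
Ltac sum_ext ::= fail.

Section CanonicalMap.
Variables (k : fieldType) (H : quasiHopfAlgType k).
Local Notation A := (alg_of H).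
Local Notation T := (tens A A).
Local Notation Δ := (@cop k H).
Local Notation ε := (@eps k H).
Local Notation S := (@ant k H).
Local Notation Φ := (phi H).
Local Notation Φ' := (phiV H).
Local Notation α := (al H).
Local Notation β := (be H).
Implicit Type U : lmodType k.

Lemma evA_ad_sum U (L : A -> U) h b : lin L ->
  \S_(h1, h2 <- Δ h) L (evA (ad h1 b) * h2) = L (h * evA b).
Proof. by move=> lL; rewrite -evA_ad (sum2_map _ _ lL). Qed.

Lemma tp_cop (a b h : A) : (a ⊠ b) * Δ h = \S_(h1, h2 <- Δ h) (a * h1) ⊠ (b * h2).
Proof. by rewrite {1}Δid sum2_mulr; apply: eq_sum2 => *; rewrite tpM. Qed.

Lemma cop_tp (a b h : A) : Δ h * (a ⊠ b) = \S_(h1, h2 <- Δ h) (h1 * a) ⊠ (h2 * b).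
Proof. by rewrite {1}Δid sum2_mull; apply: eq_sum2 => *; rewrite tpM. Qed.

(* The action of a on X ⊗ Y through X alone, applied to 1 ⊗ 1.                  *)
Definition evl (a : A) : T :=
  \S_(X, Y, Z <- Φ) \S_(x, y, z <- Φ') \S_(Z1, Z2 <- Δ Z)
    (X * a * S (x * Y) * α * y * Z1) ⊠ (z * Z2).

Lemma evl_lin : lin evl. Proof. by rewrite /evl; lin. Qed.
#[local] Hint Resolve evl_lin : linear_db.

(** To act on X alone, a ⊗ (X ⊗ Y) is first reassociated to (a ⊗ X) ⊗ Y by Φ⁻¹; a pentagon and an
    absorption turn this into the formula for [evl]. *)
Lemma evl_evA a : evl a = \S_(x, y, z <- Φ') (evA (ad x a) * y) ⊠ z.
Proof.
Transparent evA ad.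
apply: esym; rewrite /evA /ev /ad /act /evl.
step (@pent_123_12_3_4V_sum k H _ (fun p q r s => (p * a * S q * α * r) ⊠ s) ltac:(lin)).
step (absorb_phiV2 (G := fun m x z => \S_(x', y', z' <- Φ') \S_(X, Y, Z <- Φ) \S_(Z1, Z2 <- Δ Z)
  (x * X * a * S (x' * Y) * m * y' * Z1) ⊠ (z * z' * Z2)) (@cop_al k H) ltac:(lin)).
by sweedler.
Opaque evA ad.
Qed.

(** The action on X alone is H-linear on X ⊗ Y, by naturality of Φ⁻¹ and the linearity of [evA].
    This is what makes the exchange of h and a' possible. *)
Lemma evl_ad h a : \S_(h1, h2 <- Δ h) evl (ad h1 a) * Δ h2 = Δ h * evl a.
Proof.
transitivity (\S_(x, y, z <- Φ') \S_(h1, h2 <- Δ h) \S_(h21, h22 <- Δ h2)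
   (evA (ad (x * h1) a) * y * h21) ⊠ (z * h22)).
  rewrite -sum23C; apply: eq_sum2 => h1 h2; rewrite evl_evA sum3_mull.
  by apply: eq_sum3 => x y z; rewrite tp_cop adM.
step (coassocV (F := fun p q r => (evA (ad p a) * q) ⊠ r) h ltac:(lin)).
rewrite evl_evA sum3_mulr; apply: eq_sum3 => x y z; rewrite cop_tp.
apply: eq_sum2 => h1 h2.
step (evA_ad_sum (L := fun e => (e * y) ⊠ (h2 * z)) h1 (ad x a) ltac:(lin)).
by rewrite mulrA.
Qed.

Lemma evl_ad_sum U (L : T -> U) h a : lin L ->
  \S_(h1, h2 <- Δ h) L (evl (ad h1 a) * Δ h2) = L (Δ h * evl a).
Proof. by move=> lL; rewrite -evl_ad (sum2_map _ _ lL). Qed.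

Lemma evl_be : evl β = 1.
Proof. by rewrite /evl tp1; apply: be_al_cancel; lin. Qed.

Lemma evl_mulA a a' :
  evl (mulA a a') = \S_(X, Y, Z <- Φ) evl (ad X a) * evl (ad Y a') * Δ Z.
Proof.
transitivity (\S_(x, y, z <- Φ') \S_(x1, x2 <- Δ x) \S_(X, Y, Z <- Φ)
  (evA (ad (X * x1) a) * evA (ad (Y * x2) a') * Z * y) ⊠ z).
  rewrite evl_evA; apply: eq_sum3 => x y z.
  rewrite -ad_mul (sum2_map _ _ (f := fun m => (evA m * y) ⊠ z)); last by lin.
  apply: eq_sum2 => x1 x2; rewrite evA_mul sum3_mull sum3_tpl.
  by apply: eq_sum3 => X Y Z; rewrite !adM.
step (@pent_123_12_3_4V_sum k H _
  (fun p q r s => (evA (ad p a) * evA (ad q a') * r) ⊠ s) ltac:(lin)).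
transitivity (\S_(x, y, z <- Φ') \S_(x', y', z' <- Φ') \S_(X, Y, Z <- Φ) \S_(Z1, Z2 <- Δ Z)
  (evA (ad (x * X) a) * (y * evA (ad (x' * Y) a')) * y' * Z1) ⊠ (z * z' * Z2)).
  step (eq_sum3 Φ' (fun x y z => eq_sum3 Φ' (fun x' y' z' => eq_sum3 Φ (fun X Y Z =>
    evA_ad_sum (L := fun e => \S_(Z1, Z2 <- Δ Z)
    (evA (ad (x * X) a) * e * y' * Z1) ⊠ (z * z' * Z2)) y (ad (x' * Y) a') ltac:(lin))))).
  by sweedler.
apply: esym.
transitivity (\S_(X, Y, Z <- Φ) \S_(x, y, z <- Φ') \S_(x', y', z' <- Φ')
  ((evA (ad (x * X) a) * y) ⊠ z) * ((evA (ad (x' * Y) a') * y') ⊠ z') * Δ Z).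
  apply: eq_sum3 => X Y Z; rewrite !evl_evA sum3_mull sum3_mull; apply: eq_sum3 => x y z.
  rewrite sum3_mulr sum3_mull; apply: eq_sum3 => x' y' z'.
  by rewrite !adM.
refine (eq_trans (eq_sum3 _ (fun X Y Z => eq_sum3 _ (fun x y z => eq_sum3 _ (fun x' y' z' =>
  eq_trans (congr1 (fun t => t * Δ Z) (tpM _ _ _ _)) (tp_cop _ _ Z))))) _).
by sweedler.
Qed.

(* [iso (a ⊠ h)] acts on X ⊗ Y as h followed by the action of a on X alone; see   *)
(* [evT_iso].                                                                   *)
Definition iso (t : T) : T :=
  \S_(a, h <- t) \S_(x, y, z <- Φ') evl (ad x a) * Δ (y * h * S z).

Lemma iso_lin : lin iso.
Proof. by rewrite /iso; lin. Qed.
#[local] Hint Resolve iso_lin : linear_db.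

Lemma iso_tp a h : iso (a ⊠ h) = \S_(x, y, z <- Φ') evl (ad x a) * Δ (y * h * S z).
Proof. by rewrite /iso sum2_tp; [|lin]. Qed.

Lemma iso_one : iso (β ⊠ β) = Δ β.
Proof.
rewrite iso_tp.
transitivity (\S_(x, y, z <- Φ') ε x *: Δ (y * β * S z)).
  apply: eq_sum3 => x y z; rewrite ad_be (linZ evl_lin) evl_be.
  by rewrite -scalerAl mul1r.
rewrite (phiV_eps1_sum (F := fun y z => Δ (y * β * S z))); last by lin.
by rewrite mul1r ant1 mulr1.
Qed.

Definition adT : A -> T -> T := act Δ.
Definition evT : T -> T := ev Δ.

Lemma iso_ad g a h :
  \S_(g1, g2 <- Δ g) iso (ad g1 a ⊠ ad g2 h) = adT g (iso (a ⊠ h)).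
Proof.
Transparent ad.
transitivity (\S_(x, y, z <- Φ') \S_(g1, g2 <- Δ g) \S_(g21, g22 <- Δ g2)
   evl (ad (x * g1) a) * Δ (y * g21 * h * S (z * g22))).
  rewrite -sum23C; apply: eq_sum2 => g1 g2; rewrite iso_tp; apply: eq_sum3 => x y z.
  rewrite -adM {2}/ad /act.
  rewrite (sum2_map _ _ (f := fun m => evl (ad (x * g1) a) * Δ (y * m * S z))); last by lin.
  by apply: eq_sum2 => g21 g22; rewrite antM !mulrA.
Opaque ad.
step (coassocV (F := fun p q r => evl (ad p a) * Δ (q * h * S r)) g ltac:(lin)).
step (eq_sum3 Φ' (fun x y z => eq_sum2 (Δ g) (fun g1 g2 => evl_ad_sum
  (L := fun m => m * Δ (y * h * S (g2 * z))) g1 (ad x a) ltac:(lin)))).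
by rewrite /adT /act iso_tp; sweedler.
Qed.

(** The working description of [iso]: after Φ has reassociated (a ⊗ h) ⊗ x to a ⊗ (h ⊗ x), h acts on
    X ⊗ Y through Δ and then a acts on X. *)
Lemma evT_iso a h :
  evT (iso (a ⊠ h)) = \S_(X, Y, Z <- Φ) evl (ad X a) * Δ (evA (ad Y h) * Z).
Proof.
rewrite /evT /ev iso_tp.
step (esym (eq_sum3 Φ (fun X Y Z => eq_sum3 Φ' (fun x y z => evl_ad_sum
  (L := fun m => m * Δ (y * h * S z * S Y * α * Z)) X (ad x a) ltac:(lin))))).
step (@pent_12_3_4_123V_sum k H _
  (fun p q r s => evl (ad p a) * Δ (q * h * S r * α * s)) ltac:(lin)).
step (absorb_phiV3 (G := fun m x y => \S_(X, Y, Z <- Φ) \S_(X', Y', Z' <- Φ) \S_(y1, y2 <- Δ Y')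
   evl (ad (x * X') a) * Δ (y * X * y1 * h * S (Y * y2) * m * Z * Z')) (@cop_al k H) ltac:(lin)).
Transparent evA ad.
apply: esym.
transitivity (\S_(X, Y, Z <- Φ) \S_(X', Y', Z' <- Φ) \S_(Y1, Y2 <- Δ Y)
  evl (ad X a) * Δ (X' * Y1 * h * S Y2 * S Y' * α * Z' * Z)).
  apply: eq_sum3 => X Y Z; rewrite /evA /ev {2}/ad /act.
  rewrite (sum3_map _ _ (f := fun m => evl (ad X a) * Δ (m * Z))); last by lin.
  apply: eq_sum3 => X' Y' Z'; rewrite sum2_mulr sum2_mull.
  rewrite (sum2_map _ _ (f := fun m => evl (ad X a) * Δ (m * Z))); last by lin.
  by apply: eq_sum2 => Y1 Y2; rewrite !mulrA.
Opaque evA ad.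
by sweedler.
Qed.

End CanonicalMap.

#[local] Hint Resolve evl_lin iso_lin : linear_db.

(** Puts the argument of [coA] into normal form, so that sums over equal coactions are recognised
    syntactically. *)
Lemma eq_sum_coA (k : fieldType) (H : quasiHopfAlgType k) (U : lmodType k)
    (F : alg_of H -> alg_of H -> U) b b' :
  b = b' -> sum2 F (coA b) = sum2 F (coA b').
Proof. by move->. Qed.

Ltac sum_ext ::=
  lazymatch goal with
  | |- sum2 _ (coA _) = _ => eapply eq_sum_coA;
      progress (rewrite -?adM ?(ant1, mul1r, mulr1, antM) ?mulrA); reflexivity
  end.

(** * Bijectivity of the canonical map *)

Section Bijectivity.
Variables (k : fieldType) (H : quasiHopfAlgType k).
Local Notation A := (alg_of H).
Local Notation T := (tens A A).
Local Notation Δ := (@cop k H).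
Local Notation S := (@ant k H).
Local Notation Φ := (phi H).
Local Notation Φ' := (phiV H).
Local Notation α := (al H).
Local Notation β := (be H).

(** The formula for [iso] is f3 ∘ f2 ∘ f1. The first two factors are actions of Φ⁻¹ and Φ on the two
    legs, inverted by exchanging Φ and Φ⁻¹; f3 is a Galois-type map, inverted by exchanging the
    roles of α and β. *)
Let f1 (t : T) : T := \S_(a, h <- t) \S_(x, y, z <- Φ') ad x a ⊠ (y * h * S z).
Let g1 (t : T) : T := \S_(a, h <- t) \S_(x, y, z <- Φ) ad x a ⊠ (y * h * S z).
Let f2 (t : T) : T := \S_(a, h <- t) \S_(x, y, z <- Φ) (x * a * S y) ⊠ (z * h).
Let g2 (t : T) : T := \S_(a, h <- t) \S_(x, y, z <- Φ') (x * a * S y) ⊠ (z * h).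
Let f3 (t : T) : T := \S_(a, h <- t) \S_(x, y, z <- Φ') \S_(h1, h2 <- Δ h)
  (a * S x * α * y * h1) ⊠ (z * h2).
Let g3 (t : T) : T := \S_(a, h <- t) \S_(X, Y, Z <- Φ) \S_(h1, h2 <- Δ h)
  (a * X * β * S (h1 * Y)) ⊠ (h2 * Z).

Let f1K : cancel f1 g1.
Proof.
apply: tens_lin_eq; [by rewrite /f1 /g1; lin | exact: lin_id | move=> a h].
rewrite /f1 /g1.
step (phiK_sum (F := fun p q r => ad p a ⊠ (q * h * S r))).
by rewrite ad1 ant1 mul1r mulr1.
Qed.

Let g1K : cancel g1 f1.
Proof.
apply: tens_lin_eq; [by rewrite /f1 /g1; lin | exact: lin_id | move=> a h].
rewrite /f1 /g1.
step (phiVK_sum (F := fun p q r => ad p a ⊠ (q * h * S r))).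
by rewrite ad1 ant1 mul1r mulr1.
Qed.

Let f2K : cancel f2 g2.
Proof.
apply: tens_lin_eq; [by rewrite /f2 /g2; lin | exact: lin_id | move=> a h].
rewrite /f2 /g2.
step (phiVK_sum (F := fun p q r => (p * a * S q) ⊠ (r * h))).
by rewrite ant1 !mul1r mulr1.
Qed.

Let g2K : cancel g2 f2.
Proof.
apply: tens_lin_eq; [by rewrite /f2 /g2; lin | exact: lin_id | move=> a h].
rewrite /f2 /g2.
step (phiK_sum (F := fun p q r => (p * a * S q) ⊠ (r * h))).
by rewrite ant1 !mul1r mulr1.
Qed.

(** Coassociativity brings two components of h around β, which absorbs them and leaves h outside a
    copy of [al_be_cancel]; [g3K] is the same with α and [be_al_cancel]. *)
Let f3K : cancel f3 g3.
Proof.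
apply: tens_lin_eq; [by rewrite /f3 /g3; lin | exact: lin_id | move=> a h].
rewrite /f3 /g3.
step (esym (coassoc (F := fun p q r => \S_(x, y, z <- Φ') \S_(z1, z2 <- Δ z)
  (a * S x * α * y * p * β * S (z1 * q)) ⊠ (z2 * r)) h ltac:(lin))).
step (eq_sum3 Φ (fun X Y Z => absorb_l (G := fun m h => \S_(x, y, z <- Φ') \S_(z1, z2 <- Δ z)
  (a * S x * α * y * X * m * S (z1 * Y)) ⊠ (z2 * Z * h)) h (@cop_be k H) ltac:(lin))).
step (@al_be_cancel k H _ (fun p q => (a * p) ⊠ (q * h)) ltac:(lin)).
by rewrite mul1r mulr1.
Qed.

Let g3K : cancel g3 f3.
Proof.
apply: tens_lin_eq; [by rewrite /f3 /g3; lin | exact: lin_id | move=> a h].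
rewrite /f3 /g3.
step (coassocV (F := fun p q r => \S_(X, Y, Z <- Φ) \S_(Z1, Z2 <- Δ Z)
  (a * X * β * S (p * Y) * α * q * Z1) ⊠ (r * Z2)) h ltac:(lin)).
step (eq_sum3 Φ' (fun x y z => absorb_l (G := fun m h => \S_(X, Y, Z <- Φ) \S_(Z1, Z2 <- Δ Z)
  (a * X * β * S (x * Y) * m * y * Z1) ⊠ (h * z * Z2)) h (@cop_al k H) ltac:(lin))).
step (@be_al_cancel k H _ (fun p q => (a * p) ⊠ (h * q)) ltac:(lin)).
by rewrite !mulr1.
Qed.

Lemma iso_bij : bijective (@iso k H).
Proof.
have f_bij : bijective (f3 \o f2 \o f1).
  by apply: bij_comp; [apply: bij_comp; [exists g3 | exists g2] | exists g1].
apply: (eq_bij f_bij); apply: tens_lin_eq; rewrite /comp.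
- by rewrite /f1 /f2 /f3; lin.
- by lin.
move=> a h; rewrite /f1 /f2 /f3 iso_tp /evl.
refine (eq_trans _ (eq_sum3 _ (fun x y z => Logic.eq_sym (sum3_mull _ _ _)))).
apply: esym.
transitivity (\S_(x, y, z <- Φ') \S_(X, Y, Z <- Φ) \S_(x', y', z' <- Φ') \S_(Z1, Z2 <- Δ Z)
  ((X * ad x a * S (x' * Y) * α * y' * Z1) ⊠ (z' * Z2)) * Δ (y * h * S z)).
  apply: eq_sum3 => x y z; apply: eq_sum3 => X Y Z.
  by rewrite sum3_mull; apply: eq_sum3 => x' y' z'; rewrite sum2_mull.
refine (eq_trans (eq_sum3 _ (fun x y z => eq_sum3 _ (fun x0 y0 z0 => eq_sum3 _ (fun x' y' z' =>
  eq_sum2 _ (fun z1 z2 => tp_cop _ _ _))))) _).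
by sweedler.
Qed.

End Bijectivity.

(** * The braided product and its H-linearity *)

Section BraidedProduct.
Variables (k : fieldType) (H : quasiHopfAlgType k).
Local Notation A := (alg_of H).
Local Notation T := (tens A A).
Local Notation Δ := (@cop k H).
Local Notation Φ := (phi H).
Local Notation Φ' := (phiV H).
Local Notation coA := (@coA k H).

Definition bmul (t t' : T) : T :=
  \S_(a, h <- t) \S_(a', h' <- t') \S_(X, Y, Z <- Φ) \S_(P, Q, R <- Φ)
  \S_(x, y, z <- Φ') \S_(p, q, r <- Φ') \S_(Z1, Z2 <- Δ Z) \S_(r1, r2 <- Δ r)
  \S_(c, c0 <- coA (ad (x * Y) h))
    mulA (ad (p * X) a) (ad (q * P * c * y * Z1) a')
    ⊠ mulA (ad (r1 * Q) c0) (ad (r2 * R * z * Z2) h').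

Definition bact (g : A) (t : T) : T := \S_(g1, g2 <- Δ g) \S_(a, h <- t) ad g1 a ⊠ ad g2 h.

Lemma bmul_tp a h a' h' : bmul (a ⊠ h) (a' ⊠ h') =
  \S_(X, Y, Z <- Φ) \S_(P, Q, R <- Φ)
  \S_(x, y, z <- Φ') \S_(p, q, r <- Φ') \S_(Z1, Z2 <- Δ Z) \S_(r1, r2 <- Δ r)
  \S_(c, c0 <- coA (ad (x * Y) h))
    mulA (ad (p * X) a) (ad (q * P * c * y * Z1) a')
    ⊠ mulA (ad (r1 * Q) c0) (ad (r2 * R * z * Z2) h').
Proof. by rewrite /bmul sum2_tp; [rewrite sum2_tp; [|lin] | lin]. Qed.

Lemma bact_tp g a h : bact g (a ⊠ h) = \S_(g1, g2 <- Δ g) ad g1 a ⊠ ad g2 h.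
Proof. by rewrite /bact; apply: eq_sum2 => g1 g2; rewrite sum2_tp; [|lin]. Qed.

(** g is carried through the constituents of the braided product: the associators by [coassoc] and
    [coassocV], the braiding by [coA_cross], the two products of H_0 by [ad_mul]. Needed to compare
    translates in [iso_mul]. *)
Lemma bact_bmul_tp g a h a' h' :
  \S_(g1, g2 <- Δ g) bmul (bact g1 (a ⊠ h)) (bact g2 (a' ⊠ h'))
  = bact g (bmul (a ⊠ h) (a' ⊠ h')).
Proof.
transitivity (\S_(g1, g2 <- Δ g) \S_(g11, g12 <- Δ g1) \S_(g21, g22 <- Δ g2)
  \S_(X, Y, Z <- Φ) \S_(P, Q, R <- Φ)
  \S_(x, y, z <- Φ') \S_(p, q, r <- Φ') \S_(Z1, Z2 <- Δ Z) \S_(r1, r2 <- Δ r)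
  \S_(c, c0 <- coA (ad (x * Y * g12) h))
    mulA (ad (p * X * g11) a) (ad (q * P * c * y * Z1 * g21) a')
    ⊠ mulA (ad (r1 * Q) c0) (ad (r2 * R * z * Z2 * g22) h')).
  apply: eq_sum2 => g1 g2; rewrite !bact_tp.
  rewrite (sum2_map _ _ (f := fun t => bmul t _)); last by rewrite /bmul; lin.
  apply: eq_sum2 => g11 g12.
  rewrite (sum2_map _ _ (f := fun t => bmul _ t)); last by rewrite /bmul; lin.
  by apply: eq_sum2 => g21 g22; rewrite bmul_tp; sweedler.
step (coassoc (F := fun u v w => \S_(P, Q, R <- Φ)
  \S_(x, y, z <- Φ') \S_(p, q, r <- Φ') \S_(w1, w2 <- Δ w) \S_(r1, r2 <- Δ r)
  \S_(c, c0 <- coA (ad (x * v) h))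
    mulA (ad (p * u) a) (ad (q * P * c * y * w1) a')
    ⊠ mulA (ad (r1 * Q) c0) (ad (r2 * R * z * w2) h')) g ltac:(lin)).
step (eq_sum2 (Δ g) (fun g1 g2 => coassocV (F := fun u v w =>
  \S_(X, Y, Z <- Φ) \S_(P, Q, R <- Φ)
  \S_(p, q, r <- Φ') \S_(Z1, Z2 <- Δ Z) \S_(r1, r2 <- Δ r)
  \S_(c, c0 <- coA (ad (u * Y) h))
    mulA (ad (p * g1 * X) a) (ad (q * P * c * v * Z1) a')
    ⊠ mulA (ad (r1 * Q) c0) (ad (r2 * R * w * Z2) h')) g2 ltac:(lin))).
step (eq_sum2 (Δ g) (fun g1 g2 => eq_sum2 (Δ g2) (fun g21 g22 =>
  eq_sum3 Φ (fun X Y Z => eq_sum3 Φ' (fun x y z =>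
  coA_cross (F := fun c c0 =>
  \S_(P, Q, R <- Φ) \S_(p, q, r <- Φ') \S_(Z1, Z2 <- Δ Z) \S_(r1, r2 <- Δ r)
    mulA (ad (p * g1 * X) a) (ad (q * P * c * y * Z1) a')
    ⊠ mulA (ad (r1 * Q) c0) (ad (r2 * R * g22 * z * Z2) h')) g21 (ad (x * Y) h) ltac:(lin)))))).
step (eq_sum2 (Δ g) (fun g1 g2 => coassoc (F := fun u v w =>
  \S_(X, Y, Z <- Φ) \S_(x, y, z <- Φ') \S_(c, c0 <- coA (ad (x * Y) h))
  \S_(p, q, r <- Φ') \S_(Z1, Z2 <- Δ Z) \S_(r1, r2 <- Δ r)
    mulA (ad (p * g1 * X) a) (ad (q * u * c * y * Z1) a')
    ⊠ mulA (ad (r1 * v) c0) (ad (r2 * w * z * Z2) h')) g2 ltac:(lin))).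
step (coassocV (F := fun u v w =>
  \S_(X, Y, Z <- Φ) \S_(P, Q, R <- Φ) \S_(x, y, z <- Φ') \S_(c, c0 <- coA (ad (x * Y) h))
  \S_(Z1, Z2 <- Δ Z) \S_(r1, r2 <- Δ w)
    mulA (ad (u * X) a) (ad (v * P * c * y * Z1) a')
    ⊠ mulA (ad (r1 * Q) c0) (ad (r2 * R * z * Z2) h')) g ltac:(lin)).
apply: esym; rewrite /bact bmul_tp.
transitivity (\S_(g1, g2 <- Δ g) \S_(g11, g12 <- Δ g1) \S_(g21, g22 <- Δ g2)
  \S_(X, Y, Z <- Φ) \S_(P, Q, R <- Φ)
  \S_(x, y, z <- Φ') \S_(p, q, r <- Φ') \S_(Z1, Z2 <- Δ Z) \S_(r1, r2 <- Δ r)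
  \S_(c, c0 <- coA (ad (x * Y) h))
    mulA (ad (g11 * p * X) a) (ad (g12 * q * P * c * y * Z1) a')
    ⊠ mulA (ad (g21 * r1 * Q) c0) (ad (g22 * r2 * R * z * Z2) h')).
  apply: eq_sum2 => g1 g2.
  transitivity (\S_(X, Y, Z <- Φ) \S_(P, Q, R <- Φ)
  \S_(x, y, z <- Φ') \S_(p, q, r <- Φ') \S_(Z1, Z2 <- Δ Z) \S_(r1, r2 <- Δ r)
  \S_(c, c0 <- coA (ad (x * Y) h))
    ad g1 (mulA (ad (p * X) a) (ad (q * P * c * y * Z1) a'))
    ⊠ ad g2 (mulA (ad (r1 * Q) c0) (ad (r2 * R * z * Z2) h'))); first by sweedler.
  refine (eq_trans (eq_sum3 _ (fun X Y Z => eq_sum3 _ (fun P Q R => eq_sum3 _ (fun x y z =>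
   eq_sum3 _ (fun p q r => eq_sum2 _ (fun Z1 Z2 => eq_sum2 _ (fun r1 r2 => eq_sum2 _ (fun c c0 =>
    congr2 (fun u v : A => u ⊠ v) (esym (ad_mul _ _ _)) (esym (ad_mul _ _ _)))))))))) _).
  by sweedler.
by sweedler.
Qed.

End BraidedProduct.

(** * Multiplicativity *)

Section ProductCoherence.
Variables (k : fieldType) (H : quasiHopfAlgType k).
Local Notation A := (alg_of H).
Local Notation T := (tens A A).
Local Notation Δ := (@cop k H).
Local Notation Φ := (phi H).
Local Notation Φ' := (phiV H).
Local Notation coA := (@coA k H).
Implicit Type U : lmodType k.

(** The exchange at the origin of the braiding. Acting with a on X and then with h on X ⊗ Y is
    acting with h_(0) first and with the h_(-1)-translate of a afterwards: Δ(ev h) is given by the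
    half-braiding, and [evl] is H-linear. *)
Lemma cop_evA_evl_sum U (L : T -> U) h a : lin L ->
  L (Δ (evA h) * evl a) = \S_(x, y, z <- Φ') \S_(X, Y, Z <- Φ) \S_(c, c0 <- coA (ad x h))
    L (evl (ad (X * c * y) a) * Δ (evA (ad Y c0) * (Z * z))).
Proof.
move=> lL; rewrite -evl_ad_sum //.
by rewrite (cop_evA_sum (F := fun e1 e2 => L (evl (ad e1 a) * Δ e2))); last by lin.
Qed.

Lemma evl_ad_mulA z a b : evl (ad z (mulA a b)) = \S_(z1, z2 <- Δ z) \S_(X, Y, Z <- Φ)
  evl (ad (X * z1) a) * evl (ad (Y * z2) b) * Δ Z.
Proof.
rewrite -ad_mul (sum2_map _ _ (@evl_lin _ _)); apply: eq_sum2 => z1 z2.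
by rewrite evl_mulA; apply: eq_sum3 => X Y Z; rewrite !adM.
Qed.

Lemma evA_ad_mulA z a b : evA (ad z (mulA a b)) = \S_(z1, z2 <- Δ z) \S_(X, Y, Z <- Φ)
  evA (ad (X * z1) a) * evA (ad (Y * z2) b) * Z.
Proof.
rewrite -ad_mul (sum2_map _ _ (@evA_lin _ _)); apply: eq_sum2 => z1 z2.
by rewrite evA_mul; apply: eq_sum3 => X Y Z; rewrite !adM.
Qed.

Lemma evT_iso_mulA a b c d :
  evT (iso (mulA a b ⊠ mulA c d)) = \S_(Z, Z', Z'' <- Φ)
  \S_(Z1, Z2 <- Δ Z) \S_(Z3, Z4 <- Δ Z') \S_(V, V', V'' <- Φ) \S_(W, W', W'' <- Φ)
  \S_(V1, V2 <- Δ V'') \S_(V3, V4 <- Δ V2)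
    evl (ad (V * Z1) a) * evl (ad (V' * Z2) b)
    * Δ (evA (ad (V1 * W * Z3) c) * evA (ad (V3 * W' * Z4) d) * (V4 * W'' * Z'')).
Proof.
rewrite evT_iso; apply: eq_sum3 => Z Z' Z''.
rewrite evl_ad_mulA evA_ad_mulA sum2_mull; apply: eq_sum2 => Z1 Z2.
transitivity (\S_(Z3, Z4 <- Δ Z') \S_(V, V', V'' <- Φ) \S_(W, W', W'' <- Φ)
   evl (ad (V * Z1) a) * evl (ad (V' * Z2) b)
    * Δ (V'' * evA (ad (W * Z3) c) * evA (ad (W' * Z4) d) * (W'' * Z''))).
  rewrite sum2_mull (sum2_map _ _ (@cop_lin _ _)) sum2_mulr; apply: eq_sum2 => Z3 Z4.
  rewrite sum3_mull; apply: eq_sum3 => V V' V''.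
  rewrite sum3_mull (sum3_map _ _ (@cop_lin _ _)) sum3_mulr; apply: eq_sum3 => W W' W''.
  by rewrite !copM !mulrA.
apply: eq_sum2 => Z3 Z4; apply: eq_sum3 => V V' V''; apply: eq_sum3 => W W' W''.
step (esym (evA_ad_sum (L := fun e => evl (ad (V * Z1) a) * evl (ad (V' * Z2) b)
    * Δ (e * evA (ad (W' * Z4) d) * (W'' * Z''))) V'' (ad (W * Z3) c) ltac:(lin))).
step (esym (eq_sum2 (Δ V'') (fun V1 V2 => evA_ad_sum (L := fun e =>
    evl (ad (V * Z1) a) * evl (ad (V' * Z2) b)
    * Δ (evA (ad (V1 * W * Z3) c) * e * (W'' * Z''))) V2 (ad (W' * Z4) d) ltac:(lin)))).
by sweedler.
Qed.

Section Coherence.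
Variables a h a' h' : A.
Local Notation K p q r s t c0 :=
  (evl (ad p a) * evl (ad q a') * Δ (evA (ad r c0) * evA (ad s h') * t)).

(* Both sides are the map ((a⊗h)⊗(a'⊗h'))⊗x → a(a'(h(h'x))) that braids h past a' *)
(* once; each step is a pentagon, a naturality square of Φ or of the braiding.  *)
Lemma mult_coherence :
  \S_(X, Y, Z <- Φ) \S_(P, Q, R <- Φ) \S_(x, y, z <- Φ') \S_(p, q, r <- Φ')
  \S_(Z1, Z2 <- Δ Z) \S_(r1, r2 <- Δ r) \S_(c, c0 <- coA (ad (x * Y) h))
  \S_(G, G', G'' <- Φ) \S_(G1, G2 <- Δ G) \S_(G3, G4 <- Δ G')
  \S_(V, V', V'' <- Φ) \S_(W, W', W'' <- Φ) \S_(V1, V2 <- Δ V'') \S_(V3, V4 <- Δ V2)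
    K (V * G1 * p * X) (V' * G2 * q * P * c * y * Z1) (V1 * W * G3 * r1 * Q)
      (V3 * W' * G4 * r2 * R * z * Z2) (V4 * W'' * G'') c0
  = \S_(V, V', V'' <- Φ) \S_(V1, V2 <- Δ V) \S_(V3, V4 <- Δ V') \S_(Y, Y', Y'' <- Φ)
  \S_(Z, Z', Z'' <- Φ) \S_(Y1, Y2 <- Δ Y'') \S_(Y3, Y4 <- Δ Y2)
  \S_(x, y, z <- Φ') \S_(z1, z2 <- Δ z) \S_(W, W', W'' <- Φ) \S_(W1, W2 <- Δ W'')
  \S_(c, c0 <- coA (ad (x * Y' * V2) h))
    K (Y * V1) (W * c * y * Y1 * Z * V3) W' (W1 * z1 * Y3 * Z' * V4)
      (W2 * z2 * Y4 * Z'' * V'') c0.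
Proof.
step (esym (eq_sum3 Φ (fun V V' V'' => coassoc (F := fun u v w =>
  \S_(X, Y, Z <- Φ) \S_(P, Q, R <- Φ) \S_(x, y, z <- Φ') \S_(p, q, r <- Φ')
  \S_(Z1, Z2 <- Δ Z) \S_(r1, r2 <- Δ r) \S_(c, c0 <- coA (ad (x * Y) h))
  \S_(G, G', G'' <- Φ) \S_(G1, G2 <- Δ G) \S_(G3, G4 <- Δ G')
    K (V * G1 * p * X) (V' * G2 * q * P * c * y * Z1) (u * G3 * r1 * Q)
      (v * G4 * r2 * R * z * Z2) (w * G'') c0) V'' ltac:(lin)))).
step (esym (@pent_sum k H _ (fun u v w t =>
  \S_(X, Y, Z <- Φ) \S_(P, Q, R <- Φ) \S_(x, y, z <- Φ') \S_(p, q, r <- Φ')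
  \S_(Z1, Z2 <- Δ Z) \S_(r1, r2 <- Δ r) \S_(c, c0 <- coA (ad (x * Y) h))
  \S_(W, W', W'' <- Φ) \S_(w1, w2 <- Δ w)
    K (u * p * X) (v * q * P * c * y * Z1) (W * w1 * r1 * Q)
      (W' * w2 * r2 * R * z * Z2) (W'' * t) c0) ltac:(lin))).
(* The pentagon has produced a Φ adjacent to the Φ⁻¹ of the braided product, and the two cancel. *)
step (phiK_sum (F := fun u v w =>
  \S_(D, D', D'' <- Φ) \S_(N, N', N'' <- Φ) \S_(N1, N2 <- Δ N')
  \S_(X, Y, Z <- Φ) \S_(P, Q, R <- Φ) \S_(x, y, z <- Φ')
  \S_(Z1, Z2 <- Δ Z) \S_(c, c0 <- coA (ad (x * Y) h))
  \S_(W, W', W'' <- Φ) \S_(w1, w2 <- Δ (D' * N2 * w))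
    K (N * u * X) (D * N1 * v * P * c * y * Z1) (W * w1 * Q)
      (W' * w2 * R * z * Z2) (W'' * D'' * N'') c0)).
step (esym (eq_sum3 Φ (fun N N' N'' => coassoc (F := fun u v w =>
  \S_(D, D', D'' <- Φ)
  \S_(X, Y, Z <- Φ) \S_(x, y, z <- Φ')
  \S_(Z1, Z2 <- Δ Z) \S_(c, c0 <- coA (ad (x * Y) h))
  \S_(W, W', W'' <- Φ) \S_(w1, w2 <- Δ D')
    K (N * X) (D * u * c * y * Z1) (W * w1 * v)
      (W' * w2 * w * z * Z2) (W'' * D'' * N'') c0) N' ltac:(lin)))).
(* Naturality of the braiding: components of Φ standing after the coaction of h are carried back
   into its argument. *)
step (esym (eq_sum3 Φ (fun N N' N'' => eq_sum2 (Δ N') (fun N1 N2 => eq_sum3 Φ (fun X Y Z =>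
  eq_sum3 Φ' (fun x y z => coA_cross (F := fun c c0 =>
  \S_(D, D', D'' <- Φ) \S_(P, Q, R <- Φ)
  \S_(Z1, Z2 <- Δ Z) \S_(W, W', W'' <- Φ) \S_(w1, w2 <- Δ D')
    K (N * X) (D * P * c * y * Z1) (W * w1 * Q)
      (W' * w2 * R * N2 * z * Z2) (W'' * D'' * N'') c0) N1 (ad (x * Y) h) ltac:(lin))))))).
step (@pent_sum k H _ (fun u v w t =>
  \S_(N, N', N'' <- Φ) \S_(N1, N2 <- Δ N') \S_(N3, N4 <- Δ N1)
  \S_(X, Y, Z <- Φ) \S_(x, y, z <- Φ')
  \S_(Z1, Z2 <- Δ Z) \S_(c, c0 <- coA (ad (N3 * x * Y) h))
    K (N * X) (u * c * N4 * y * Z1) v (w * N2 * z * Z2) (t * N'') c0) ltac:(lin)).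
step (esym (eq_sum3 Φ (fun D D' D'' => eq_sum3 Φ (fun N N' N'' => eq_sum2 (Δ N') (fun N1 N2 =>
  eq_sum2 (Δ N1) (fun N3 N4 => eq_sum3 Φ (fun X Y Z =>
  eq_sum3 Φ' (fun x y z => coA_cross (F := fun c c0 =>
  \S_(W, W', W'' <- Φ) \S_(W1, W2 <- Δ W'') \S_(Z1, Z2 <- Δ Z)
    K (N * X) (W * c * N4 * y * Z1) W' (W1 * D' * N2 * z * Z2)
      (W2 * D'' * N'') c0) D (ad (N3 * x * Y) h) ltac:(lin))))))))).
step (esym (eq_sum3 Φ (fun N N' N'' => coassocV (F := fun u v w =>
  \S_(D, D', D'' <- Φ) \S_(D1, D2 <- Δ D) \S_(X, Y, Z <- Φ)
  \S_(W, W', W'' <- Φ) \S_(W1, W2 <- Δ W'') \S_(Z1, Z2 <- Δ Z)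
  \S_(c, c0 <- coA (ad (D1 * u * Y) h))
    K (N * X) (W * c * D2 * v * Z1) W' (W1 * D' * w * Z2)
      (W2 * D'' * N'') c0) N' ltac:(lin)))).
step (@pent_12_3_4_123V_sum k H _ (fun u v w t =>
  \S_(N, N', N'' <- Φ) \S_(N1, N2 <- Δ N') \S_(N3, N4 <- Δ N2) \S_(X, Y, Z <- Φ)
  \S_(W, W', W'' <- Φ) \S_(W1, W2 <- Δ W'') \S_(Z1, Z2 <- Δ Z)
  \S_(c, c0 <- coA (ad (u * N1 * Y) h))
    K (N * X) (W * c * v * N3 * Z1) W' (W1 * w * N4 * Z2)
      (W2 * t * N'') c0) ltac:(lin)).
step (@pent_sum k H _ (fun u v w t =>
  \S_(x, y, z <- Φ') \S_(z1, z2 <- Δ z) \S_(Z, Z', Z'' <- Φ)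
  \S_(W, W', W'' <- Φ) \S_(W1, W2 <- Δ W'') \S_(w1, w2 <- Δ w)
  \S_(c, c0 <- coA (ad (x * v) h))
    K u (W * c * y * Z * w1) W' (W1 * z1 * Z' * w2)
      (W2 * z2 * Z'' * t) c0) ltac:(lin)).
step (eq_sum3 Φ (fun Y Y' Y'' => coassoc (F := fun u v w =>
  \S_(V, V', V'' <- Φ) \S_(V1, V2 <- Δ V) \S_(V3, V4 <- Δ V')
  \S_(x, y, z <- Φ') \S_(z1, z2 <- Δ z)
  \S_(W, W', W'' <- Φ) \S_(W1, W2 <- Δ W'')
  \S_(c, c0 <- coA (ad (x * Y' * V2) h))
    K (Y * V1) (W * c * y * u * V3) W' (W1 * z1 * v * V4)
      (W2 * z2 * w * V'') c0) Y'' ltac:(lin))).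
by sweedler.
Qed.

End Coherence.
End ProductCoherence.

Section CanonicalMapMultiplicative.
Variables (k : fieldType) (H : quasiHopfAlgType k).
Local Notation A := (alg_of H).
Local Notation T := (tens A A).
Local Notation Δ := (@cop k H).
Local Notation Φ := (phi H).
Local Notation Φ' := (phiV H).
Local Notation coA := (@coA k H).

Definition mulT : T -> T -> T := mul Δ.

Let ΔM : forall x y, Δ (x * y) = Δ x * Δ y := @copM k H.
Let Δ_lin : lin Δ := @cop_lin k H.

Lemma evT_lin : lin (@evT k H). Proof. exact: ev_lin. Qed.
Lemma adT_lin g : lin (@adT k H g). Proof. exact: act_lin. Qed.
Lemma mulT_lin t : lin (mulT t). Proof. by rewrite /mulT /mul; lin. Qed.
Lemma mulT_linl t : lin (fun s => mulT s t). Proof. by rewrite /mulT /mul; lin. Qed.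
Lemma bmul_lin t : lin (@bmul k H t). Proof. by rewrite /bmul; lin. Qed.
Lemma bmul_linl t : lin (fun s => @bmul k H s t). Proof. by rewrite /bmul; lin. Qed.
Lemma bact_lin g : lin (@bact k H g). Proof. by rewrite /bact; lin. Qed.
#[local] Hint Resolve evT_lin adT_lin mulT_lin bmul_lin bact_lin : linear_db.
Ltac lin_ext ::= first [apply: (lin_comp (eps_lin _)) | apply: (lin_comp (ad_linl _))
  | apply: (lin_comp (mulA_linl _)) | apply: (lin_comp (mulT_linl _))
  | apply: (lin_comp (bmul_linl _))].

Lemma evT_iso_bmul_tp a h a' h' :
  evT (iso (bmul (a ⊠ h) (a' ⊠ h'))) = evT (mulT (iso (a ⊠ h)) (iso (a' ⊠ h'))).
Proof.
transitivity (
  \S_(X, Y, Z <- Φ) \S_(P, Q, R <- Φ) \S_(x, y, z <- Φ') \S_(p, q, r <- Φ')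
  \S_(Z1, Z2 <- Δ Z) \S_(r1, r2 <- Δ r) \S_(c, c0 <- coA (ad (x * Y) h))
  evT (iso (mulA (ad (p * X) a) (ad (q * P * c * y * Z1) a')
    ⊠ mulA (ad (r1 * Q) c0) (ad (r2 * R * z * Z2) h')))).
  have l : lin (fun t => evT (@iso k H t)) by lin.
  rewrite bmul_tp.
  do 4!(rewrite (sum3_map _ _ l); apply: eq_sum3 => ? ? ?).
  by do 3!(rewrite (sum2_map _ _ l); apply: eq_sum2 => ? ?).
refine (eq_trans (eq_sum3 _ (fun X Y Z => eq_sum3 _ (fun P Q R => eq_sum3 _ (fun x y z =>
   eq_sum3 _ (fun p q r => eq_sum2 _ (fun Z1 Z2 => eq_sum2 _ (fun r1 r2 => eq_sum2 _ (fun c c0 =>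
    evT_iso_mulA _ _ _ _)))))))) _).
refine (eq_trans (eq_trans _ (mult_coherence a h a' h')) _); first by sweedler.
(* On this side the product is a composition of four actions, in the order a, h, a', h'; h has to be
   moved past a'. *)
apply: esym; rewrite [LHS](ev_mul Δ_lin ΔM).
transitivity (\S_(V, V', V'' <- Φ) \S_(V1, V2 <- Δ V) \S_(V3, V4 <- Δ V')
  \S_(X, Y, Z <- Φ) \S_(X', Y', Z' <- Φ)
  evl (ad (X * V1) a) * Δ (evA (ad (Y * V2) h)) * (Δ Z * evl (ad (X' * V3) a'))
  * Δ (evA (ad (Y' * V4) h') * Z' * V'')).
  apply: eq_sum3 => V V' V''.
  rewrite -[act Δ V _]iso_ad -[act Δ V' _]iso_ad.
  rewrite (sum2_map _ _ (f := ev Δ)); last exact: ev_lin.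
  rewrite !sum2_mull; apply: eq_sum2 => V1 V2.
  rewrite (sum2_map _ _ (f := ev Δ)); last exact: ev_lin.
  rewrite sum2_mulr sum2_mull; apply: eq_sum2 => V3 V4.
  rewrite [ev Δ _]evT_iso [X in _ * X * _]evT_iso !sum3_mull; apply: eq_sum3 => X Y Z.
  rewrite sum3_mulr sum3_mull; apply: eq_sum3 => X' Y' Z'.
  by rewrite !adM !copM !mulrA.
step (esym (eq_sum3 Φ (fun V V' V'' => eq_sum2 (Δ V) (fun V1 V2 => eq_sum2 (Δ V') (fun V3 V4 =>
  eq_sum3 Φ (fun X Y Z => eq_sum3 Φ (fun X' Y' Z' => evl_ad_sum (L := fun m =>
  evl (ad (X * V1) a) * Δ (evA (ad (Y * V2) h)) * m
  * Δ (evA (ad (Y' * V4) h') * Z' * V'')) Z (ad (X' * V3) a') ltac:(lin)))))))).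
(* The only crossing of h with a'; it creates the coaction of h found in the braided product. *)
step (eq_sum3 Φ (fun V V' V'' => eq_sum2 (Δ V) (fun V1 V2 => eq_sum2 (Δ V') (fun V3 V4 =>
  eq_sum3 Φ (fun X Y Z => eq_sum3 Φ (fun X' Y' Z' => eq_sum2 (Δ Z) (fun Z1 Z2 =>
  cop_evA_evl_sum (L := fun m =>
  evl (ad (X * V1) a) * m * Δ (Z2 * evA (ad (Y' * V4) h') * Z' * V''))
  (ad (Y * V2) h) (ad (Z1 * X' * V3) a') ltac:(lin)))))))).
step (esym (eq_sum3 Φ (fun V V' V'' => eq_sum2 (Δ V) (fun V1 V2 => eq_sum2 (Δ V') (fun V3 V4 =>
  eq_sum3 Φ (fun X Y Z => eq_sum3 Φ (fun X' Y' Z' => eq_sum2 (Δ Z) (fun Z1 Z2 =>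
  eq_sum3 Φ' (fun x y z => eq_sum3 Φ (fun P Q R => evA_ad_sum (L := fun e =>
  \S_(c, c0 <- coA (ad (x * Y * V2) h))
  evl (ad (X * V1) a) * evl (ad (P * c * y * Z1 * X' * V3) a')
  * Δ (evA (ad Q c0) * e * Z' * V'')) (R * z * Z2) (ad (Y' * V4) h') ltac:(lin))))))))))).
by sweedler.
Qed.

Lemma iso_bact (g : A) (t : T) : iso (bact g t) = adT g (iso t).
Proof.
move: t; apply: tens_lin_eq; [by lin | by lin | move=> a h].
by rewrite bact_tp (sum2_map _ _ (@iso_lin k H)) iso_ad.
Qed.

Lemma evT_iso_bmul (s t : T) : evT (iso (bmul s t)) = evT (mulT (iso s) (iso t)).
Proof.
move: s; apply: tens_lin_eq; [by lin | by lin | move=> a h].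
move: t; apply: tens_lin_eq; [by lin | by lin | move=> a' h'].
exact: evT_iso_bmul_tp.
Qed.

Lemma bact_bmul (g : A) (s t : T) :
  \S_(g1, g2 <- Δ g) bmul (bact g1 s) (bact g2 t) = bact g (bmul s t).
Proof.
move: s; apply: tens_lin_eq; [by lin | by lin | move=> a h].
move: t; apply: tens_lin_eq; [by lin | by lin | move=> a' h'].
exact: bact_bmul_tp.
Qed.

(** Equality of actions is not yet equality of elements: [ev_rec] also asks for the actions of
    translates. Since [iso] and both products are H-linear, these are again images of products,
    covered by [evT_iso_bmul]. *)
Lemma iso_mul (s t : T) : iso (bmul s t) = mulT (iso s) (iso t).
Proof.
rewrite -[LHS](ev_rec Δ_lin ΔM (@cop_one k H)) -[RHS](ev_rec Δ_lin ΔM (@cop_one k H)).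
apply: eq_sum3 => x y z; congr (_ * _).
rewrite -[act Δ x _]iso_bact -bact_bmul (sum2_map _ _ (@iso_lin k H)).
rewrite -[act Δ x _](act_mul Δ_lin ΔM).
rewrite !(sum2_map _ _ (evT_lin : lin (ev Δ))); apply: eq_sum2 => x1 x2.
by have := evT_iso_bmul (bact x1 s) (bact x2 t); rewrite !iso_bact.
Qed.

End CanonicalMapMultiplicative.

#[local] Hint Resolve evT_lin adT_lin mulT_lin bmul_lin bact_lin : linear_db.

(** * Colinearity *)

Section BraidedCoaction.
Variables (k : fieldType) (H : quasiHopfAlgType k).
Local Notation A := (alg_of H).
Local Notation T := (tens A A).
Local Notation Δ := (@cop k H).
Local Notation Φ := (phi H).
Local Notation Φ' := (phiV H).
Local Notation coA := (@coA k H).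

Let ΔM : forall x y, Δ (x * y) = Δ x * Δ y := @copM k H.
Let Δ_lin : lin Δ := @cop_lin k H.

Definition λT (b : T) : tens A T := Φ * cop_id Δ b * Φ'.

Lemma λT_lin : lin λT.
Proof. by rewrite /λT; lin. Qed.

Lemma λTM s t : λT (s * t) = λT s * λT t.
Proof.
by rewrite /λT cop_id_morph !mulrA -[X in _ = X * _ * _]mulrA phiVK -!tp1 mulr1.
Qed.

Lemma λT_cop h : λT (Δ h) = \S_(h1, h2 <- Δ h) h1 ⊠ Δ h2.
Proof. by rewrite /λT -copA. Qed.

Definition coT : T -> tens A T := coact Δ λT.

Lemma λT_tp a b : λT (a ⊠ b) = \S_(V, V', V'' <- Φ) \S_(a1, a2 <- Δ a) \S_(x, y, z <- Φ')
   (V * a1 * x) ⊠ ((V' * a2 * y) ⊠ (V'' * b * z)).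
Proof.
rewrite /λT /cop_id sum2_tp; last by lin.
rewrite -{1}(sum3_id Φ) -{1}(sum3_id Φ') !sum3_mull; apply: eq_sum3 => V V' V''.
rewrite sum2_mulr sum2_mull; apply: eq_sum2 => a1 a2; rewrite sum3_mulr.
by apply: eq_sum3 => x y z; rewrite !tpM.
Qed.

(** Conjugation by Φ in [λT] reassociates N ⊗ (X ⊗ Y), so that a acts on N ⊗ X through Δ. By
    [cop_evA_sum] this is braiding a past N and acting on X; pentagons reassemble [evl]. *)
Lemma λT_evl a : λT (evl a) = \S_(z, z', z'' <- Φ') \S_(W, W', W'' <- Φ)
  \S_(c, c0 <- coA (ad z a)) (W * c * z') ⊠ (evl (ad W' c0) * Δ (W'' * z'')).
Proof.
transitivity (\S_(x, y, z <- Φ') \S_(V, V', V'' <- Φ) \S_(w, w', w'' <- Φ') \S_(y1, y2 <- Δ y)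
  \S_(e1, e2 <- Δ (evA (ad x a)))
  (V * e1 * y1 * w) ⊠ ((V' * e2 * y2 * w') ⊠ (V'' * z * w''))).
  rewrite evl_evA (sum3_map _ _ λT_lin); apply: eq_sum3 => x y z; rewrite λT_tp.
  by sweedler.
refine (eq_trans (eq_sum3 _ (fun x y z => eq_sum3 _ (fun V V' V'' => eq_sum3 _ (fun w w' w'' =>
  eq_sum2 _ (fun y1 y2 => cop_evA_sum (F := fun e1 e2 =>
  (V * e1 * y1 * w) ⊠ ((V' * e2 * y2 * w') ⊠ (V'' * z * w''))) (ad x a) ltac:(lin)))))) _).
step (esym (eq_sum3 Φ' (fun x y z => eq_sum3 Φ (fun V V' V'' => eq_sum3 Φ' (fun w w' w'' =>
  eq_sum2 (Δ y) (fun y1 y2 => eq_sum3 Φ' (fun p p' p'' => eq_sum3 Φ (fun P P' P'' =>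
  eq_sum2 (coA (ad (p * x) a)) (fun c c0 => evA_ad_sum (L := fun e =>
  (V * P * c * p' * y1 * w) ⊠ ((e * P'' * p'' * y2 * w') ⊠ (V'' * z * w'')))
   V' (ad P' c0) ltac:(lin)))))))))).
step (@pentV_sum k H _ (fun u v w t => \S_(V, V', V'' <- Φ) \S_(P, P', P'' <- Φ)
  \S_(V1, V2 <- Δ V') \S_(c, c0 <- coA (ad u a))
  (V * P * c * v) ⊠ ((evA (ad (V1 * P') c0) * V2 * P'' * w) ⊠ (V'' * t))) ltac:(lin)).
step (eq_sum3 Φ' (fun x y z => eq_sum3 Φ' (fun x' y' z' =>
  coA_cross (F := fun c c0 => \S_(V, V', V'' <- Φ) \S_(P, P', P'' <- Φ)
  \S_(V1, V2 <- Δ V') \S_(z1, z2 <- Δ z')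
  (V * P * c * y') ⊠ ((evA (ad (V1 * P') c0) * V2 * P'' * y * z1) ⊠ (V'' * z * z2)))
  x (ad x' a) ltac:(lin)))).
step (esym (@pent_234V_1_2_34_sum k H _ (fun u v w t => \S_(x', y', z' <- Φ') \S_(z1, z2 <- Δ z')
  \S_(c, c0 <- coA (ad x' a))
  (u * c * y') ⊠ ((evA (ad v c0) * w * z1) ⊠ (t * z2))) ltac:(lin))).
apply: esym.
refine (eq_trans (eq_sum3 _ (fun z z' z'' => eq_sum3 _ (fun W W' W'' => eq_sum2 _ (fun c c0 =>
  congr1 (fun m => (W * c * z') ⊠ (m * Δ (W'' * z''))) (evl_evA (ad W' c0)))))) _).
transitivity (\S_(z, z', z'' <- Φ') \S_(W, W', W'' <- Φ) \S_(c, c0 <- coA (ad z a))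
  \S_(x, y, w <- Φ') (W * c * z') ⊠ (((evA (ad x (ad W' c0)) * y) ⊠ w) * Δ (W'' * z''))).
  do 2!apply: eq_sum3 => ? ? ?; apply: eq_sum2 => ? ?; rewrite sum3_mull sum3_tpr.
  by apply: eq_sum3.
refine (eq_trans (eq_sum3 _ (fun z z' z'' => eq_sum3 _ (fun W W' W'' => eq_sum2 _ (fun c c0 =>
  eq_sum3 _ (fun x y w => congr1 (fun m => (W * c * z') ⊠ m) (tp_cop _ _ _)))))) _).
by sweedler.
Qed.

Definition bcoact (t : T) : tens A T :=
  \S_(a, h <- t) \S_(X, X', X'' <- Φ) \S_(Y, Y', Y'' <- Φ) \S_(x, x', x'' <- Φ')
  \S_(c, c0 <- coA (ad (x * Y) a)) \S_(d, d0 <- coA (ad Y' h))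
  (X * c * x' * d * Y'') ⊠ (ad X' c0 ⊠ ad (X'' * x'') d0).

Lemma bcoact_tp a h : bcoact (a ⊠ h) =
  \S_(X, X', X'' <- Φ) \S_(Y, Y', Y'' <- Φ) \S_(x, x', x'' <- Φ')
  \S_(c, c0 <- coA (ad (x * Y) a)) \S_(d, d0 <- coA (ad Y' h))
  (X * c * x' * d * Y'') ⊠ (ad X' c0 ⊠ ad (X'' * x'') d0).
Proof. by rewrite /bcoact sum2_tp; [|lin]. Qed.

(** The Yetter-Drinfeld compatibility of the tensor product coaction, from that of each factor and
    naturality of Φ; it is one of the premises of [coact_uniq] in [coT_iso]. *)
Lemma bcoact_bact_tp g a h :
  \S_(g1, g2 <- Δ g) bcoact (bact g1 (a ⊠ h)) * (g2 ⊠ 1)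
  = \S_(g1, g2 <- Δ g) \S_(t1, t0 <- bcoact (a ⊠ h)) (g1 * t1) ⊠ bact g2 t0.
Proof.
transitivity (\S_(g1, g2 <- Δ g) \S_(g11, g12 <- Δ g1)
  \S_(X, X', X'' <- Φ) \S_(Y, Y', Y'' <- Φ) \S_(x, x', x'' <- Φ')
  \S_(c, c0 <- coA (ad (x * Y * g11) a)) \S_(d, d0 <- coA (ad (Y' * g12) h))
  (X * c * x' * d * Y'' * g2) ⊠ (ad X' c0 ⊠ ad (X'' * x'') d0)).
  apply: eq_sum2 => g1 g2; rewrite bact_tp.
  rewrite (sum2_map _ _ (f := fun t => bcoact t * _)); last by rewrite /bcoact; lin.
  apply: eq_sum2 => g11 g12; rewrite bcoact_tp.
  transitivity (\S_(X, X', X'' <- Φ) \S_(Y, Y', Y'' <- Φ) \S_(x, x', x'' <- Φ')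
  \S_(c, c0 <- coA (ad (x * Y * g11) a)) \S_(d, d0 <- coA (ad (Y' * g12) h))
  ((X * c * x' * d * Y'') ⊠ (ad X' c0 ⊠ ad (X'' * x'') d0)) * (g2 ⊠ 1)); first by sweedler.
  do 3!apply: eq_sum3 => ? ? ?; do 2!apply: eq_sum2 => ? ?.
  by rewrite tpM mulr1.
step (coassoc (F := fun u v w =>
  \S_(X, X', X'' <- Φ) \S_(x, x', x'' <- Φ')
  \S_(c, c0 <- coA (ad (x * u) a)) \S_(d, d0 <- coA (ad v h))
  (X * c * x' * d * w) ⊠ (ad X' c0 ⊠ ad (X'' * x'') d0)) g ltac:(lin)).
step (eq_sum2 (Δ g) (fun g1 g2 => eq_sum3 Φ (fun Y Y' Y'' =>
  coA_cross (F := fun d d0 => \S_(X, X', X'' <- Φ) \S_(x, x', x'' <- Φ')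
  \S_(c, c0 <- coA (ad (x * g1 * Y) a))
  (X * c * x' * d * Y'') ⊠ (ad X' c0 ⊠ ad (X'' * x'') d0)) g2 (ad Y' h) ltac:(lin)))).
step (coassocV (F := fun u v w =>
  \S_(X, X', X'' <- Φ) \S_(Y, Y', Y'' <- Φ)
  \S_(c, c0 <- coA (ad (u * Y) a)) \S_(d, d0 <- coA (ad Y' h))
  (X * c * v * d * Y'') ⊠ (ad X' c0 ⊠ ad (X'' * w) d0)) g ltac:(lin)).
step (eq_sum2 (Δ g) (fun g1 g2 => eq_sum3 Φ (fun Y Y' Y'' => eq_sum3 Φ' (fun x x' x'' =>
  coA_cross (F := fun c c0 => \S_(X, X', X'' <- Φ) \S_(d, d0 <- coA (ad Y' h))
  (X * c * x' * d * Y'') ⊠ (ad X' c0 ⊠ ad (X'' * g2 * x'') d0)) g1 (ad (x * Y) a) ltac:(lin))))).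
step (coassoc (F := fun u v w =>
  \S_(Y, Y', Y'' <- Φ) \S_(x, x', x'' <- Φ')
  \S_(c, c0 <- coA (ad (x * Y) a)) \S_(d, d0 <- coA (ad Y' h))
  (u * c * x' * d * Y'') ⊠ (ad v c0 ⊠ ad (w * x'') d0)) g ltac:(lin)).
apply: esym.
transitivity (\S_(g1, g2 <- Δ g)
  \S_(X, X', X'' <- Φ) \S_(Y, Y', Y'' <- Φ) \S_(x, x', x'' <- Φ')
  \S_(c, c0 <- coA (ad (x * Y) a)) \S_(d, d0 <- coA (ad Y' h))
  (g1 * (X * c * x' * d * Y'')) ⊠ bact g2 (ad X' c0 ⊠ ad (X'' * x'') d0)).
  by apply: eq_sum2 => g1 g2; rewrite bcoact_tp; sweedler.
refine (eq_trans (eq_sum2 _ (fun g1 g2 => eq_sum3 _ (fun X X' X'' => eq_sum3 _ (fun Y Y' Y'' =>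
  eq_sum3 _ (fun x x' x'' => eq_sum2 _ (fun c c0 => eq_sum2 _ (fun d d0 =>
  congr1 (fun m => (g1 * (X * c * x' * d * Y'')) ⊠ m) (bact_tp _ _ _)))))))) _).
by sweedler.
Qed.

End BraidedCoaction.

Section CanonicalMapColinear.
Variables (k : fieldType) (H : quasiHopfAlgType k).
Local Notation A := (alg_of H).
Local Notation T := (tens A A).
Local Notation Δ := (@cop k H).
Local Notation Φ := (phi H).
Local Notation Φ' := (phiV H).
Local Notation coA := (@coA k H).
Local Notation iso := (@iso k H).
Local Notation coT := (@coT k H).
Local Notation λT := (@λT k H).
Local Notation bcoact := (@bcoact k H).

Let ΔM : forall x y, Δ (x * y) = Δ x * Δ y := @copM k H.
Let Δ_lin : lin Δ := @cop_lin k H.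
Let λl : lin λT := @λT_lin k H.
#[local] Hint Resolve λT_lin : linear_db.

Lemma bcoact_lin : lin bcoact.
Proof. by rewrite /bcoact; lin. Qed.
Lemma coT_lin : lin coT.
Proof. exact: coact_lin. Qed.
#[local] Hint Resolve bcoact_lin coT_lin : linear_db.

Lemma bcoact_bact g t :
  \S_(g1, g2 <- Δ g) bcoact (bact g1 t) * (g2 ⊠ 1)
  = \S_(g1, g2 <- Δ g) \S_(t1, t0 <- bcoact t) (g1 * t1) ⊠ bact g2 t0.
Proof.
move: t; apply: tens_lin_eq; [by lin | by lin | move=> a h].
exact: bcoact_bact_tp.
Qed.

Section Coherence.
Variables a h : A.
Local Notation M n1 c n2 d n3 r c0 s d0 t :=
  ((n1 * c * n2 * d * n3) ⊠ (evl (ad r c0) * Δ (evA (ad s d0) * t))).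

(* Both sides are the map ((a⊗h)⊗n)⊗x → n⊗(a(h x)) that braids h, then a, past n. *)
Lemma coact_coherence :
  \S_(W, W', W'' <- Φ) \S_(X, X', X'' <- Φ) \S_(Y, Y', Y'' <- Φ) \S_(x, x', x'' <- Φ')
  \S_(c, c0 <- coA (ad (x * Y) a)) \S_(d, d0 <- coA (ad Y' h))
  \S_(W1, W2 <- Δ W') \S_(V, V', V'' <- Φ)
    M (W * X) c x' d Y'' (V * W1 * X') c0 (V' * W2 * X'' * x'') d0 (V'' * W'')
  = \S_(V, V', V'' <- Φ) \S_(V1, V2 <- Δ V) \S_(X, X', X'' <- Φ) \S_(X1, X2 <- Δ X'')
  \S_(z, z', z'' <- Φ') \S_(W, W', W'' <- Φ) \S_(c, c0 <- coA (ad (z * X * V1) a))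
  \S_(p, p', p'' <- Φ') \S_(P, P', P'' <- Φ) \S_(d, d0 <- coA (ad (p * X' * V2) h))
  \S_(W1, W2 <- Δ W'') \S_(z1, z2 <- Δ z'')
    M W c (z' * P) d (p' * X1 * V') W' c0 (W1 * z1 * P') d0 (W2 * z2 * P'' * p'' * X2 * V'').
Proof.
step (@pent_sum k H _ (fun u v w t =>
  \S_(Y, Y', Y'' <- Φ) \S_(x, x', x'' <- Φ')
  \S_(c, c0 <- coA (ad (x * Y) a)) \S_(d, d0 <- coA (ad Y' h))
    M u c x' d Y'' v c0 (w * x'') d0 t) ltac:(lin)).
step (esym (eq_sum3 Φ (fun P P' P'' => eq_sum3 Φ (fun R R' R'' => eq_sum3 Φ (fun Y Y' Y'' =>
  eq_sum3 Φ' (fun x x' x'' => coA_cross (F := fun c c0 =>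
  \S_(P1, P2 <- Δ P'') \S_(d, d0 <- coA (ad Y' h))
    M P c x' d Y'' P' c0 (P1 * R' * x'') d0 (P2 * R'')) R (ad (x * Y) a) ltac:(lin))))))).
step (@pent_12_3_4_123V_sum k H _ (fun u v w t =>
  \S_(P, P', P'' <- Φ) \S_(Y, Y', Y'' <- Φ)
  \S_(P1, P2 <- Δ P'') \S_(c, c0 <- coA (ad (u * Y) a)) \S_(d, d0 <- coA (ad Y' h))
    M P c v d Y'' P' c0 (P1 * w) d0 (P2 * t)) ltac:(lin)).
step (esym (eq_sum3 Φ (fun Q Q' Q'' => eq_sum3 Φ (fun Y Y' Y'' =>
  coA_cross (F := fun d d0 =>
  \S_(P, P', P'' <- Φ) \S_(P1, P2 <- Δ P'') \S_(z, z', z'' <- Φ') \S_(z1, z2 <- Δ z'')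
  \S_(G, G', G'' <- Φ) \S_(c, c0 <- coA (ad (z * Q * Y) a))
    M P c (z' * G) d Y'' P' c0 (P1 * z1 * G') d0 (P2 * z2 * G'' * Q'')) Q' (ad Y' h) ltac:(lin))))).
step (@pent_1_23_4_123_sum k H _ (fun u v w t =>
  \S_(P, P', P'' <- Φ) \S_(P1, P2 <- Δ P'') \S_(z, z', z'' <- Φ') \S_(z1, z2 <- Δ z'')
  \S_(G, G', G'' <- Φ) \S_(c, c0 <- coA (ad (z * u) a)) \S_(d, d0 <- coA (ad v h))
    M P c (z' * G) d w P' c0 (P1 * z1 * G') d0 (P2 * z2 * G'' * t)) ltac:(lin)).
by sweedler.
Qed.

End Coherence.

Definition id_iso (t : tens A T) : tens A T := \S_(t1, t0 <- t) t1 ⊠ iso t0.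

Lemma id_iso_lin : lin id_iso.
Proof. by rewrite /id_iso; lin. Qed.
#[local] Hint Resolve id_iso_lin : linear_db.

Lemma co_ev_bcoact a h :
  co_ev Δ (id_iso (bcoact (a ⊠ h))) =
  \S_(W, W', W'' <- Φ) \S_(X, X', X'' <- Φ) \S_(Y, Y', Y'' <- Φ) \S_(x, x', x'' <- Φ')
  \S_(c, c0 <- coA (ad (x * Y) a)) \S_(d, d0 <- coA (ad Y' h))
  \S_(W1, W2 <- Δ W') \S_(V, V', V'' <- Φ)
    (W * X * c * x' * d * Y'')
    ⊠ (evl (ad (V * W1 * X') c0) * Δ (evA (ad (V' * W2 * X'' * x'') d0) * (V'' * W''))).
Proof.
transitivity (\S_(X, X', X'' <- Φ) \S_(Y, Y', Y'' <- Φ) \S_(x, x', x'' <- Φ')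
  \S_(c, c0 <- coA (ad (x * Y) a)) \S_(d, d0 <- coA (ad Y' h))
  co_ev Δ ((X * c * x' * d * Y'') ⊠ iso (ad X' c0 ⊠ ad (X'' * x'') d0))).
  have l : lin (fun t => co_ev Δ (id_iso t)) by apply: lin_comp; [apply: co_ev_lin | lin].
  rewrite bcoact_tp.
  do 3!(rewrite (sum3_map _ _ l); apply: eq_sum3 => ? ? ?).
  do 2!(rewrite (sum2_map _ _ l); apply: eq_sum2 => ? ?).
  by rewrite /id_iso sum2_tp; [|lin].
transitivity (\S_(X, X', X'' <- Φ) \S_(Y, Y', Y'' <- Φ) \S_(x, x', x'' <- Φ')
  \S_(c, c0 <- coA (ad (x * Y) a)) \S_(d, d0 <- coA (ad Y' h)) \S_(W, W', W'' <- Φ)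
  \S_(W1, W2 <- Δ W') \S_(V, V', V'' <- Φ)
    (W * (X * c * x' * d * Y''))
    ⊠ (evl (ad (V * W1 * X') c0) * Δ (evA (ad (V' * W2 * X'' * x'') d0) * V'') * Δ W''));
  last by sweedler.
do 3!apply: eq_sum3 => ? ? ?; do 2!apply: eq_sum2 => ? ?.
rewrite co_ev_tp //; apply: eq_sum3 => W W' W''.
rewrite -[act Δ W' _]iso_ad (sum2_map _ _ (@evT_lin k H : lin (ev Δ))) sum2_mull sum2_tpr.
apply: eq_sum2 => W1 W2.
rewrite [ev Δ _]evT_iso sum3_mull sum3_tpr; apply: eq_sum3 => V V' V''.
by rewrite -!adM !mulrA.
Qed.

(** By [co_ev_coact] the coaction may be replaced by λ of the action. As λ is multiplicative, a and
    h pass N separately, a by [λT_evl] and h by [cop_evA_sum]. *)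
Lemma co_ev_coT a h :
  co_ev Δ (coT (iso (a ⊠ h))) =
  \S_(V, V', V'' <- Φ) \S_(V1, V2 <- Δ V) \S_(X, X', X'' <- Φ) \S_(X1, X2 <- Δ X'')
  \S_(z, z', z'' <- Φ') \S_(W, W', W'' <- Φ) \S_(c, c0 <- coA (ad (z * X * V1) a))
  \S_(p, p', p'' <- Φ') \S_(P, P', P'' <- Φ) \S_(d, d0 <- coA (ad (p * X' * V2) h))
  \S_(W1, W2 <- Δ W'') \S_(z1, z2 <- Δ z'')
    (W * c * (z' * P) * d * (p' * X1 * V'))
    ⊠ (evl (ad W' c0) * Δ (evA (ad (W1 * z1 * P') d0) * (W2 * z2 * P'' * p'' * X2 * V''))).
Proof.
rewrite (co_ev_coact Δ_lin ΔM λl (@λTM k H) (@λT_cop k H)).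
transitivity (\S_(V, V', V'' <- Φ) \S_(V1, V2 <- Δ V) \S_(X, X', X'' <- Φ)
  λT (evl (ad (X * V1) a)) * λT (Δ (evA (ad (X' * V2) h) * X'')) * (V' ⊠ Δ V'')).
  apply: eq_sum3 => V V' V''.
  rewrite -[act Δ V _]iso_ad (sum2_map _ _ (@evT_lin k H : lin (ev Δ))).
  rewrite (sum2_map _ _ λl) sum2_mull; apply: eq_sum2 => V1 V2.
  rewrite [ev Δ _]evT_iso (sum3_map _ _ λl) sum3_mull; apply: eq_sum3 => X X' X''.
  by rewrite λTM !adM.
transitivity (\S_(V, V', V'' <- Φ) \S_(V1, V2 <- Δ V) \S_(X, X', X'' <- Φ)
  \S_(z, z', z'' <- Φ') \S_(W, W', W'' <- Φ) \S_(c, c0 <- coA (ad (z * X * V1) a))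
  \S_(X1, X2 <- Δ X'') \S_(e1, e2 <- Δ (evA (ad (X' * V2) h)))
  (W * c * z' * e1 * X1 * V') ⊠ (evl (ad W' c0) * Δ (W'' * z'' * e2 * X2 * V''))).
  apply: eq_sum3 => V V' V''; apply: eq_sum2 => V1 V2; apply: eq_sum3 => X X' X''.
  transitivity (\S_(z, z', z'' <- Φ') \S_(W, W', W'' <- Φ) \S_(c, c0 <- coA (ad (z * X * V1) a))
  \S_(X1, X2 <- Δ X'') \S_(e1, e2 <- Δ (evA (ad (X' * V2) h)))
  ((W * c * z') ⊠ (evl (ad W' c0) * Δ (W'' * z'')))
   * ((e1 * X1) ⊠ Δ (e2 * X2)) * (V' ⊠ Δ V'')).
    rewrite λT_evl λT_cop; by sweedler.
  refine (eq_trans (eq_sum3 _ (fun z z' z'' => eq_sum3 _ (fun W W' W'' => eq_sum2 _ (fun c c0 =>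
   eq_sum2 _ (fun X1 X2 => eq_sum2 _ (fun e1 e2 => eq_trans (congr1 (fun m => m * _) (tpM _ _ _ _))
     (tpM _ _ _ _))))))) _).
  by sweedler.
step (eq_sum3 Φ (fun V V' V'' => eq_sum2 (Δ V) (fun V1 V2 => eq_sum3 Φ (fun X X' X'' =>
  cop_evA_sum (F := fun e1 e2 =>
  \S_(z, z', z'' <- Φ') \S_(W, W', W'' <- Φ) \S_(c, c0 <- coA (ad (z * X * V1) a))
  \S_(X1, X2 <- Δ X'')
  (W * c * z' * e1 * X1 * V') ⊠ (evl (ad W' c0) * Δ (W'' * z'' * e2 * X2 * V'')))
  (ad (X' * V2) h) ltac:(lin))))).
step (esym (eq_sum3 Φ (fun V V' V'' => eq_sum2 (Δ V) (fun V1 V2 => eq_sum3 Φ (fun X X' X'' =>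
  eq_sum3 Φ' (fun p p' p'' => eq_sum3 Φ (fun P P' P'' =>
  eq_sum2 (coA (ad (p * X' * V2) h)) (fun d d0 =>
  eq_sum3 Φ' (fun z z' z'' => eq_sum3 Φ (fun W W' W'' => evA_ad_sum (L := fun e =>
  \S_(c, c0 <- coA (ad (z * X * V1) a)) \S_(X1, X2 <- Δ X'')
  (W * c * z' * P * d * p' * X1 * V')
   ⊠ (evl (ad W' c0) * Δ (e * P'' * p'' * X2 * V''))) (W'' * z'') (ad P' d0) ltac:(lin))))))))))).
by sweedler.
Qed.

(** Both sides satisfy the Yetter-Drinfeld compatibility, so by [coact_uniq] they may be compared as
    operators on N ⊗ X, where [coact_coherence] applies. *)
Lemma coT_iso t : coT (iso t) = id_iso (bcoact t).
Proof.
have cop1' := @cop_one k H.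
apply: (coact_uniq Δ_lin ΔM cop1' (ac := @bact k H)
  (f := fun t => coT (iso t)) (g := fun t => id_iso (bcoact t))).
- move=> g u.
  refine (eq_trans (eq_sum2 _ (fun g1 g2 => congr1 (fun m => coT m * _) (iso_bact g1 u))) _).
  exact: (coact_act Δ_lin ΔM λl (@λTM k H) (@λT_cop k H)).
- move=> g u.
  have E := eq_trans (esym (sum2_map _ _ id_iso_lin))
    (eq_trans (congr1 id_iso (bcoact_bact g u)) (sum2_map _ _ id_iso_lin)).
  refine (eq_trans (eq_trans _ E) _); apply: eq_sum2 => g1 g2.
    move: (bcoact _); apply: tens_lin_eq; [by lin | by lin | move=> x y].
    by rewrite tpM /id_iso !sum2_tp ?tpM ?mulr1; lin.
  have aT : lin (act Δ g2) := @adT_lin k H g2.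
  move: (bcoact u); apply: tens_lin_eq; [by lin | by lin | move=> x y].
  rewrite sum2_tp; last by lin.
  rewrite /id_iso !sum2_tp; [by rewrite iso_bact | by lin..].
move=> u; move: u; apply: tens_lin_eq.
- by apply: lin_comp; [apply: co_ev_lin | lin].
- by apply: lin_comp; [apply: co_ev_lin | lin].
move=> a h; rewrite co_ev_bcoact co_ev_coT coact_coherence.
by sweedler.
Qed.

End CanonicalMapColinear.

(** * Comparison with the definitions of the statement *)

Ltac leaf_ext ::= rewrite ?antM ?antK.
Ltac sum_ext ::= fail.

Section Comparison.
Variables (k : fieldType) (H : quasiHopfAlgType k).
Local Notation A := (alg_of H).
Local Notation T := (tens A A).
Transparent alg_of tens tp sum2 sum3 sum4 cop ant antV eps al be phi phiV ad evA mulA coA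
  del SS twistV.

(** Unsealed, the working operations are convertible to those of the statement; opacity is switched
    back on wherever a Sweedler computation is needed. *)
Lemma twist_del : twist_delta H = del H :> T.
Proof.
transitivity (sum4 (fun a b c d : A => (a * be H * ant d) ⊠ (b * be H * ant c))
   (leg12_3_4 (@cop k H) (phi H) * leg123 (phiV H)) : T).
  exact: (@tens_fold4 k H (@comult k H) (reassoc H) (reassocV H)).
Opaque tens tp sum2 sum3 sum4 cop ant phi phiV be alg_of.
by rewrite /del; sweedler.
Qed.

Transparent tens tp sum2 sum3 sum4 cop ant phi phiV be alg_of.
Lemma drinfeld_twistV_twistV : drinfeld_twistV H = twistV H :> T.
Proof.
by rewrite /drinfeld_twistV twist_del.
Qed.

Lemma HH_coactE b : HH_coact (H := H) b = λT b.
Proof. exact: (@tens_conj k H (@comult k H) (reassoc H) (reassocV H) b). Qed.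

Lemma twisted_coactE (B : algType k) (v : {lrmorphism H -> B}) (λ : B -> H ⊗ B) b :
  twisted_coact v λ b = coact (H := H) v λ b.
Proof.
rewrite /twisted_coact drinfeld_twistV_twistV.
(* [q_R] is written out so that the antipode cancels S⁻¹ in its second component, by [antK] in
   [leaf_ext]. *)
transitivity (\S_(X, Y, Z <- phi H) \S_(X', Y', Z' <- phi H) \S_(X1, X2 <- cop X')
  \S_(Y1, Y2 <- cop Y')
  \S_(Q, R <- \S_(Q, R, T <- phi H) (Q ⊠ (antV (al H * T) * R)))
  \S_(g, g' <- twistV H) \S_(b1, b0 <- (λ b : tens A B))
    (X * X1 * b1 * g * ant (R * Y2) * Z')
    ⊠ (v (Y * X2) * b0 * v (g' * ant (Z * Q * Y1)))).
  reflexivity.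
Opaque alg_of tens tp sum2 sum3 sum4 cop ant antV eps al be phi phiV ad evA mulA coA
  del SS twistV.
have lv : lin (v : A -> B) := lin_linear v.
rewrite /coact.
do 2!apply: eq_sum3 => ? ? ?; do 2!apply: eq_sum2 => ? ?.
by eapply eq_trans; [norm_sums | apply: esym; eapply eq_trans; [norm_sums | reflexivity]].
Qed.

Transparent alg_of tens tp sum2 sum3 sum4 cop ant antV eps al be phi phiV ad evA mulA coA
  del SS twistV.

(** The action, product and unit agree by conversion. The coactions agree only pointwise, so
    functional extensionality is used to equate the records. *)
Lemma H0E : H0 H = @YDAlgData k H H (@ad k H) (@coA k H) (@mulA k H) (be H).
Proof.
have e : twisted_coact (idfun : {lrmorphism H -> H}) (@comult k H)
    = (@coA k H :> (H -> H ⊗ H)).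
  by apply: boolp.funext => b; exact: twisted_coactE.
by rewrite /H0 /twisted_algebra e.
Qed.

Lemma HH_DeltaE : HH_Delta H =
  @YDAlgData k H (H ⊗ H)%type (@adT k H) (@coT k H) (@mulT k H) (cop (be H)).
Proof.
have e : (@HH_coact k H) = (@λT k H :> (H ⊗ H -> H ⊗ H ⊗ H)).
  by apply: boolp.funext => c; exact: HH_coactE.
have e' : twisted_coact (@comult k H) (@HH_coact k H)
    = (@coT k H :> (H ⊗ H -> H ⊗ H ⊗ H)).
  rewrite e; apply: boolp.funext => b; exact: (twisted_coactE (@comult k H)).
by rewrite /HH_Delta /twisted_algebra e'.
Qed.

Lemma iso_linear : linear (@iso k H : H ⊗ H -> H ⊗ H).
Proof. exact: iso_lin. Qed.

HB.instance Definition _ :=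
  GRing.isLinear.Build k (H ⊗ H)%type (H ⊗ H)%type _
    (@iso k H : H ⊗ H -> H ⊗ H) iso_linear.

End Comparison.

Theorem proposition5p8 (k : fieldType) (H : quasiHopfAlgType k) :
  yd_algebra_isomorphic (braided_tensor (H0 H) (H0 H)) (HH_Delta H).
Proof.
rewrite H0E HH_DeltaE.
exists (@iso k H : H ⊗ H -> H ⊗ H).
split.
- exact: iso_bij.
- move=> h a; exact: (iso_bact (H := H)).
- move=> a; exact: (coT_iso (H := H)).
- exact: (iso_one H).
- move=> a a'; exact: (iso_mul (H := H)).
Qed.
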